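(* Let $\Delta=\{x^2+y^2\le1\}\subset\mathbb{R}^2$, let $\Sigma,\Sigma_1\subset\mathbb{R}^3$ be smooth compact embedded surfaces diffeomorphic to $\Delta$, and let $\mathbf{X}:\Delta\to\Sigma$, $\mathbf{Y}:\Delta\to\Sigma_1$ be conformal diffeomorphisms with conformal factors $\mu,\eta>0$, i.e. $G_{\mathbf X}=\mu I$ and $G_{\mathbf Y}=\eta I$ on $\Delta$. Let $\Phi\in O(\Sigma,\Sigma_1)$ and let $\mathbf Q=\mathbf Y\circ\Phi^{-1}\circ\mathbf X^{-1}:\Sigma\to\Sigma_1$. Then $\mathbf Q$, with this decomposition, is a quasi-rigid deformation if and only if $\Phi$ satisfies (i) $\mathrm{Im}\,\partial_{\bar z}\Big\{\eta^{-1}\,\partial_{\bar z}\big(\mu^2(\Phi)\,f_\Phi\big)\Big\}=0$ on $\Delta$; (ii) $\mathrm{Im}\Big(f_\Phi\,\dfrac{dz}{d\bar z}\Big)=0$ on $\partial\Delta$.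
   Context: Points $(x,y)\in\Delta$ are identified with $z=x+iy$, and $\partial_{\bar z}=\tfrac12(\partial_x+i\partial_y)$. All maps and functions are smooth up to the boundary. For a parameterization $\mathbf X:\Delta\to\mathbb{R}^3$, $G_{\mathbf X}=\begin{pmatrix}\|\mathbf X_x\|^2&\langle\mathbf X_x,\mathbf X_y\rangle\\ \langle\mathbf X_x,\mathbf X_y\rangle&\|\mathbf X_y\|^2\end{pmatrix}$, and $I$ is the $2\times2$ identity matrix. $\mathrm{Diff}(\Delta)$ is the set of diffeomorphisms of $\Delta$ onto itself. For $\Phi=(\phi_1,\phi_2)\in\mathrm{Diff}(\Delta)$, $$D\Phi=\begin{pmatrix}\partial_x\phi_1&\partial_x\phi_2\\ \partial_y\phi_1&\partial_y\phi_2\end{pmatrix},\qquad |D\Phi|^2=D\Phi\,(D\Phi)^{T}.$$ Define $$O(\Sigma,\Sigma_1)=\{\Phi\in\mathrm{Diff}(\Delta):\ \mu(\Phi(x,y))\det(D\Phi_{(x,y)})=\eta(x,y)\ \ \forall (x,y)\in\Delta\},$$ $$\hat H_\Delta(\Phi)=\int_\Delta\mu^2(\Phi)\,\mathrm{tr}\big(|D\Phi|^2\big)\,dx\,dy ,$$ and the Hopf function $f_\Phi=|\Phi_y|^2-|\Phi_x|^2+2i\,(\Phi_x\cdot\Phi_y)$. On $\partial\Delta$, $dz/d\bar z$ denotes the quotient $\tau/\bar\tau$, where $\tau\in\mathbb{C}$ is a unit tangent vector to $\partial\Delta$ at the point considered. Quasi-rigidity: given $\Phi\in O(\Sigma,\Sigma_1)$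 and $\psi\in C^\infty(\Delta;\mathbb{R})$ with $\psi\equiv0$ on $\partial\Delta$, let $\vec v=(v_1,v_2)$ be given by $v_1+iv_2=i\,\eta^{-1}\partial_{\bar z}\psi$ and let $\Phi^{(t)}$ solve $\partial_t\Phi^{(t)}=v_1\Phi^{(t)}_x+v_2\Phi^{(t)}_y$, $\Phi^{(0)}=\Phi$. The map $\mathbf Q=\mathbf Y\circ\Phi^{-1}\circ\mathbf X^{-1}$ (with $\mathbf X,\mathbf Y$ conformal diffeomorphisms as in the claim) is called quasi-rigid, with this decomposition, if $\frac{d}{dt}\hat H_\Delta(\Phi^{(t)})\big|_{t=0}=0$ for every such $\psi$. *)

(* Defs.v *)
From Stdlib Require Import Reals.
From Coquelicot Require Import Coquelicot.

Open Scope R_scope.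

Definition R2 : Type := (R * R)%type.
Definition R3 : Type := (R * R * R)%type.

Definition disk (p : R2) : Prop := fst p ^ 2 + snd p ^ 2 <= 1.
Definition boundary_disk (p : R2) : Prop := fst p ^ 2 + snd p ^ 2 = 1.

(** [D h] is the derivative in the direction [h].  For finite-dimensional [U],
    having continuous iterated directional derivatives of all orders is the
    usual notion of a C^oo map on the whole of [U]. *)
Fixpoint Ck {U V : NormedModule R_AbsRing} (k : nat) (f : U -> V) : Prop :=
  (forall x : U, continuous f x) /\
  match k with
  | O => True
  | S j => exists D : U -> U -> V,
      (forall h x : U, is_derive (fun s : R => f (plus x (scal s h))) 0 (D h x)) /\
      (forall h : U, Ck j (D h))
  end.

(** A map that is smooth up to the boundary of a closed set such as [disk] is
    the restriction of a smooth map of the ambient space; it is represented by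
    such an extension.  On [disk] its partial derivatives of all orders do not
    depend on the extension, since [disk] is the closure of its interior. *)
Definition smooth {U V : NormedModule R_AbsRing} (f : U -> V) : Prop :=
  forall k : nat, Ck k f.

Definition inverse_on {U V : Type} (A : U -> Prop) (B : V -> Prop)
    (f : U -> V) (g : V -> U) : Prop :=
  (forall u, A u -> B (f u) /\ g (f u) = u) /\
  (forall v, B v -> A (g v) /\ f (g v) = v).

(** Diffeomorphism between subsets of Euclidean spaces: a smooth bijection with
    smooth inverse, smoothness on a subset being that of an extension. *)
Definition diffeo {U V : NormedModule R_AbsRing} (A : U -> Prop) (B : V -> Prop)
    (f : U -> V) : Prop :=
  smooth f /\ exists g : V -> U, smooth g /\ inverse_on A B f g.

(** A subset of R^3 diffeomorphic, as a subset, to [disk] is exactly a smooth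
    compact embedded surface (with boundary) diffeomorphic to [disk]. *)
Definition embedded_disk (S : R3 -> Prop) : Prop :=
  exists E : R2 -> R3, diffeo disk S E.

Definition dx (f : R2 -> R) (p : R2) : R := Derive (fun s => f (s, snd p)) (fst p).
Definition dy (f : R2 -> R) (p : R2) : R := Derive (fun s => f (fst p, s)) (snd p).

Definition dx2 (F : R2 -> R2) (p : R2) : R2 :=
  (dx (fun q => fst (F q)) p, dx (fun q => snd (F q)) p).
Definition dy2 (F : R2 -> R2) (p : R2) : R2 :=
  (dy (fun q => fst (F q)) p, dy (fun q => snd (F q)) p).

Definition dx3 (F : R2 -> R3) (p : R2) : R3 :=
  (dx (fun q => fst (fst (F q))) p, dx (fun q => snd (fst (F q))) p,
   dx (fun q => snd (F q)) p).
Definition dy3 (F : R2 -> R3) (p : R2) : R3 :=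
  (dy (fun q => fst (fst (F q))) p, dy (fun q => snd (fst (F q))) p,
   dy (fun q => snd (F q)) p).

Definition dot2 (a b : R2) : R := fst a * fst b + snd a * snd b.
Definition dot3 (a b : R3) : R :=
  fst (fst a) * fst (fst b) + snd (fst a) * snd (fst b) + snd a * snd b.

(** 2x2 real matrices, as pairs of rows. *)
Definition M2 : Type := (R2 * R2)%type.
Definition m2id : M2 := ((1, 0), (0, 1)).
Definition m2scal (c : R) (A : M2) : M2 :=
  ((c * fst (fst A), c * snd (fst A)), (c * fst (snd A), c * snd (snd A))).
Definition m2tr (A : M2) : R := fst (fst A) + snd (snd A).
Definition m2det (A : M2) : R :=
  fst (fst A) * snd (snd A) - snd (fst A) * fst (snd A).
Definition m2T (A : M2) : M2 :=
  ((fst (fst A), fst (snd A)), (snd (fst A), snd (snd A))).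
Definition m2mul (A B : M2) : M2 :=
  ((dot2 (fst A) (fst (m2T B)), dot2 (fst A) (snd (m2T B))),
   (dot2 (snd A) (fst (m2T B)), dot2 (snd A) (snd (m2T B)))).

Definition gram (X : R2 -> R3) (p : R2) : M2 :=
  ((dot3 (dx3 X p) (dx3 X p), dot3 (dx3 X p) (dy3 X p)),
   (dot3 (dx3 X p) (dy3 X p), dot3 (dy3 X p) (dy3 X p))).

Definition conformal_diffeo (S : R3 -> Prop) (X : R2 -> R3) (mu : R2 -> R) : Prop :=
  diffeo disk S X /\ smooth mu /\
  forall p, disk p -> 0 < mu p /\ gram X p = m2scal (mu p) m2id.

Definition Diff_disk (Phi : R2 -> R2) : Prop := diffeo disk disk Phi.

(** First row the x-derivatives, second row the y-derivatives. *)
Definition Jac (Phi : R2 -> R2) (p : R2) : M2 := (dx2 Phi p, dy2 Phi p).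

(** The set O(Sigma, Sigma_1), for the conformal factors [mu] and [eta]. *)
Definition OSigma (mu eta : R2 -> R) (Phi : R2 -> R2) : Prop :=
  Diff_disk Phi /\
  forall p, disk p -> mu (Phi p) * m2det (Jac Phi p) = eta p.

(** Double integral over [disk] of a continuous function, as an iterated one. *)
Definition int_disk (F : R2 -> R) : R :=
  RInt (fun x => RInt (fun y => F (x, y)) (- sqrt (1 - x ^ 2)) (sqrt (1 - x ^ 2)))
       (-1) 1.

Definition Hhat (mu : R2 -> R) (Phi : R2 -> R2) : R :=
  int_disk (fun p => mu (Phi p) ^ 2 * m2tr (m2mul (Jac Phi p) (m2T (Jac Phi p)))).

Definition dbar (F : R2 -> C) (p : R2) : C :=
  Cmult (RtoC (/ 2))
    (Cplus (dx (fun q => Re (F q)) p, dx (fun q => Im (F q)) p)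
           (Cmult Ci (dy (fun q => Re (F q)) p, dy (fun q => Im (F q)) p))).

Definition hopf (Phi : R2 -> R2) (p : R2) : C :=
  (dot2 (dy2 Phi p) (dy2 Phi p) - dot2 (dx2 Phi p) (dx2 Phi p),
   2 * dot2 (dx2 Phi p) (dy2 Phi p)).

Definition unit_tangent (p : R2) (tau : C) : Prop :=
  Cmod tau = 1 /\ Re tau * fst p + Im tau * snd p = 0.

(** [Q] is Y o Phi^-1 o X^-1 on [S]. *)
Definition decomposition (S : R3 -> Prop) (X Y : R2 -> R3) (Phi : R2 -> R2)
    (Q : R3 -> R3) : Prop :=
  exists (Xinv : R3 -> R2) (Phiinv : R2 -> R2),
    inverse_on disk S X Xinv /\ inverse_on disk disk Phi Phiinv /\
    forall s, S s -> Q s = Y (Phiinv (Xinv s)).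

(** v_1 + i v_2. *)
Definition vfield (eta psi : R2 -> R) (p : R2) : C :=
  Cmult Ci (Cmult (RtoC (/ eta p)) (dbar (fun q => RtoC (psi q)) p)).

(** [W t], for |t| < eps, is a smooth family of maps of [disk] to itself
    solving the transport equation along v with initial value [Phi]. *)
Definition transport_solution (eta psi : R2 -> R) (Phi : R2 -> R2)
    (eps : R) (W : R -> R2 -> R2) : Prop :=
  smooth (fun q : R * R2 => W (fst q) (snd q)) /\
  (forall p, disk p -> W 0 p = Phi p) /\
  (forall t p, Rabs t < eps -> disk p ->
     disk (W t p) /\
     is_derive (fun s : R => W s p) t
       (plus (scal (Re (vfield eta psi p)) (dx2 (W t) p))
             (scal (Im (vfield eta psi p)) (dy2 (W t) p)))).

Definition quasi_rigid (S : R3 -> Prop) (X Y : R2 -> R3) (mu eta : R2 -> R)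
    (Phi : R2 -> R2) (Q : R3 -> R3) : Prop :=
  decomposition S X Y Phi Q /\
  forall psi : R2 -> R,
    smooth psi -> (forall p, boundary_disk p -> psi p = 0) ->
    forall (eps : R) (W : R -> R2 -> R2),
      0 < eps -> transport_solution eta psi Phi eps W ->
      is_derive (fun t : R => Hhat mu (W t)) 0 0.

(* Main.v *)
Require Import Defs.
From Stdlib Require Import Reals.
From Coquelicot Require Import Coquelicot.
From Stdlib Require Import Lra Lia Psatz FunctionalExtensionality IndefiniteDescription.

(** Write M = mu^2(Phi), M f_Phi = A + i B, and let v be the field of psi.
    Along the transport equation the energy density e = M tr|DPhi|^2 changes by
      div(e v) - A (d_x v1 - d_y v2) + B (d_x v2 + d_y v1),
    that is div(e v) - 2 Re(M f_Phi dbar(v1 + i v2)) ([energy_variation]).  Moving the derivatives from v onto A + i B, and then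
    from psi onto eta^-1 dbar(A + i B), leaves
      2 psi Im dbar(eta^-1 dbar(M f_Phi)) + div Z
    ([variation_density]).  Since psi vanishes on the circle, v is tangent to it
    and the flux of Z is a positive multiple of d_n psi times
    2 A x y + B (x^2 - y^2) = - M Im(f_Phi dz/dzbar) ([flux_boundary]).  With the
    divergence theorem on the disk ([divergence_disk]) this gives
      dH/dt = int psi D + int_circle (d_n psi / 2 eta) b,
    where D = 0 is condition (i) and b = 0 is condition (ii)
    ([first_variation]).  So (i) and (ii) imply quasi-rigidity.

    For the converse one needs enough functions psi for which the transport
    equation does have a smooth solution.  No general flow theorem is used: psi is
    taken to be h(u), where u = |z - a|^2 / |1 - conj(a) z|^2 and |a| < 1.  The
    level curves of u are the orbits of R_s, the conjugate of the rotation of angle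
    s by a Moebius automorphism of the disk, so the flow of v is
    R_{sigma(t,p)}(p) for a change of time sigma, and sigma is the solution of one
    scalar equation int_0^sigma k(R_s p) ds = h'(u(p)) t, to which a
    one-dimensional implicit function theorem applies ([implicit_function],
    [time_changed_flow], [mobius_transport]).

    Taking for h a bump with support near 0 localises int psi D at a, whence
    D = 0 in the disk ([interior_density_zero]).  Then h(s) = s - 1 leaves only the
    circle, and there d_n u is twice the Poisson kernel of a; letting a tend to a
    point of the circle gives b = 0 ([poisson_concentration],
    [boundary_density_zero]).

    The functions eta and mu are positive on the disk only, so 1 / eta is replaced
    throughout by 1 / n with n smooth, bounded below on the whole plane, and equal
    to eta near every point of the disk ([positive_smooth_extension]). *)

(** * Directional derivatives and the algebra of smooth functions *)

Definition line {U : NormedModule R_AbsRing} (x h : U) (s : R) : U := plus x (scal s h).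

(** The derivative of [f] at [x] in the direction [h]; being total, it can serve
    as the canonical family of derivatives in [Ck]. *)
Definition pd {U : NormedModule R_AbsRing} (h : U) (f : U -> R) (x : U) : R :=
  Derive (fun s => f (line x h s)) 0.

Section Lines.
Context {U : NormedModule R_AbsRing}.

Lemma line_0 (x h : U) : line x h 0 = x.
Proof.
  unfold line. transitivity (plus x (@zero U)).
  - f_equal. exact (scal_zero_l h).
  - apply plus_zero_r.
Qed.

Lemma line_line (x h : U) (s r : R) : line (line x h s) h r = line x h (s + r).
Proof.
  unfold line. rewrite <- plus_assoc. f_equal.
  symmetry. exact (scal_distr_r s r h).
Qed.

Lemma line_continuous (x h : U) (s : R) : continuous (line x h) s.
Proof.
  apply (continuous_plus (fun _ : R => x) (fun r : R => scal r h)).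
  - apply continuous_const.
  - apply (continuous_scal_l (fun r : R => r)). apply continuous_id.
Qed.

Lemma Ck_0_iff (f : U -> R) : Ck 0 f <-> forall x, continuous f x.
Proof. simpl. tauto. Qed.

(** The derivative family of [Ck] is unique, hence equal to [pd]: every induction
    on the order of smoothness goes through this form. *)
Lemma Ck_S_iff (k : nat) (f : U -> R) :
  Ck (S k) f <->
  (forall x, continuous f x) /\
  (forall h x, is_derive (fun s : R => f (line x h s)) 0 (pd h f x)) /\
  (forall h, Ck k (pd h f)).
Proof.
  split.
  - intros [Hc [D [HD HC]]].
    assert (E : forall h, pd h f = D h).
    { intros h. apply functional_extensionality. intros x.
      unfold pd. apply is_derive_unique. exact (HD h x). }
    split. exact Hc. split.
    + intros h x. rewrite E. exact (HD h x).
    + intros h. rewrite E. apply HC.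
  - intros [Hc [HD HC]]. split. exact Hc.
    exists (fun h => pd h f). split; auto.
Qed.

Lemma Ck_weaken {V : NormedModule R_AbsRing} (k : nat) :
  forall f : U -> V, Ck (S k) f -> Ck k f.
Proof.
  induction k as [|k IH]; intros f [Hc [D [HD HC]]].
  - split; auto.
  - split. exact Hc. exists D. split. exact HD. intros h. apply IH, HC.
Qed.

Lemma Ck_continuous {V : NormedModule R_AbsRing} (k : nat) (f : U -> V) (x : U) :
  Ck k f -> continuous f x.
Proof. destruct k; intros [H _]; apply H. Qed.

Lemma smooth_continuous {V : NormedModule R_AbsRing} (f : U -> V) (x : U) :
  smooth f -> continuous f x.
Proof. intros H. exact (Ck_continuous 0 f x (H 0%nat)). Qed.

Lemma smooth_continuous_R (f : U -> R) (x : U) : smooth f -> continuous f x.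
Proof. exact (smooth_continuous f x). Qed.

Lemma pd_eq (f : U -> R) (h x : U) (l : R) :
  is_derive (fun s : R => f (line x h s)) 0 l -> pd h f x = l.
Proof. intros H. now apply is_derive_unique. Qed.

Lemma smooth_is_derive (f : U -> R) (h x : U) :
  smooth f -> is_derive (fun s : R => f (line x h s)) 0 (pd h f x).
Proof. intros H. apply (proj1 (Ck_S_iff 0 f) (H 1%nat)). Qed.

Lemma smooth_pd (f : U -> R) (h : U) : smooth f -> smooth (pd h f).
Proof. intros H k. apply (proj1 (Ck_S_iff k f) (H (S k))). Qed.

Lemma is_derive_line (f : U -> R) (x h : U) (s : R) :
  (forall y, is_derive (fun r : R => f (line y h r)) 0 (pd h f y)) ->
  is_derive (fun r : R => f (line x h r)) s (pd h f (line x h s)).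
Proof.
  intros H.
  apply (is_derive_ext (fun r => f (line (line x h s) h (r - s)))).
  { intros t. rewrite line_line. do 2 f_equal. ring. }
  evar_last.
  - apply (is_derive_comp (fun r => f (line (line x h s) h r)) (fun r => r - s)).
    + replace (s - s) with 0 by ring. apply H.
    + auto_derive. trivial. reflexivity.
  - apply Rmult_1_l.
Qed.

Lemma smooth_is_derive_line (f : U -> R) (x h : U) (s : R) :
  smooth f -> is_derive (fun r : R => f (line x h r)) s (pd h f (line x h s)).
Proof. intros H. apply is_derive_line. intros y. now apply smooth_is_derive. Qed.

Lemma Ck_const {V : NormedModule R_AbsRing} (k : nat) : forall c : V, Ck k (fun _ : U => c).
Proof.
  induction k as [|k IH]; intros c.
  - split; [|exact I]. intros x. apply continuous_const.
  - split. intros x. apply continuous_const.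
    exists (fun _ _ => zero). split. intros h x. apply (is_derive_const c 0). intros h. apply IH.
Qed.

Lemma Ck_plus (k : nat) : forall f g : U -> R,
  Ck k f -> Ck k g -> Ck k (fun x => f x + g x).
Proof.
  induction k as [|k IH]; intros f g Hf Hg.
  - apply Ck_0_iff. intros x.
    apply (continuous_plus f g); eapply Ck_continuous; eassumption.
  - apply Ck_S_iff in Hf. apply Ck_S_iff in Hg.
    destruct Hf as [cf [df Cf]], Hg as [cg [dg Cg]]. split.
    + intros x. apply (continuous_plus f g); auto.
    + exists (fun h x => pd h f x + pd h g x). split.
      * intros h x. apply (is_derive_plus (fun s => f (line x h s)) (fun s => g (line x h s))); auto.
      * intros h. apply (IH (pd h f) (pd h g)); auto.
Qed.

Lemma Ck_mult (k : nat) : forall f g : U -> R,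
  Ck k f -> Ck k g -> Ck k (fun x => f x * g x).
Proof.
  induction k as [|k IH]; intros f g Hf Hg.
  - apply Ck_0_iff. intros x.
    apply (continuous_mult f g); [exact (Ck_continuous 0 f x Hf) | exact (Ck_continuous 0 g x Hg)].
  - assert (Hf' := Ck_weaken k f Hf). assert (Hg' := Ck_weaken k g Hg).
    apply Ck_S_iff in Hf. apply Ck_S_iff in Hg.
    destruct Hf as [cf [df Cf]], Hg as [cg [dg Cg]]. split.
    + intros x. apply (continuous_mult f g); auto.
    + exists (fun h x => pd h f x * g x + f x * pd h g x). split.
      * intros h x. evar_last.
        apply (is_derive_mult (fun s => f (line x h s)) (fun s => g (line x h s))); auto.
        intros; apply Rmult_comm.
        rewrite line_0. reflexivity.
      * intros h. apply (Ck_plus k (fun x => pd h f x * g x) (fun x => f x * pd h g x));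
        apply IH; auto.
Qed.

Lemma Ck_inv (k : nat) : forall f : U -> R,
  (forall x, f x <> 0) -> Ck k f -> Ck k (fun x => / f x).
Proof.
  induction k as [|k IH]; intros f H0 Hf.
  - apply Ck_0_iff. intros x.
    apply (continuous_comp f Rinv). exact (Ck_continuous 0 f x Hf).
    apply continuous_Rinv; auto.
  - assert (Hf' := Ck_weaken k f Hf).
    apply Ck_S_iff in Hf.
    destruct Hf as [cf [df Cf]]. split.
    + intros x. apply (continuous_comp f Rinv); auto.
      apply continuous_Rinv; auto.
    + exists (fun h x => (-1 * pd h f x) * (/ f x * / f x)). split.
      * intros h x. evar_last.
        apply (is_derive_inv (fun s => f (line x h s))); auto.
        rewrite line_0. cbn. field. auto.
      * intros h. apply Ck_mult. apply Ck_mult. apply (Ck_const k (-1)). auto.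
        apply Ck_mult; auto.
Qed.

Lemma Ck_linear {V : NormedModule R_AbsRing} (k : nat) (l : U -> V) : is_linear l -> Ck k l.
Proof.
  intros Hl.
  assert (C : forall x, continuous l x).
  { intros x. exact (linear_cont l x Hl). }
  destruct k. split; [exact C|exact I].
  split. exact C. exists (fun h _ => l h). split.
  - intros h x. apply (is_derive_ext (fun s : R => plus (l x) (scal s (l h)))).
    + intros t. symmetry. etransitivity. apply (linear_plus l Hl). f_equal. apply (linear_scal l Hl).
    + evar_last. apply (is_derive_plus (fun _ => l x)). apply is_derive_const.
      apply filterdiff_linear. apply (is_linear_scal_l (l h)).
      apply plus_zero_l.
  - intros h. apply Ck_const.
Qed.

Lemma smooth_const (c : R) : smooth (fun _ : U => c).
Proof. intros k. apply Ck_const. Qed.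
Lemma smooth_plus (f g : U -> R) : smooth f -> smooth g -> smooth (fun x => f x + g x).
Proof. intros Hf Hg k. now apply Ck_plus. Qed.
Lemma smooth_mult (f g : U -> R) : smooth f -> smooth g -> smooth (fun x => f x * g x).
Proof. intros Hf Hg k. now apply Ck_mult. Qed.
Lemma smooth_inv (f : U -> R) : (forall x, f x <> 0) -> smooth f -> smooth (fun x => / f x).
Proof. intros H0 Hf k. now apply Ck_inv. Qed.
Lemma smooth_opp (f : U -> R) : smooth f -> smooth (fun x => - f x).
Proof.
  intros Hf. replace (fun x => - f x) with (fun x => -1 * f x).
  now apply smooth_mult; [apply smooth_const|].
  apply functional_extensionality. intros x. ring.
Qed.
Lemma smooth_minus (f g : U -> R) : smooth f -> smooth g -> smooth (fun x => f x - g x).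
Proof. intros Hf Hg. apply smooth_plus; [|apply smooth_opp]; assumption. Qed.
Lemma smooth_pow (f : U -> R) (n : nat) : smooth f -> smooth (fun x => f x ^ n).
Proof.
  intros Hf. induction n; simpl. apply smooth_const. now apply smooth_mult.
Qed.

Lemma pd_plus (f g : U -> R) (h x : U) : smooth f -> smooth g ->
  pd h (fun y => f y + g y) x = pd h f x + pd h g x.
Proof.
  intros Hf Hg. apply pd_eq.
  apply (is_derive_plus (fun s => f (line x h s)) (fun s => g (line x h s)));
  now apply smooth_is_derive.
Qed.
Lemma pd_mult (f g : U -> R) (h x : U) : smooth f -> smooth g ->
  pd h (fun y => f y * g y) x = pd h f x * g x + f x * pd h g x.
Proof.
  intros Hf Hg. apply pd_eq. evar_last.
  apply (is_derive_mult (fun s => f (line x h s)) (fun s => g (line x h s)));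
  try now apply smooth_is_derive. intros; apply Rmult_comm.
  rewrite line_0. reflexivity.
Qed.
Lemma pd_opp (f : U -> R) (h x : U) : smooth f -> pd h (fun y => - f y) x = - pd h f x.
Proof.
  intros Hf. apply pd_eq. apply (is_derive_opp (fun s => f (line x h s))).
  now apply smooth_is_derive.
Qed.
Lemma pd_minus (f g : U -> R) (h x : U) : smooth f -> smooth g ->
  pd h (fun y => f y - g y) x = pd h f x - pd h g x.
Proof.
  intros Hf Hg. unfold Rminus. rewrite (pd_plus f (fun y => - g y)); auto.
  rewrite pd_opp; auto. now apply smooth_opp.
Qed.

(** A derivative depends only on the germ; it is used to replace a global smooth
    extension by the original formula. *)
Lemma pd_ext_loc (f g : U -> R) (h x : U) :
  locally x (fun y => f y = g y) -> pd h f x = pd h g x.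
Proof.
  intros H. unfold pd. apply Derive_ext_loc.
  apply (line_continuous x h 0 (fun y => f y = g y)). now rewrite line_0.
Qed.
End Lines.

Lemma Ck_comp_linear {U V : NormedModule R_AbsRing} (k : nat) (l : U -> V) :
  is_linear l -> forall f : V -> R, Ck k f -> Ck k (fun x => f (l x)).
Proof.
  intros Hl.
  assert (C : forall x, continuous l x).
  { intros x. exact (linear_cont l x Hl). }
  induction k as [|k IH]; intros f Hf.
  - apply Ck_0_iff. intros x. apply (continuous_comp l f). apply C. exact (Ck_continuous 0 f (l x) Hf).
  - apply Ck_S_iff in Hf. destruct Hf as [cf [df Cf]]. split.
    + intros x. apply continuous_comp; auto.
    + exists (fun h x => pd (l h) f (l x)). split.
      * intros h x. apply (is_derive_ext (fun s : R => f (line (l x) (l h) s))).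
        -- intros s. unfold line. rewrite (linear_plus l Hl).
           rewrite (linear_scal l Hl). reflexivity.
        -- apply df.
      * intros h. apply (IH (pd (l h) f)). auto.
Qed.

Lemma is_derive_linear_comp {V W : NormedModule R_AbsRing} (l : V -> W) (F : R -> V)
    (s : R) (d : V) :
  is_linear l -> is_derive F s d -> is_derive (fun r => l (F r)) s (l d).
Proof.
  intros Hl HF. unfold is_derive.
  apply (filterdiff_ext_lin _ (fun y : R => l (scal y d))).
  apply (filterdiff_comp' F l s (fun y : R => scal y d) l). exact HF.
  now apply filterdiff_linear.
  intros y. now rewrite (linear_scal l Hl).
Qed.

Lemma Ck_linear_comp {U V W : NormedModule R_AbsRing} (k : nat) (l : V -> W) :
  is_linear l -> forall f : U -> V, Ck k f -> Ck k (fun x => l (f x)).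
Proof.
  intros Hl.
  assert (C : forall x, continuous l x).
  { intros x. exact (linear_cont l x Hl). }
  induction k as [|k IH]; intros f Hf.
  - split; [|exact I]. intros x. apply (continuous_comp f l). exact (Ck_continuous 0 f x Hf). apply C.
  - destruct Hf as [cf [D [df Cf]]]. split.
    + intros x. apply continuous_comp; auto.
    + exists (fun h x => l (D h x)). split.
      * intros h x. apply (is_derive_linear_comp l). exact Hl. apply df.
      * intros h. apply (IH (D h)). auto.
Qed.

Lemma is_derive_pair {V W : NormedModule R_AbsRing} (f : R -> V) (g : R -> W)
    (s : R) (df : V) (dg : W) :
  is_derive f s df -> is_derive g s dg ->
  is_derive (fun r => (f r, g r)) s (df, dg).
Proof.
  intros Hf Hg. unfold is_derive.
  apply (filterdiff_ext_lin _ (fun y : R => (scal y df, scal y dg))); [|reflexivity].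
  apply (filterdiff_comp'_2 f g (fun a b => (a, b)) s
             (fun y : R => scal y df) (fun y : R => scal y dg) (fun a b => (a, b))).
  exact Hf. exact Hg.
  apply (filterdiff_ext_lin _ (fun z => z)); [|now intros []].
  apply (filterdiff_ext (fun z => z)); [now intros []|].
  apply filterdiff_id.
Qed.

Lemma Ck_pair {U V W : NormedModule R_AbsRing} (k : nat) : forall (f : U -> V) (g : U -> W),
  Ck k f -> Ck k g -> Ck k (fun x => (f x, g x)).
Proof.
  induction k as [|k IH]; intros f g Hf Hg.
  - split; [|exact I]. intros x.
    apply (continuous_comp_2 f g (fun a b => (a, b))).
    exact (Ck_continuous 0 f x Hf). exact (Ck_continuous 0 g x Hg).
    apply (continuous_ext (fun z => z)). now intros []. apply continuous_id.
  - destruct Hf as [cf [D [df Cf]]], Hg as [cg [D' [dg Cg]]]. split.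
    + intros x. apply (continuous_comp_2 f g (fun a b => (a, b))); auto.
      apply (continuous_ext (fun z => z)). now intros []. apply continuous_id.
    + exists (fun h x => (D h x, D' h x)). split.
      * intros h x.
        apply (is_derive_pair (fun s : R => f (plus x (scal s h))) (fun s : R => g (plus x (scal s h)))).
        apply df. apply dg.
      * intros h. apply (IH (D h) (D' h)); auto.
Qed.

(** * The chain rule in three variables *)

(** Split the increment of [f] into a step along the real factor and a step along
    [V].  The first is, by the mean value theorem, the partial derivative at a
    nearby point, and its continuity makes the error negligible.  Iterating this
    turns continuous directional derivatives into Frechet differentiability. *)
Lemma filterdiff_prod_step {V : NormedModule R_AbsRing} (f : R * V -> R)
    (p0 : R * V) (l : V -> R) :
  (forall p, is_derive (fun s : R => f (line p (1, zero) s)) 0 (pd (1, zero) f p)) ->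
  continuous (pd (1, zero) f) p0 ->
  filterdiff (fun y : V => f (fst p0, y)) (locally (snd p0)) l ->
  filterdiff f (locally p0) (fun h => fst h * pd (1, zero) f p0 + l (snd h)).
Proof.
  destruct p0 as [x0 y0]. cbn [fst snd]. intros Hd Hc [Ll Hl]. split.
  - apply (is_linear_ext (fun h : R * V => plus (mult (fst h) (pd (1, zero) f (x0, y0))) (l (snd h)))).
    reflexivity.
    apply (is_linear_comp (fun h : R * V => (mult (fst h) (pd (1, zero) f (x0, y0)), l (snd h)))
             (fun t : R * R => plus (fst t) (snd t))).
    + apply is_linear_prod.
      * apply (is_linear_comp fst (fun t : R => mult t (pd (1, zero) f (x0, y0)))).
        apply is_linear_fst. apply (is_linear_scal_l (pd (1, zero) f (x0, y0))).
      * apply (is_linear_comp snd l). apply is_linear_snd. exact Ll.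
    + apply (is_linear_plus (V := R_NormedModule)).
  - intros q Hq eps.
    assert (E := is_filter_lim_locally_unique _ _ Hq). subst q. clear Hq.
    assert (He : 0 < eps / 2) by (destruct eps; simpl; lra).
    specialize (Hl y0 (fun P H => H) (mkposreal _ He)).
    destruct Hl as [d1 Hl].
    destruct (Hc (ball (pd (1, zero) f (x0, y0)) (eps / 2))) as [d2 Hc'].
    { exact (locally_ball _ (mkposreal _ He)). }
    assert (Hd12 : 0 < Rmin d1 d2) by (apply Rmin_glb_lt; [apply d1 | apply d2]).
    exists (mkposreal _ Hd12). intros [x y] [Bx By]. cbn [fst snd] in Bx, By.
    simpl pos in Bx, By.
    assert (By1 : ball y0 d1 y) by (eapply ball_le; [apply Rmin_l | exact By]).
    assert (By2 : ball y0 d2 y) by (eapply ball_le; [apply Rmin_r | exact By]).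
    assert (Bx2 : ball x0 d2 x) by (eapply ball_le; [apply Rmin_r | exact Bx]).
    specialize (Hl y By1). simpl pos in Hl.
    assert (Hline : forall t, line (x0, y) (1, zero) (t - x0) = (t, y)).
    { intros t. unfold line. apply injective_projections; cbn.
      - change (x0 + (t - x0) * 1 = t). ring.
      - transitivity (plus y (@zero V)); [|apply plus_zero_r].
        f_equal. exact (scal_zero_r (t - x0)). }
    assert (Hder : forall t, is_derive (fun t => f (t, y)) t (pd (1, zero) f (t, y))).
    { intros t. apply (is_derive_ext (fun t => f (line (x0, y) (1, zero) (t - x0)))).
      { intros s. now rewrite Hline. }
      evar_last.
      apply (is_derive_comp (fun r => f (line (x0, y) (1, zero) r)) (fun t => t - x0)).
      apply is_derive_line. exact Hd. auto_derive. trivial. reflexivity.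
      rewrite Hline. apply Rmult_1_l. }
    destruct (MVT_gen (fun t => f (t, y)) x0 x (fun t => pd (1, zero) f (t, y))) as [xi [Hxi HM]].
    { intros t _. apply Hder. }
    { intros t _. apply continuity_pt_filterlim.
      apply (ex_derive_continuous (fun t => f (t, y))). eexists; apply Hder. }
    cbn [fst snd].
    assert (Bxi : ball x0 d2 xi).
    { change (Rabs (xi - x0) < d2). change (Rabs (x - x0) < d2) in Bx2.
      revert Hxi Bx2. unfold Rmin, Rmax. destruct (Rle_dec x0 x); intros ?;
      unfold Rabs; repeat destruct Rcase_abs; lra. }
    specialize (Hc' (xi, y) (conj Bxi By2)).
    change (Rabs (pd (1, zero) f (xi, y) - pd (1, zero) f (x0, y0)) < eps / 2) in Hc'.
    change (Rabs ((f (x, y) - f (x0, y0)) - ((x - x0) * pd (1, zero) f (x0, y0) + l (minus y y0)))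
      <= eps * norm (minus x x0, minus y y0)).
    change (Rabs ((f (x0, y) - f (x0, y0)) - l (minus y y0)) <= eps / 2 * norm (minus y y0)) in Hl.
    assert (N1 : Rabs (x - x0) <= norm (minus x x0, minus y y0)).
    { eapply Rle_trans; [apply Rle_abs|]. eapply Rle_trans; [apply (Rmax_l _ (Rabs (norm (minus y y0))))|].
      apply sqrt_plus_sqr. }
    assert (N2 : norm (minus y y0) <= norm (minus x x0, minus y y0)).
    { eapply Rle_trans; [apply Rle_abs|]. eapply Rle_trans; [apply (Rmax_r (Rabs (Rabs (x - x0))))|].
      apply sqrt_plus_sqr. }
    replace (f (x, y) - f (x0, y0) - ((x - x0) * pd (1, zero) f (x0, y0) + l (minus y y0)))
      with ((f (x, y) - f (x0, y) - (x - x0) * pd (1, zero) f (x0, y0)) +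
            (f (x0, y) - f (x0, y0) - l (minus y y0))) by ring.
    eapply Rle_trans; [apply Rabs_triang|].
    cbn beta in HM. replace (f (x, y) - f (x0, y)) with (pd (1, zero) f (xi, y) * (x - x0)) by (symmetry; exact HM).
    replace (pd (1, zero) f (xi, y) * (x - x0) - (x - x0) * pd (1, zero) f (x0, y0))
      with ((x - x0) * (pd (1, zero) f (xi, y) - pd (1, zero) f (x0, y0))) by ring.
    rewrite Rabs_mult.
    replace (eps * norm (minus x x0, minus y y0)) with
      (norm (minus x x0, minus y y0) * (eps / 2) + eps / 2 * norm (minus x x0, minus y y0)) by field.
    apply Rplus_le_compat.
    + apply Rmult_le_compat; try apply Rabs_pos; lra.
    + eapply Rle_trans; [exact Hl|]. apply Rmult_le_compat_l; lra.
Qed.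

(** The directions of time and of the two plane coordinates. *)
Definition e0 : R * R2 := (1, (0, 0)).
Definition e1 : R * R2 := (0, (1, 0)).
Definition e2 : R * R2 := (0, (0, 1)).

Lemma C1_filterdiff (f : R * R2 -> R) (p : R * R2) :
  Ck 1 f -> filterdiff f (locally p)
    (fun h => fst h * pd e0 f p + (fst (snd h) * pd e1 f p + snd (snd h) * pd e2 f p)).
Proof.
  intros H. apply Ck_S_iff in H. destruct H as [_ [Hd Hc]].
  assert (Hc' : forall h, continuous (pd h f) p).
  { intros h. apply (Ck_continuous 0 (pd h f) p (Hc h)). }
  destruct p as [t [x y]].
  apply (filterdiff_prod_step (V := prod_NormedModule _ R_NormedModule R_NormedModule) f (t, (x, y))
     (fun h => fst h * pd e1 f (t, (x, y)) + snd h * pd e2 f (t, (x, y)))).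
  - intros q. apply Hd.
  - apply Hc'.
  - assert (L : forall h z (s : R), @line (prod_NormedModule _ R_NormedModule R_NormedModule) z h s =
              (fst z + s * fst h, snd z + s * snd h)) by reflexivity.
    assert (L3 : forall h z (s : R), @line (prod_NormedModule _ R_NormedModule
        (prod_NormedModule _ R_NormedModule R_NormedModule)) z h s =
              (fst z + s * fst h, (fst (snd z) + s * fst (snd h), snd (snd z) + s * snd (snd h))))
      by reflexivity.
    assert (E : forall q, pd (1, zero) (fun y0 : R2 => f (t, y0)) q = pd e1 f (t, q)).
    { intros q. unfold pd. apply Derive_ext. intros s. rewrite L, L3. cbn.
      unfold zero; cbn. do 2 f_equal. simpl. ring. }
    cbn [fst snd].
    apply (filterdiff_ext_lin _ (fun h : R2 => fst h * pd (1, zero) (fun q : R2 => f (t, q)) (x, y)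
        + snd h * pd e2 f (t, (x, y)))).
    2: { intros h. rewrite (E (x, y)). reflexivity. }
    apply (filterdiff_prod_step (fun q : R2 => f (t, q)) (x, y)
      (fun h => h * pd e2 f (t, (x, y)))).
    + intros q. rewrite E.
      apply (is_derive_ext (fun s => f (line (t, q) e1 s))).
      { intros s. rewrite L, L3. cbn. unfold zero; cbn. f_equal. apply (f_equal (fun r => (r, _))). simpl. ring. }
      apply Hd.
    + apply (continuous_ext (fun q => pd e1 f (t, q))). { intros q; now rewrite E. }
      apply (continuous_comp_2 (fun _ : R2 => t) (fun q : R2 => q) (fun a b => pd e1 f (a, b))).
      apply continuous_const. apply continuous_id.
      apply (continuous_ext (pd e1 f)). { now intros []. } apply Hc'.
    + cbn [fst snd].
      apply (filterdiff_ext_lin _ (fun h : R => scal h (pd e2 f (t, (x, y))))); [|reflexivity].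
      change (is_derive (fun y0 : R => f (t, (x, y0))) y (pd e2 f (t, (x, y)))).
      apply (is_derive_ext (fun r => f (line (t, (x, y)) e2 (r - y)))).
      { intros r. rewrite L3. cbn. f_equal. f_equal. ring. f_equal; ring. }
      evar_last.
      apply (is_derive_comp (fun r => f (line (t, (x, y)) e2 r)) (fun r => r - y)).
      apply is_derive_line. apply Hd. auto_derive. trivial. reflexivity.
      replace (line (t, (x, y)) e2 (y - y)) with (t, (x, y)).
      apply Rmult_1_l. rewrite L3. cbn. f_equal. ring. f_equal; ring.
Qed.

Section Comp.
Context {U : NormedModule R_AbsRing}.

Lemma is_derive_comp_R3 (f : R * R2 -> R) (c : R -> R * R2) (s : R) (dc : R * R2) :
  Ck 1 f -> is_derive c s dc ->
  is_derive (fun r => f (c r)) s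
    (fst dc * pd e0 f (c s) + (fst (snd dc) * pd e1 f (c s) + snd (snd dc) * pd e2 f (c s))).
Proof.
  intros Hf Hc. unfold is_derive.
  eapply filterdiff_ext_lin.
  - apply (filterdiff_comp' c f s (fun y : R => scal y dc)
     (fun h => fst h * pd e0 f (c s) + (fst (snd h) * pd e1 f (c s) + snd (snd h) * pd e2 f (c s)))).
    exact Hc. now apply C1_filterdiff.
  - intros y. destruct dc as [a [b c']].
    change (y * a * pd e0 f (c s) + (y * b * pd e1 f (c s) + y * c' * pd e2 f (c s)) =
      y * (a * pd e0 f (c s) + (b * pd e1 f (c s) + c' * pd e2 f (c s)))). ring.
Qed.

(** Composition is needed only through time and position, so three real inner
    functions are enough; the chain rule expresses the derivatives by products of
    functions of order [k], which closes the induction. *)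
Lemma Ck_comp_R3 (k : nat) : forall (f : R * R2 -> R) (a b c : U -> R),
  Ck k f -> Ck k a -> Ck k b -> Ck k c -> Ck k (fun x => f (a x, (b x, c x))).
Proof.
  induction k as [|k IH]; intros f a b c Hf Ha Hb Hc.
  - apply Ck_0_iff. intros x.
    apply (continuous_comp (fun x => (a x, (b x, c x))) f).
    + apply (Ck_continuous 0 (fun x => (a x, (b x, c x)))).
      apply Ck_pair; [|apply Ck_pair]; assumption.
    + exact (Ck_continuous 0 f _ Hf).
  - assert (Hf1 : Ck 1 f).
    { clear -Hf. induction k. exact Hf. apply IHk. now apply Ck_weaken. }
    assert (Hg : Ck (S k) (fun x => (a x, (b x, c x)))).
    { apply Ck_pair; [|apply Ck_pair]; assumption. }
    assert (Cg := fun x => Ck_continuous (S k) _ x Hg).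
    assert (Cf := fun x => Ck_continuous (S k) _ x Hf).
    assert (Ha' := Ck_weaken k a Ha). assert (Hb' := Ck_weaken k b Hb). assert (Hc' := Ck_weaken k c Hc).
    apply Ck_S_iff in Hf. destruct Hf as [_ [_ Df]].
    apply Ck_S_iff in Ha. destruct Ha as [_ [da Da]].
    apply Ck_S_iff in Hb. destruct Hb as [_ [db Db]].
    apply Ck_S_iff in Hc. destruct Hc as [_ [dc Dc]].
    split. { intros x. apply (continuous_comp (fun x => (a x, (b x, c x))) f); auto. }
    exists (fun h x => pd h a x * pd e0 f (a x, (b x, c x)) +
      (pd h b x * pd e1 f (a x, (b x, c x)) + pd h c x * pd e2 f (a x, (b x, c x)))).
    split.
    + intros h x.
      assert (H := is_derive_comp_R3 f (fun s => (a (line x h s), (b (line x h s), c (line x h s)))) 0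
         (pd h a x, (pd h b x, pd h c x)) Hf1).
      cbn beta in H. rewrite line_0 in H. apply H.
      apply (is_derive_pair (fun s => a (line x h s)) (fun s => (b (line x h s), c (line x h s)))).
      apply da. apply (is_derive_pair (fun s => b (line x h s)) (fun s => c (line x h s))); auto.
    + intros h. repeat apply Ck_plus; apply Ck_mult; auto; apply (IH (pd _ f)); auto.
Qed.
End Comp.

(** * Composition of smooth functions and symmetry of second derivatives *)

Lemma pd_coordinates (f : R * R2 -> R) (h p : R * R2) : smooth f ->
  pd h f p = fst h * pd e0 f p + (fst (snd h) * pd e1 f p + snd (snd h) * pd e2 f p).
Proof.
  intros Hf. apply pd_eq.
  assert (H := is_derive_comp_R3 f (fun s => line p h s) 0 h (Hf 1%nat)).
  cbn beta in H. rewrite line_0 in H. apply H.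
  destruct h as [h0 [h1 h2]], p as [p0 [p1 p2]].
  apply (is_derive_pair (fun s => p0 + s * h0) (fun s => (p1 + s * h1, p2 + s * h2)) 0 h0 (h1, h2)).
  auto_derive; [trivial|ring].
  apply (is_derive_pair (fun s => p1 + s * h1) (fun s => p2 + s * h2) 0 h1 h2);
  auto_derive; trivial; ring.
Qed.

(** Both sides are limits of the same difference quotients, whether or not these
    converge. *)
Lemma Derive_shift (f : R -> R) (x : R) : Derive (fun s => f (x + s * 1)) 0 = Derive f x.
Proof.
  unfold Derive. apply f_equal, Lim_ext. intros h. do 3 f_equal; ring.
Qed.

Lemma line_R2 (p h : R2) (s : R) : line p h s = (fst p + s * fst h, snd p + s * snd h).
Proof. reflexivity. Qed.

Lemma dx_pd (f : R2 -> R) (p : R2) : dx f p = pd (1, 0) f p.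
Proof.
  unfold dx, pd. rewrite <- (Derive_shift (fun s => f (s, snd p))). apply Derive_ext.
  intros s. f_equal. apply (f_equal (fun r => (_, r))). simpl.
  unfold plus, scal; simpl; unfold mult; simpl. ring.
Qed.

Lemma dy_pd (f : R2 -> R) (p : R2) : dy f p = pd (0, 1) f p.
Proof.
  unfold dy, pd. rewrite <- (Derive_shift (fun s => f (fst p, s))). apply Derive_ext.
  intros s. f_equal. apply (f_equal (fun r => (r, _))). simpl.
  unfold plus, scal; simpl; unfold mult; simpl. ring.
Qed.

Lemma dxE (f : R2 -> R) : dx f = pd (1, 0) f.
Proof. apply functional_extensionality. apply dx_pd. Qed.
Lemma dyE (f : R2 -> R) : dy f = pd (0, 1) f.
Proof. apply functional_extensionality. apply dy_pd. Qed.

Notation NR2 := (prod_NormedModule R_AbsRing R_NormedModule R_NormedModule).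
Notation NR3 := (prod_NormedModule R_AbsRing R_NormedModule NR2).

Section Comp.
Context {U : NormedModule R_AbsRing}.

Lemma smooth_comp_R3 (f : R * R2 -> R) (a b c : U -> R) :
  smooth f -> smooth a -> smooth b -> smooth c -> smooth (fun x => f (a x, (b x, c x))).
Proof. intros Hf Ha Hb Hc k. now apply Ck_comp_R3. Qed.

Lemma pd_comp_R3 (f : R * R2 -> R) (a b c : U -> R) (h x : U) :
  smooth f -> smooth a -> smooth b -> smooth c ->
  pd h (fun x => f (a x, (b x, c x))) x =
    pd h a x * pd e0 f (a x, (b x, c x)) +
      (pd h b x * pd e1 f (a x, (b x, c x)) + pd h c x * pd e2 f (a x, (b x, c x))).
Proof.
  intros Hf Ha Hb Hc. apply pd_eq.
  assert (H := is_derive_comp_R3 f (fun s => (a (line x h s), (b (line x h s), c (line x h s)))) 0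
         (pd h a x, (pd h b x, pd h c x)) (Hf 1%nat)).
  cbn beta in H. rewrite line_0 in H. apply H.
  apply (is_derive_pair (fun s => a (line x h s)) (fun s => (b (line x h s), c (line x h s)))).
  now apply smooth_is_derive.
  apply (is_derive_pair (fun s => b (line x h s)) (fun s => c (line x h s))); now apply smooth_is_derive.
Qed.

Lemma smooth_linear {V : NormedModule R_AbsRing} (l : U -> V) : is_linear l -> smooth l.
Proof. intros Hl k. now apply Ck_linear. Qed.

Lemma smooth_pair {V W : NormedModule R_AbsRing} (f : U -> V) (g : U -> W) :
  smooth f -> smooth g -> smooth (fun x => (f x, g x)).
Proof. intros Hf Hg k. now apply Ck_pair. Qed.

Lemma pd_comp_linear {V : NormedModule R_AbsRing} (l : U -> V) (f : V -> R) (h x : U) :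
  is_linear l -> pd h (fun x => f (l x)) x = pd (l h) f (l x).
Proof.
  intros Hl. unfold pd. apply Derive_ext. intros s. f_equal. unfold line.
  rewrite (linear_plus l Hl). f_equal. apply (linear_scal l Hl).
Qed.

Lemma is_derive_comp_R2 (f : R2 -> R) (a b : R -> R) (s da db : R) :
  smooth f -> is_derive a s da -> is_derive b s db ->
  is_derive (fun r => f (a r, b r)) s (da * dx f (a s, b s) + db * dy f (a s, b s)).
Proof.
  intros Hf Ha Hb.
  assert (Hf' : Ck 1 (fun q : R * R2 => f (snd q))).
  { apply (Ck_comp_linear 1 snd). apply is_linear_snd. apply Hf. }
  assert (H := is_derive_comp_R3 (fun q : R * R2 => f (snd q)) (fun r => (0, (a r, b r))) s
    (0, (da, db)) Hf').
  evar_last. apply H. apply (is_derive_pair (fun _ => 0) (fun r => (a r, b r))).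
  apply (is_derive_const 0). apply (is_derive_pair a b); assumption.
  assert (E : forall e p, pd e (fun q : R * R2 => f (snd q)) p = pd (snd e) f (snd p)).
  { intros e p. unfold pd. apply Derive_ext. intros r. reflexivity. }
  rewrite dx_pd, dy_pd, !E. cbn [fst snd e0 e1 e2]. ring.
Qed.

Lemma smooth_comp_R2 (f : R2 -> R) (a b : U -> R) :
  smooth f -> smooth a -> smooth b -> smooth (fun x => f (a x, b x)).
Proof.
  intros Hf Ha Hb.
  apply (smooth_comp_R3 (fun q => f (snd q)) (fun _ => 0) a b); auto.
  - intros k. apply (Ck_comp_linear k snd). apply is_linear_snd. apply Hf.
  - apply smooth_const.
Qed.

Lemma pd_comp_R2 (f : R2 -> R) (a b : U -> R) (h x : U) :
  smooth f -> smooth a -> smooth b ->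
  pd h (fun x => f (a x, b x)) x =
    pd h a x * dx f (a x, b x) + pd h b x * dy f (a x, b x).
Proof.
  intros Hf Ha Hb. apply pd_eq.
  assert (H := is_derive_comp_R2 f (fun s => a (line x h s)) (fun s => b (line x h s)) 0
    (pd h a x) (pd h b x) Hf (smooth_is_derive a h x Ha) (smooth_is_derive b h x Hb)).
  cbn beta in H. now rewrite line_0 in H.
Qed.

Lemma smooth_fst_comp {V W : NormedModule R_AbsRing} (g : U -> V * W) :
  smooth g -> smooth (fun x => fst (g x)).
Proof. intros Hg k. apply (Ck_linear_comp k (fun z : V * W => fst z)). apply is_linear_fst. apply Hg. Qed.
Lemma smooth_snd_comp {V W : NormedModule R_AbsRing} (g : U -> V * W) :
  smooth g -> smooth (fun x => snd (g x)).
Proof. intros Hg k. apply (Ck_linear_comp k (fun z : V * W => snd z)). apply is_linear_snd. apply Hg. Qed.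

Lemma smooth_comp3 (f : R * R2 -> R) (g : U -> R * R2) :
  smooth f -> smooth g -> smooth (fun x => f (g x)).
Proof.
  intros Hf Hg.
  replace (fun x => f (g x)) with (fun x => f (fst (g x), (fst (snd (g x)), snd (snd (g x))))).
  - apply (smooth_comp_R3 f (fun x => fst (g x)) (fun x => fst (snd (g x))) (fun x => snd (snd (g x)))).
    exact Hf. exact (smooth_fst_comp g Hg).
    exact (smooth_fst_comp (fun x => snd (g x)) (smooth_snd_comp g Hg)).
    exact (smooth_snd_comp (fun x => snd (g x)) (smooth_snd_comp g Hg)).
  - apply functional_extensionality. intros x. now destruct (g x) as [t [x' y]].
Qed.

Lemma smooth_comp2 (f : R2 -> R) (g : U -> R2) :
  smooth f -> smooth g -> smooth (fun x => f (g x)).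
Proof.
  intros Hf Hg.
  replace (fun x => f (g x)) with (fun x => f (fst (g x), snd (g x))).
  - apply (smooth_comp_R2 f (fun x => fst (g x)) (fun x => snd (g x))).
    exact Hf. exact (smooth_fst_comp g Hg). exact (smooth_snd_comp g Hg).
  - apply functional_extensionality. intros x. now destruct (g x).
Qed.

Lemma smooth_comp_R (f : R -> R) (a : U -> R) :
  smooth f -> smooth a -> smooth (fun x => f (a x)).
Proof.
  intros Hf Ha.
  apply (smooth_comp_R2 (fun q => f (fst q)) a (fun _ => 0)); auto.
  - intros k. apply (Ck_comp_linear k fst). apply is_linear_fst. apply Hf.
  - apply smooth_const.
Qed.
End Comp.

Lemma smooth_is_derive_R (f : R -> R) (x : R) : smooth f -> is_derive f x (Derive f x).
Proof.
  intros Hf. apply Derive_correct.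
  assert (H := smooth_is_derive_line f 0 1 x Hf).
  exists (pd 1 f (line 0 1 x)). revert H. apply is_derive_ext. intros t. f_equal.
  change (0 + t * 1 = t). ring.
Qed.

Lemma pd_R (f : R -> R) (h x : R) : smooth f -> pd h f x = h * Derive f x.
Proof.
  intros Hf. apply pd_eq.
  apply (is_derive_comp f (fun s => line x h s)).
  - rewrite line_0. now apply smooth_is_derive_R.
  - apply (is_derive_ext (fun s => x + s * h)). reflexivity. auto_derive. trivial. ring.
Qed.

Lemma smooth_Derive (f : R -> R) : smooth f -> smooth (Derive f).
Proof.
  intros Hf. replace (Derive f) with (pd 1 f). now apply smooth_pd.
  apply functional_extensionality. intros x. rewrite pd_R; auto. ring.
Qed.

Lemma pd_comp_R {U : NormedModule R_AbsRing} (f : R -> R) (a : U -> R) (h x : U) :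
  smooth f -> smooth a -> pd h (fun x => f (a x)) x = pd h a x * Derive f (a x).
Proof.
  intros Hf Ha. apply pd_eq.
  apply (is_derive_comp f (fun s => a (line x h s))).
  - rewrite line_0. now apply smooth_is_derive_R.
  - now apply smooth_is_derive.
Qed.

Lemma pd_R2 (f : R2 -> R) (h p : R2) : smooth f ->
  pd h f p = fst h * dx f p + snd h * dy f p.
Proof.
  intros Hf. destruct p as [p1 p2].
  rewrite <- (pd_ext_loc (fun q => f (fst q, snd q)) f).
  2: { exists (mkposreal _ Rlt_0_1). now intros [] _. }
  rewrite (pd_comp_R2 f fst snd); auto.
  - f_equal; f_equal; apply pd_eq; destruct h as [h1 h2].
    + apply (is_derive_ext (fun s : R => p1 + s * h1)). reflexivity. auto_derive; trivial. simpl. ring.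
    + apply (is_derive_ext (fun s : R => p2 + s * h2)). reflexivity. auto_derive; trivial. simpl. ring.
  - apply smooth_linear. apply is_linear_fst.
  - apply smooth_linear. apply is_linear_snd.
Qed.

Lemma smooth_dx (f : R2 -> R) : smooth f -> smooth (dx f).
Proof. intros Hf. rewrite dxE. now apply smooth_pd. Qed.
Lemma smooth_dy (f : R2 -> R) : smooth f -> smooth (dy f).
Proof. intros Hf. rewrite dyE. now apply smooth_pd. Qed.

Lemma is_derive_dy (f : R2 -> R) (x y : R) : smooth f ->
  is_derive (fun s => f (x, s)) y (dy f (x, y)).
Proof.
  intros Hf. apply Derive_correct. cbn [fst snd].
  exists (dy f (x, y)).
  apply (is_derive_ext (fun s => f (line (x, 0) (0, 1) s))).
  { intros s. f_equal. rewrite line_R2. apply injective_projections; simpl; ring. }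
  rewrite dy_pd. replace (x, y) with (line (x, 0) (0, 1) y). now apply smooth_is_derive_line.
  rewrite line_R2. apply injective_projections; simpl; ring.
Qed.

Section Schwarz.
Context {U : NormedModule R_AbsRing}.

Lemma line_swap (x h k : U) (s t : R) : line (line x h s) k t = line (line x k t) h s.
Proof.
  unfold line. rewrite <- !plus_assoc. f_equal. apply plus_comm.
Qed.

Lemma line2_continuous (x h k : U) (p : R2) :
  continuous (fun q : R2 => line (line x h (fst q)) k (snd q)) p.
Proof.
  apply (continuous_plus (fun q : R2 => line x h (fst q)) (fun q : R2 => scal (snd q) k)).
  - apply (continuous_comp fst (line x h)). apply continuous_fst. apply line_continuous.
  - apply (continuous_scal_l (fun q : R2 => snd q)). apply continuous_snd.
Qed.

(** Restricted to the plane through [x] spanned by [h] and [k], this is the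
    classical theorem of Schwarz. *)
Lemma pd_comm (f : U -> R) (h k x : U) : smooth f ->
  pd h (pd k f) x = pd k (pd h f) x.
Proof.
  intros Hf.
  assert (H1 : forall u v, Derive (fun t => f (line (line x h u) k t)) v = pd k f (line (line x h u) k v)).
  { intros u v. apply is_derive_unique. now apply smooth_is_derive_line. }
  assert (D2 : forall u v, is_derive (fun z => f (line (line x h z) k v)) u (pd h f (line (line x h u) k v))).
  { intros u v. rewrite line_swap.
    apply (is_derive_ext (fun z => f (line (line x k v) h z))). intros; now rewrite line_swap.
    now apply smooth_is_derive_line. }
  assert (H2 : forall u v, Derive (fun t => f (line (line x h t) k v)) u = pd h f (line (line x h u) k v)).
  { intros u v. apply is_derive_unique. apply D2. }
  assert (D12 : forall u v, is_derive (fun z => Derive (fun t => f (line (line x h z) k t)) v) u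
                      (pd h (pd k f) (line (line x h u) k v))).
  { intros u v. apply (is_derive_ext (fun z => pd k f (line (line x k v) h z))).
    intros; now rewrite H1, line_swap. rewrite line_swap.
    apply smooth_is_derive_line. now apply smooth_pd. }
  assert (D21 : forall u v, is_derive (fun z => Derive (fun t => f (line (line x h t) k z)) u) v
                      (pd k (pd h f) (line (line x h u) k v))).
  { intros u v. apply (is_derive_ext (fun z => pd h f (line (line x h u) k z))).
    intros; now rewrite H2.
    apply smooth_is_derive_line. now apply smooth_pd. }
  assert (C : forall g : U -> R, smooth g -> forall u v,
     continuity_2d_pt (fun u v => g (line (line x h u) k v)) u v).
  { intros g Hg u v. apply continuity_2d_pt_filterlim.
    change (continuous (fun q : R2 => g (line (line x h (fst q)) k (snd q))) (u, v)).
    apply (continuous_comp (fun q : R2 => line (line x h (fst q)) k (snd q)) g).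
    apply line2_continuous. now apply smooth_continuous_R. }
  transitivity (Derive (fun z => Derive (fun t => f (line (line x h z) k t)) 0) 0).
  { symmetry. etransitivity. apply is_derive_unique, D12. now rewrite !line_0. }
  transitivity (Derive (fun z => Derive (fun t => f (line (line x h t) k z)) 0) 0).
  2: { etransitivity. apply is_derive_unique, D21. now rewrite !line_0. }
  apply (Schwarz (fun u v => f (line (line x h u) k v)) 0 0).
  - exists (mkposreal _ Rlt_0_1). intros u v _ _. repeat split.
    + eexists; apply D2.
    + eexists; now apply smooth_is_derive_line.
    + eexists; apply D12.
    + eexists; apply D21.
  - apply (continuity_2d_pt_ext (fun u v => pd h (pd k f) (line (line x h u) k v))).
    intros u v. symmetry. apply is_derive_unique, D12. apply C. now do 2 apply smooth_pd.
  - apply (continuity_2d_pt_ext (fun u v => pd k (pd h f) (line (line x h u) k v))).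
    intros u v. symmetry. apply is_derive_unique, D21. apply C. now do 2 apply smooth_pd.
Qed.
End Schwarz.

Lemma Ck_sin_cos (k : nat) : Ck k sin /\ Ck k cos.
Proof.
  induction k as [|k [IHs IHc]].
  - split; apply Ck_0_iff; intros x. apply continuous_sin. apply continuous_cos.
  - split; split.
    + intros x. apply continuous_sin.
    + exists (fun h x => h * cos x). split.
      * intros h x. apply (is_derive_ext (fun s => sin (x + s * h))). reflexivity.
        auto_derive. trivial. rewrite Rmult_0_l, Rplus_0_r. ring.
      * intros h. apply Ck_mult. apply Ck_const. exact IHc.
    + intros x. apply continuous_cos.
    + exists (fun h x => (- h) * sin x). split.
      * intros h x. apply (is_derive_ext (fun s => cos (x + s * h))). reflexivity.
        auto_derive. trivial. rewrite Rmult_0_l, Rplus_0_r. ring.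
      * intros h. apply Ck_mult. apply Ck_const. exact IHs.
Qed.

Lemma smooth_sin : smooth sin.
Proof. intros k. apply Ck_sin_cos. Qed.
Lemma smooth_cos : smooth cos.
Proof. intros k. apply Ck_sin_cos. Qed.
Lemma smooth_id : smooth (fun x : R => x).
Proof. apply smooth_linear. apply (is_linear_id (V := R_NormedModule)). Qed.

(** * Flat functions and smooth positive extensions *)

(** x^-n exp(-1/x), extended by 0 to x <= 0.  The whole family is considered
    because it is closed under differentiation:
    (flat n)' = flat (n+2) - n flat (n+1). *)
Definition flat (n : nat) (x : R) : R :=
  if Rlt_dec 0 x then (/ x) ^ n * exp (- / x) else 0.

Lemma flat_neg (n : nat) (x : R) : x <= 0 -> flat n x = 0.
Proof. intros H. unfold flat. destruct Rlt_dec; lra. Qed.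

Lemma flat_pos (n : nat) (x : R) : 0 < x -> flat n x = (/ x) ^ n * exp (- / x).
Proof. intros H. unfold flat. destruct Rlt_dec; lra. Qed.

(** y/m <= exp(y/m), raised to the power m. *)
Lemma pow_le_exp (m : nat) (y : R) : (0 < m)%nat -> 0 <= y -> y ^ m <= INR m ^ m * exp y.
Proof.
  intros Hm Hy. assert (Hm' : 0 < INR m) by (now apply lt_0_INR).
  assert (E : exp y = exp (y / INR m) ^ m).
  { rewrite <- Rpower_pow by apply exp_pos. unfold Rpower. rewrite ln_exp. f_equal. field. lra. }
  rewrite E, <- Rpow_mult_distr. apply pow_incr. split. exact Hy.
  assert (H := exp_ineq1_le (y / INR m)).
  apply Rle_trans with (INR m * (y / INR m)). right; field; lra.
  apply Rmult_le_compat_l; lra.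
Qed.

Lemma flat_bound (n : nat) (x : R) : Rabs (flat n x) <= INR (n + 2) ^ (n + 2) * x ^ 2.
Proof.
  destruct (Rlt_dec 0 x) as [Hx|Hx].
  - rewrite flat_pos; auto.
    assert (Hx' := Rinv_0_lt_compat _ Hx).
    assert (H := pow_le_exp (n + 2) (/ x) ltac:(lia) (Rlt_le _ _ Hx')).
    assert (He := exp_pos (- / x)).
    rewrite Rabs_right.
    2: { apply Rle_ge, Rmult_le_pos. apply pow_le; lra. lra. }
    replace ((/ x) ^ n) with ((/ x) ^ (n + 2) * x ^ 2).
    2: { rewrite pow_add. replace (x ^ 2) with (/ ((/ x) ^ 2)). field. lra.
         rewrite pow_inv, Rinv_inv. reflexivity. }
    replace (INR (n + 2) ^ (n + 2) * x ^ 2) with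
      ((INR (n + 2) ^ (n + 2) * exp (/ x)) * (x ^ 2 * exp (- / x))).
    2: { rewrite exp_Ropp. field. apply Rgt_not_eq, exp_pos. }
    rewrite Rmult_assoc. apply Rmult_le_compat_r; [|exact H].
    apply Rmult_le_pos. apply pow2_ge_0. lra.
  - rewrite flat_neg; [|lra]. rewrite Rabs_R0. apply Rmult_le_pos.
    apply pow_le, pos_INR. apply pow2_ge_0.
Qed.

Lemma is_derive_flat (n : nat) (x : R) :
  is_derive (flat n) x (flat (n + 2) x - INR n * flat (n + 1) x).
Proof.
  destruct (Rtotal_order x 0) as [Hx|[Hx|Hx]].
  - rewrite !flat_neg by lra.
    apply (is_derive_ext_loc (fun _ => 0)).
    + assert (Hx' : 0 < - x) by lra. exists (mkposreal _ Hx'). intros y Hy.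
      change (Rabs (y - x) < - x) in Hy. apply Rabs_def2 in Hy.
      symmetry. apply flat_neg. lra.
    + evar_last. apply (is_derive_const 0). unfold zero; simpl. ring.
  - subst x. rewrite !flat_neg by lra. replace (0 - INR n * 0) with 0 by ring.
    apply is_derive_Reals. intros eps Heps.
    set (C := INR (n + 2) ^ (n + 2)).
    assert (HC : 0 < C). { apply pow_lt, lt_0_INR. lia. }
    assert (Hd : 0 < eps / C) by (now apply Rdiv_lt_0_compat).
    exists (mkposreal _ Hd). intros h Hh Hhd. simpl in Hhd.
    rewrite Rplus_0_l, (flat_neg n 0), !Rminus_0_r by lra.
    assert (B := flat_bound n h). fold C in B.
    unfold Rdiv. rewrite Rabs_mult, Rabs_inv.
    assert (Hp := Rabs_pos_lt _ Hh).
    apply Rle_lt_trans with (C * Rabs h).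
    + replace (C * Rabs h) with (C * h ^ 2 * / Rabs h).
      apply Rmult_le_compat_r. left; now apply Rinv_0_lt_compat. exact B.
      rewrite <- (pow2_abs h). field. lra.
    + replace eps with (C * (eps / C)) by (field; lra). now apply Rmult_lt_compat_l.
  - apply (is_derive_ext_loc (fun y => (/ y) ^ n * exp (- / y))).
    + exists (mkposreal _ Hx). intros y Hy.
      change (Rabs (y - x) < x) in Hy. apply Rabs_def2 in Hy.
      symmetry. apply flat_pos. lra.
    + rewrite !flat_pos; auto. auto_derive. repeat split; lra.
      rewrite !pow_add. destruct n. simpl. field. lra.
      simpl pred. rewrite <- !tech_pow_Rmult, S_INR. field. lra.
Qed.

Lemma smooth_flat (n : nat) : smooth (flat n).
Proof.
  assert (C : forall n x, continuous (flat n) x).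
  { intros m x. apply (ex_derive_continuous (flat m)). eexists; apply is_derive_flat. }
  intros k. revert n. induction k as [|k IH]; intros n.
  - apply Ck_0_iff. apply C.
  - split. apply C.
    exists (fun h x => h * (flat (n + 2) x + (- INR n) * flat (n + 1) x)). split.
    + intros h x. evar_last.
      apply (is_derive_comp (flat n) (fun s => x + s * h)).
      apply is_derive_flat. auto_derive. trivial. reflexivity.
      rewrite Rmult_0_l, Rplus_0_r. unfold scal; simpl; unfold mult; simpl. ring.
    + intros h. apply Ck_mult. apply Ck_const. apply Ck_plus. apply IH.
      apply Ck_mult. apply Ck_const. apply IH.
Qed.

Lemma flat0_pos (x : R) : 0 < x -> 0 < flat 0 x.
Proof. intros H. rewrite flat_pos; auto. simpl. rewrite Rmult_1_l. apply exp_pos. Qed.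

Lemma flat0_nonneg (x : R) : 0 <= flat 0 x.
Proof.
  destruct (Rlt_dec 0 x). left; now apply flat0_pos. right. symmetry. apply flat_neg. lra.
Qed.

(** A smooth step between eps/2 and eps, multiplied by x - eps and added to eps.
    Composing with this function turns a function that is positive on the disk
    into one that can be inverted on the whole plane. *)
Lemma positive_extension (eps : R) : 0 < eps ->
  exists F : R -> R, smooth F /\ (forall x, eps / 2 <= F x) /\ (forall x, eps <= x -> F x = x).
Proof.
  intros He.
  (* a vanishes for x <= eps/2 and b for x >= eps, so a/(a+b) is the step. *)
  set (a := fun x => flat 0 (2 / eps * x - 1)). set (b := fun x => flat 0 (2 - 2 / eps * x)).
  assert (Sa : smooth a).
  { apply (smooth_comp_R (flat 0)). apply smooth_flat. apply smooth_minus.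
    apply smooth_mult. apply smooth_const. apply smooth_id. apply smooth_const. }
  assert (Sb : smooth b).
  { apply (smooth_comp_R (flat 0)). apply smooth_flat. apply smooth_minus.
    apply smooth_const. apply smooth_mult. apply smooth_const. apply smooth_id. }
  assert (Hx : forall x, 2 / eps * x = 2 * (x / eps)) by (intros; field; lra).
  assert (Hab : forall x, 0 < a x + b x).
  { intros x. unfold a, b. destruct (Rlt_dec 1 (2 / eps * x)).
    - apply Rplus_lt_le_0_compat. apply flat0_pos; lra. apply flat0_nonneg.
    - apply Rplus_le_lt_0_compat. apply flat0_nonneg. apply flat0_pos; lra. }
  exists (fun x => eps + (a x * / (a x + b x)) * (x - eps)). split; [|split].
  - apply smooth_plus. apply smooth_const. apply smooth_mult. apply smooth_mult. exact Sa.
    apply smooth_inv. intros x. specialize (Hab x). lra. now apply smooth_plus.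
    apply smooth_minus. apply smooth_id. apply smooth_const.
  - intros x. specialize (Hab x).
    assert (Ha : 0 <= a x) by apply flat0_nonneg. assert (Hb : 0 <= b x) by apply flat0_nonneg.
    assert (Hi := Rinv_0_lt_compat _ Hab).
    assert (H1 : a x * / (a x + b x) <= 1).
    { apply Rmult_le_reg_r with (a x + b x). exact Hab. rewrite Rmult_assoc, Rinv_l; lra. }
    assert (H0 : 0 <= a x * / (a x + b x)) by (apply Rmult_le_pos; lra).
    destruct (Rle_dec x (eps / 2)) as [H|H].
    + assert (E : a x = 0).
      { apply flat_neg. rewrite Hx. apply Rmult_le_compat_r with (r := / eps) in H.
        2: left; now apply Rinv_0_lt_compat.
        replace (eps / 2 * / eps) with (/ 2) in H by (field; lra). unfold Rdiv. lra. }
      rewrite E. lra.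
    + destruct (Rle_dec x eps).
      * assert (- (x - eps) * (a x * / (a x + b x)) <= - (x - eps) * 1).
        { apply Rmult_le_compat_l; lra. } lra.
      * assert (0 <= (a x * / (a x + b x)) * (x - eps)) by (apply Rmult_le_pos; lra). lra.
  - intros x H. assert (E : b x = 0).
    { apply flat_neg. rewrite Hx. apply Rmult_le_compat_r with (r := / eps) in H.
      2: left; now apply Rinv_0_lt_compat. rewrite Rinv_r in H by lra. unfold Rdiv. lra. }
    specialize (Hab x). rewrite E in *. field. lra.
Qed.

(** * Integrals depending on a parameter *)

Lemma continuous_pair {T V W : UniformSpace} (f : T -> V) (g : T -> W) (x : T) :
  continuous f x -> continuous g x -> continuous (fun y => (f y, g y)) x.
Proof.
  intros Hf Hg. apply (continuous_comp_2 f g (fun a b => (a, b))). exact Hf. exact Hg.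
  apply (continuous_ext (fun z => z)). now intros []. apply continuous_id.
Qed.

Lemma ex_RInt_of_continuous (f : R -> R) (a b : R) :
  (forall x, continuous f x) -> ex_RInt f a b.
Proof.
  intros Hf. apply (ex_RInt_continuous (V := R_CompleteNormedModule)). intros; apply Hf.
Qed.

Section Param.
Context {U : NormedModule R_AbsRing}.
Context (a b : R) (Hab : a <= b).

(** Compactness of [a, b]: finitely many product neighbourhoods of the points
    (s, u0) cover it. *)
Lemma continuous_uniformly (K : R * U -> R) (u0 : U) (eps : posreal) :
  (forall q, continuous K q) ->
  locally u0 (fun u => forall s, a <= s <= b -> Rabs (K (s, u) - K (s, u0)) < eps).
Proof.
  intros HK.
  assert (He : 0 < eps / 2) by (destruct eps; simpl; lra).
  destruct (functional_choice (fun (s : R) (d : posreal) =>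
     forall q, ball (s, u0) d q -> Rabs (K q - K (s, u0)) < eps / 2)) as [delta Hdelta].
  { intros s. destruct (HK (s, u0) (ball (K (s, u0)) (eps / 2))) as [d Hd].
    exact (locally_ball _ (mkposreal _ He)). exists d. exact Hd. }
  destruct (compactness_value_1d a b delta) as [d Hd].
  exists d. intros u Hu s Hs.
  apply Rnot_le_lt. intros Hn. apply (Hd s Hs). intros [t [_ [Hst Hdt]]].
  apply (Rle_not_lt _ _ Hn).
  assert (H1 := Hdelta t (s, u) (conj Hst (ball_le u0 d (delta t) Hdt u Hu))).
  assert (H2 := Hdelta t (s, u0) (conj Hst (ball_center u0 (delta t)))).
  apply Rabs_def2 in H1. apply Rabs_def2 in H2. apply Rabs_def1; lra.
Qed.

Lemma continuous_section (K : R * U -> R) (u : U) (s : R) :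
  (forall q, continuous K q) -> continuous (fun s => K (s, u)) s.
Proof.
  intros HK. apply (continuous_comp (fun s : R => (s, u)) K).
  apply continuous_pair. apply continuous_id. apply continuous_const. apply HK.
Qed.

Lemma ex_RInt_section (K : R * U -> R) (u : U) :
  (forall q, continuous K q) -> ex_RInt (fun s => K (s, u)) a b.
Proof.
  intros HK. apply ex_RInt_of_continuous. intros s. now apply continuous_section.
Qed.

Lemma continuous_RInt_section (K : R * U -> R) (u : U) :
  (forall q, continuous K q) -> continuous (fun u => RInt (fun s => K (s, u)) a b) u.
Proof.
  intros HK P [eps HP].
  assert (He : 0 < eps / (b - a + 1)).
  { apply Rdiv_lt_0_compat. apply eps. lra. }
  change (locally u (fun v => P (RInt (fun s => K (s, v)) a b))).
  eapply filter_imp; [|exact (continuous_uniformly K u (mkposreal _ He) HK)].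
  intros v Hv. apply HP.
  change (Rabs (RInt (fun s => K (s, v)) a b - RInt (fun s => K (s, u)) a b) < eps).
  apply Rle_lt_trans with ((b - a) * (eps / (b - a + 1))).
  - apply (norm_RInt_le_const (V := R_NormedModule) (fun s => K (s, v) - K (s, u)) a b); auto.
    + intros s Hs. left. now apply Hv.
    + apply (is_RInt_minus (V := R_NormedModule) (fun s => K (s, v)) (fun s => K (s, u)));
      apply (RInt_correct (V := R_CompleteNormedModule)), ex_RInt_section; auto.
  - replace (pos eps) with ((b - a + 1) * (eps / (b - a + 1))) at 2 by (field; lra).
    apply Rmult_lt_compat_r. exact He. lra.
Qed.

Lemma pd_section (K : R * U -> R) (s : R) (u h : U) :
  Derive (fun r => K (s, line u h r)) 0 = pd (zero, h) K (s, u).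
Proof.
  unfold pd. apply Derive_ext. intros r. f_equal. unfold line.
  apply injective_projections; [|reflexivity]. simpl.
  symmetry. transitivity (plus s (@zero R_AbelianMonoid)); [|apply plus_zero_r].
  apply (f_equal (plus s)). apply (scal_zero_r (V := R_NormedModule)).
Qed.

Lemma is_derive_section (K : R * U -> R) (s : R) (u h : U) (r : R) :
  Ck 1 K -> is_derive (fun r => K (s, line u h r)) r (pd (zero, h) K (s, line u h r)).
Proof.
  intros HK. assert (HL : forall r, (s, line u h r) = line (s, u) (zero, h) r).
  { intros t. apply injective_projections; [|reflexivity]. simpl.
    symmetry. transitivity (plus s (@zero R_AbelianMonoid)); [|apply plus_zero_r].
    apply (f_equal (plus s)). apply (scal_zero_r (V := R_NormedModule)). }
  apply (is_derive_ext (fun r => K (line (s, u) (zero, h) r))).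
  { intros t. now rewrite HL. }
  rewrite HL. apply is_derive_line. apply Ck_S_iff in HK. intros; apply HK.
Qed.

Lemma is_derive_RInt_section (K : R * U -> R) (u h : U) : Ck 1 K ->
  is_derive (fun r => RInt (fun s => K (s, line u h r)) a b) 0
    (RInt (fun s => pd (zero, h) K (s, u)) a b).
Proof.
  intros HK.
  assert (CK : forall q, continuous K q). { intros q. exact (Ck_continuous 1 K q HK). }
  assert (CD : forall q, continuous (pd (zero, h) K) q).
  { intros q. apply Ck_S_iff in HK. exact (Ck_continuous 0 _ q (proj2 (proj2 HK) (zero, h))). }
  evar_last.
  - apply (is_derive_RInt_param (fun r s => K (s, line u h r))).
    + apply filter_forall. intros r s _. eexists. now apply is_derive_section.
    + intros s _. apply (continuity_2d_pt_ext (fun r s => pd (zero, h) K (s, line u h r))).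
      { intros r t. symmetry. apply is_derive_unique. now apply is_derive_section. }
      apply continuity_2d_pt_filterlim.
      change (continuous (fun q : R2 => pd (zero, h) K (snd q, line u h (fst q))) (0, s)).
      apply (continuous_comp (fun q : R2 => (snd q, line u h (fst q))) (pd (zero, h) K)).
      * apply continuous_pair. apply continuous_snd.
        apply (continuous_comp fst (line u h)). apply continuous_fst. apply line_continuous.
      * apply CD.
    + apply filter_forall. intros r. now apply ex_RInt_section.
  - apply RInt_ext. intros s _. apply pd_section.
Qed.

Lemma Ck_RInt_section (k : nat) : forall K : R * U -> R,
  Ck k K -> Ck k (fun u => RInt (fun s => K (s, u)) a b).
Proof.
  induction k as [|k IH]; intros K HK.
  - apply Ck_0_iff. intros u. apply continuous_RInt_section. exact (proj1 HK).
  - assert (HK1 : Ck 1 K).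
    { clear -HK. induction k. exact HK. apply IHk. now apply Ck_weaken. }
    apply Ck_S_iff in HK. split.
    + intros u. apply continuous_RInt_section. apply HK.
    + exists (fun h u => RInt (fun s => pd (zero, h) K (s, u)) a b). split.
      * intros h u. now apply (is_derive_RInt_section K u h).
      * intros h. apply IH. apply HK.
Qed.

Lemma smooth_RInt_section (K : R * U -> R) : smooth K ->
  smooth (fun u => RInt (fun s => K (s, u)) a b).
Proof. intros HK k. now apply Ck_RInt_section. Qed.

Lemma pd_RInt_section (K : R * U -> R) (u h : U) : smooth K ->
  pd h (fun u => RInt (fun s => K (s, u)) a b) u = RInt (fun s => pd (zero, h) K (s, u)) a b.
Proof. intros HK. apply pd_eq. apply is_derive_RInt_section. apply HK. Qed.
End Param.

(** * Primitives and a smooth implicit function theorem in one unknown *)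

Lemma smooth_fst3 : smooth (fun q : R * R2 => fst q).
Proof. apply smooth_linear. apply is_linear_fst. Qed.
Lemma smooth_fst_snd3 : smooth (fun q : R * R2 => fst (snd q)).
Proof.
  apply smooth_linear. apply (is_linear_comp (fun q : R * R2 => snd q) (fun q : R2 => fst q)).
  apply is_linear_snd. apply is_linear_fst.
Qed.
Lemma smooth_snd_snd3 : smooth (fun q : R * R2 => snd (snd q)).
Proof.
  apply smooth_linear. apply (is_linear_comp (fun q : R * R2 => snd q) (fun q : R2 => snd q)).
  apply is_linear_snd. apply is_linear_snd.
Qed.

Lemma line_e0 (t s : R) (p : R2) : line (t, p) e0 s = (t + s, p).
Proof.
  destruct p as [x y].
  change ((t + s * 1, (x + s * 0, y + s * 0)) = (t + s, (x, y))).
  rewrite Rmult_1_r, Rmult_0_r, !Rplus_0_r. reflexivity.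
Qed.

Lemma is_derive_e0 (f : R * R2 -> R) (t : R) (p : R2) : smooth f ->
  is_derive (fun s : R => f (s, p)) t (pd e0 f (t, p)).
Proof.
  intros Hf. apply (is_derive_ext (fun s => f (line (0, p) e0 s))).
  { intros s. now rewrite line_e0, Rplus_0_l. }
  replace (t, p) with (line (0, p) e0 t) at 1 by now rewrite line_e0, Rplus_0_l.
  now apply smooth_is_derive_line.
Qed.

Lemma pd_e0_eq (f : R * R2 -> R) (t : R) (p : R2) (l : R) :
  is_derive (fun s : R => f (s, p)) t l -> pd e0 f (t, p) = l.
Proof.
  intros H. apply pd_eq. apply (is_derive_ext (fun s => f (t + s, p))).
  { intros s. now rewrite line_e0. }
  evar_last.
  apply (is_derive_comp (fun s => f (s, p)) (fun s => t + s)).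
  rewrite Rplus_0_r. exact H. auto_derive. trivial. reflexivity. apply Rmult_1_l.
Qed.

(** The primitive from 0 to t is t times an integral over the fixed interval
    [0, 1], to which smooth dependence on parameters applies in all variables. *)
Lemma smooth_primitive (k : R * R2 -> R) : smooth k ->
  exists E : R * R2 -> R, smooth E /\
    (forall p, E (0, p) = 0) /\ (forall q, pd e0 E q = k q).
Proof.
  intros Hk.
  exists (fun q => fst q * RInt (fun s => k (s * fst q, snd q)) 0 1).
  assert (HK : smooth (fun z : R * (R * R2) => k (fst z * fst (snd z), snd (snd z)))).
  { assert (S1 : smooth (fun z : R * (R * R2) => snd z))
      by exact (smooth_linear _ (is_linear_snd (U := R_NormedModule) (V := NR3))).
    apply (smooth_comp3 k (fun z : R * (R * R2) => (fst z * fst (snd z), snd (snd z)))).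
    exact Hk.
    apply (smooth_pair (fun z : R * (R * R2) => fst z * fst (snd z)) (fun z : R * (R * R2) => snd (snd z))).
    - apply (smooth_mult (fun z : R * (R * R2) => fst z) (fun z : R * (R * R2) => fst (snd z))).
      + exact (smooth_linear _ (is_linear_fst (U := R_NormedModule) (V := NR3))).
      + exact (smooth_fst_comp (fun z : R * (R * R2) => snd z) S1).
    - exact (smooth_snd_comp (fun z : R * (R * R2) => snd z) S1). }
  assert (HE : smooth (fun q => fst q * RInt (fun s => k (s * fst q, snd q)) 0 1)).
  { apply smooth_mult. apply smooth_fst3.
    exact (smooth_RInt_section 0 1 ltac:(lra) _ HK). }
  split; [exact HE|]. split.
  - intros p. simpl. ring.
  - intros [t p]. apply pd_e0_eq. cbn [fst snd].
    assert (Ck : forall t, continuous (fun s => k (s, p)) t).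
    { intros s. apply continuous_section. intros q. exact (smooth_continuous_R (U := NR3) k q Hk). }
    apply (is_derive_ext (fun t => RInt (fun s => k (s, p)) 0 t)).
    + intros s.
      assert (H := RInt_comp_lin (V := R_CompleteNormedModule) (fun s => k (s, p)) s 0 0 1).
      rewrite !Rmult_0_r, Rmult_1_r, !Rplus_0_r in H. rewrite <- H.
      * etransitivity. apply RInt_scal.
        apply ex_RInt_of_continuous. intros z.
        apply (continuous_comp (fun z => s * z + 0) (fun s => k (s, p))).
        apply (ex_derive_continuous (fun z => s * z + 0)). auto_derive. trivial.
        apply Ck.
        change (s * RInt (fun z => k (s * z + 0, p)) 0 1 = s * RInt (fun z => k (z * s, p)) 0 1).
        f_equal. apply RInt_ext. intros z _. f_equal. f_equal. simpl. ring.
      * apply ex_RInt_of_continuous. intros; apply Ck.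
    + apply (is_derive_RInt (V := R_NormedModule) (fun s => k (s, p)) (fun t => RInt (fun s => k (s, p)) 0 t) 0 t).
      * apply filter_forall. intros s. apply (RInt_correct (V := R_CompleteNormedModule)).
        apply ex_RInt_of_continuous. intros; apply Ck.
      * apply Ck.
Qed.

Lemma is_derive_slope (phi : R -> R) :
  continuous phi 0 -> is_derive (fun r => r * phi r) 0 (phi 0).
Proof.
  intros H. apply is_derive_Reals. intros eps Heps.
  destruct (H (ball (phi 0) (mkposreal _ Heps))) as [d Hd]. apply locally_ball.
  exists d. intros h Hh Hhd. rewrite Rplus_0_l, Rmult_0_l.
  replace ((h * phi h - 0) / h - phi 0) with (phi h - phi 0) by (field; auto).
  apply (Hd h). change (Rabs (h - 0) < d). now rewrite Rminus_0_r.
Qed.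

(** Caratheodory's form of differentiability. *)
Lemma slope_continuous (f : R -> R) (l : R) : f 0 = 0 -> is_derive f 0 l ->
  continuous (fun r => if Req_EM_T r 0 then l else f r / r) 0.
Proof.
  intros H0 H P [eps HP]. apply is_derive_Reals in H.
  destruct (H eps (cond_pos eps)) as [d Hd]. exists d. intros h Hh. apply HP.
  change (Rabs (h - 0) < d) in Hh. rewrite Rminus_0_r in Hh.
  destruct (Req_EM_T 0 0) as [_|n]; [|now destruct n].
  destruct (Req_EM_T h 0) as [E|n].
  - apply ball_center.
  - specialize (Hd h n Hh). now rewrite Rplus_0_l, H0, Rminus_0_r in Hd.
Qed.

(** Since [f] vanishes at 0, the second factor need only be continuous there: the
    slope of the product is the slope of [f] times [g]. *)
Lemma is_derive_vanishing_mult (f g : R -> R) (l : R) :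
  f 0 = 0 -> is_derive f 0 l -> continuous g 0 ->
  is_derive (fun r => f r * g r) 0 (l * g 0).
Proof.
  intros H0 Hf Hg. set (phi := fun r => if Req_EM_T r 0 then l else f r / r).
  apply (is_derive_ext (fun r => r * (phi r * g r))).
  { intros r. unfold phi. destruct Req_EM_T as [->|n]. rewrite H0; simpl; ring.
    simpl; field; auto. }
  replace (l * g 0) with (phi 0 * g 0).
  apply (is_derive_slope (fun r => phi r * g r)).
  apply (continuous_mult phi g). now apply slope_continuous. exact Hg.
  unfold phi. destruct Req_EM_T as [_|n]; [reflexivity|now destruct n].
Qed.

Section Implicit.
Context (E k : R * R2 -> R) (c : R) (Hc : 0 < c) (HE : smooth E)
  (HEk : forall q, pd e0 E q = k q) (Hk : forall q, c <= k q).

Lemma implicit_mean_value (s t : R) (p : R2) :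
  exists xi, Rabs (xi - s) <= Rabs (t - s) /\ E (t, p) - E (s, p) = k (xi, p) * (t - s).
Proof.
  destruct (MVT_gen (fun s => E (s, p)) s t (fun s => k (s, p))) as [xi [Hxi HM]].
  - intros r _. rewrite <- HEk. now apply is_derive_e0.
  - intros r _. apply continuity_pt_filterlim.
    apply (ex_derive_continuous (fun s => E (s, p))). eexists; now apply is_derive_e0.
  - exists xi. split; [|exact HM].
    revert Hxi. unfold Rmin, Rmax. destruct (Rle_dec s t); intros ?;
    unfold Rabs; repeat destruct Rcase_abs; lra.
Qed.

(** [E] expands distances in the time variable by at least [c]; existence,
    uniqueness and continuity of the solution all rest on this. *)
Lemma implicit_expanding (s t : R) (p : R2) :
  c * Rabs (t - s) <= Rabs (E (t, p) - E (s, p)).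
Proof.
  destruct (implicit_mean_value s t p) as [xi [_ H]]. rewrite H, Rabs_mult.
  apply Rmult_le_compat_r. apply Rabs_pos. eapply Rle_trans; [apply Hk|apply Rle_abs].
Qed.

Lemma implicit_exists (q : R * R2) : exists s, E (s, snd q) = fst q.
Proof.
  destruct q as [y p]; simpl.
  (* A radius beyond which the expansion by [c] exceeds the distance to [y]. *)
  set (d := (Rabs (y - E (0, p)) + 1) / c).
  assert (Hd : 0 < d). { apply Rdiv_lt_0_compat; auto. assert (H := Rabs_pos (y - E (0, p))). lra. }
  assert (Hcd : c * d = Rabs (y - E (0, p)) + 1) by (unfold d; field; lra).
  assert (H1 : E (0, p) + c * d <= E (d, p)).
  { destruct (implicit_mean_value 0 d p) as [xi [_ H]].
    assert (c * (d - 0) <= k (xi, p) * (d - 0)) by (apply Rmult_le_compat_r; [lra|apply Hk]). lra. }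
  assert (H2 : E (- d, p) <= E (0, p) - c * d).
  { destruct (implicit_mean_value (- d) 0 p) as [xi [_ H]].
    assert (c * (0 - - d) <= k (xi, p) * (0 - - d)) by (apply Rmult_le_compat_r; [lra|apply Hk]). lra. }
  assert (Ha := Rle_abs (y - E (0, p))). assert (Hb := Rle_abs (- (y - E (0, p)))).
  rewrite Rabs_Ropp in Hb.
  destruct (IVT_gen (fun s => E (s, p)) (- d) d y) as [s [_ Hs]].
  - intros r. apply continuity_pt_filterlim.
    apply (ex_derive_continuous (fun s => E (s, p))). eexists; now apply is_derive_e0.
  - rewrite Rmin_left, Rmax_right; lra.
  - now exists s.
Qed.

Lemma implicit_unique (s t : R) (p : R2) : E (s, p) = E (t, p) -> s = t.
Proof.
  intros H. assert (H' := implicit_expanding s t p). rewrite H, Rminus_diag, Rabs_R0 in H'.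
  destruct (Req_dec t s) as [->|n]; [reflexivity|].
  assert (Hp := Rabs_pos_lt (t - s) ltac:(lra)).
  assert (0 < c * Rabs (t - s)) by now apply Rmult_lt_0_compat. lra.
Qed.

Section Solution.
Context (S : R * R2 -> R) (HS : forall q, E (S q, snd q) = fst q).

Lemma implicit_continuous (q : R * R2) : continuous S q.
Proof.
  intros P [eps HP].
  assert (C : continuous (fun z : R * R2 => fst z - E (S q, snd z)) q).
  { apply (smooth_continuous_R (fun z : R * R2 => fst z - E (S q, snd z))).
    apply (smooth_minus (U := NR3) (fun z => fst z) (fun z => E (S q, snd z))).
    apply smooth_fst3.
    apply (smooth_comp3 (U := NR3) E (fun z : R * R2 => (S q, snd z))). exact HE.
    apply (smooth_pair (fun _ : R * R2 => S q) (fun z : R * R2 => snd z)).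
    exact (smooth_const (U := NR3) (S q)). exact (smooth_linear _ (is_linear_snd (U := R_NormedModule) (V := NR2))). }
  assert (He : 0 < c * eps). { apply Rmult_lt_0_compat. exact Hc. apply eps. }
  destruct (C (ball (fst q - E (S q, snd q)) (mkposreal _ He))) as [d Hd]. apply locally_ball.
  exists d. intros z Hz. apply HP. specialize (Hd z Hz).
  change (Rabs ((fst z - E (S q, snd z)) - (fst q - E (S q, snd q))) < c * eps) in Hd.
  rewrite HS, Rminus_diag, Rminus_0_r in Hd.
  change (Rabs (S z - S q) < eps).
  apply Rmult_lt_reg_l with c. exact Hc.
  refine (Rle_lt_trans _ _ _ (implicit_expanding (S q) (S z) (snd z)) _).
  exact (eq_ind_r (fun r => Rabs (r - E (S q, snd z)) < c * eps) Hd (HS z)).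
Qed.

(** By the mean value theorem the increment of the solution is that of the data
    divided by the value of [k] at an intermediate time; the latter is known only
    to be continuous at 0, and the former vanishes at 0. *)
Lemma implicit_is_derive (h q : R * R2) :
  is_derive (fun r => S (line q h r)) 0 ((fst h - pd (0, snd h) E (S q, snd q)) * / k (S q, snd q)).
Proof.
  assert (CS : continuous (fun r => S (line q h r)) 0).
  { apply (continuous_comp (line q h) S). apply line_continuous. apply implicit_continuous. }
  destruct (functional_choice (fun r xi => Rabs (xi - S q) <= Rabs (S (line q h r) - S q) /\
    E (S (line q h r), snd (line q h r)) - E (S q, snd (line q h r)) =
       k (xi, snd (line q h r)) * (S (line q h r) - S q))) as [xi Hxi].
  { intros r. apply implicit_mean_value. }
  assert (X0 : xi 0 = S q).
  { destruct (Hxi 0) as [H _]. rewrite line_0, Rminus_diag, Rabs_R0 in H.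
    assert (H' := Rabs_pos (xi 0 - S q)).
    destruct (Req_dec (xi 0 - S q) 0) as [|n]; [lra|]. apply Rabs_pos_lt in n. lra. }
  assert (Cxi : continuous xi 0).
  { intros P [eps HP].
    destruct (CS (ball (S (line q h 0)) eps)) as [d Hd]. apply locally_ball.
    exists d. intros r Hr. apply HP. specialize (Hd r Hr).
    rewrite X0. rewrite line_0 in Hd.
    change (Rabs (xi r - S q) < eps). eapply Rle_lt_trans; [apply Hxi|exact Hd]. }
  assert (Kp : forall z, k z <> 0). { intros z. specialize (Hk z). lra. }
  apply (is_derive_ext (fun r => S q +
    (r * fst h - (E (S q, snd (line q h r)) - E (S q, snd q))) * / k (xi r, snd (line q h r)))).
  { intros r. destruct (Hxi r) as [_ H]. rewrite HS in H. rewrite HS.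
    replace (r * fst h - (E (S q, snd (line q h r)) - fst q)) with
      (k (xi r, snd (line q h r)) * (S (line q h r) - S q)).
    2: { rewrite <- H.
      change (fst q + r * fst h - E (S q, snd (line q h r)) =
        r * fst h - (E (S q, snd (line q h r)) - fst q)). ring. }
    simpl. field. apply Kp. }
  assert (DE : is_derive (fun r => E (S q, snd (line q h r))) 0 (pd (0, snd h) E (S q, snd q))).
  { apply (is_derive_ext (fun r => E (line (S q, snd q) (0, snd h) r))).
    { intros r. apply f_equal. apply injective_projections; [|reflexivity].
      change (S q + r * 0 = S q). ring. }
    now apply smooth_is_derive. }
  evar_last.
  - apply (is_derive_plus (fun _ => S q)). apply is_derive_const.
    apply (is_derive_vanishing_mult
      (fun r => r * fst h - (E (S q, snd (line q h r)) - E (S q, snd q)))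
      (fun r => / k (xi r, snd (line q h r))) (fst h - pd (0, snd h) E (S q, snd q))).
    + rewrite line_0. change (0 * fst h - (E (S q, snd q) - E (S q, snd q)) = 0). ring.
    + apply (is_derive_minus (fun r => r * fst h)). auto_derive; trivial; ring.
      evar_last. apply (is_derive_minus _ (fun _ => E (S q, snd q)) 0 _ 0 DE).
      apply (is_derive_const (E (S q, snd q))). apply Rminus_0_r.
    + apply (continuous_comp (fun r => k (xi r, snd (line q h r))) Rinv).
      apply (continuous_comp (fun r => (xi r, snd (line q h r))) k).
      apply continuous_pair. exact Cxi.
      apply (continuous_comp (line q h) snd). apply line_continuous. apply continuous_snd.
      apply (continuous_ext (pd e0 E)). exact HEk.
      apply (smooth_continuous_R (pd e0 E)). now apply smooth_pd.
      apply continuous_Rinv. apply Kp.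
  - rewrite X0, line_0. apply Rplus_0_l.
Qed.

(** The formula for the derivative involves the solution only, not its
    derivatives, so one order of smoothness is gained at each step. *)
Lemma implicit_smooth : smooth S.
Proof.
  intros n. induction n as [|n IH].
  - apply Ck_0_iff. apply implicit_continuous.
  - split. apply implicit_continuous.
    exists (fun h q : NR3 => (fst h + -1 * pd (0, snd h) E (S q, snd q)) * / k (S q, snd q)). split.
    + intros h q. evar_last. apply implicit_is_derive.
      change ((fst h - pd (0, snd h) E (S q, snd q)) * / k (S q, snd q) =
        (fst h + -1 * pd (0, snd h) E (S q, snd q)) * / k (S q, snd q)). ring.
    + assert (Cf : forall f : R * R2 -> R, smooth f -> Ck n (fun q => f (S q, snd q))).
      { intros f Hf.
        assert (H := Ck_comp_R3 n f S (fun q => fst (snd q)) (fun q => snd (snd q)) (Hf n) IH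
          (smooth_fst_snd3 n) (smooth_snd_snd3 n)). revert H.
        match goal with |- Ck n ?f -> Ck n ?g => replace g with f; [trivial|] end.
        apply functional_extensionality. intros [t [x y]]. reflexivity. }
      intros h. apply Ck_mult. apply Ck_plus. apply Ck_const. apply Ck_mult. apply Ck_const.
      apply Cf. now apply smooth_pd.
      apply Ck_inv. intros q. specialize (Hk (S q, snd q)). lra.
      apply Cf. replace k with (pd e0 E). now apply smooth_pd.
      apply functional_extensionality. exact HEk.
Qed.
End Solution.

Lemma implicit_function : exists S : R * R2 -> R, smooth S /\
  forall q, E (S q, snd q) = fst q.
Proof.
  destruct (functional_choice (fun q s => E (s, snd q) = fst q) implicit_exists) as [S HS].
  exists S. split; [now apply implicit_smooth | exact HS].
Qed.
End Implicit.

(** * Polar form of disk integrals and the divergence theorem *)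

Lemma smooth_R2_of_components {U : NormedModule R_AbsRing} (g : U -> R2) :
  smooth (fun x => fst (g x)) -> smooth (fun x => snd (g x)) -> smooth g.
Proof.
  intros H1 H2. replace g with (fun x => (fst (g x), snd (g x))).
  exact (smooth_pair (fun x => fst (g x)) (fun x => snd (g x)) H1 H2).
  apply functional_extensionality. intros x. now destruct (g x).
Qed.

Lemma smooth_id_V {U : NormedModule R_AbsRing} : smooth (fun x : U => x).
Proof. apply smooth_linear. apply is_linear_id. Qed.

(** Smoothness by the syntax of the function; an arbitrary smooth outer function is
    tried last, with one, two or three real variables. *)
Ltac smooth_step :=
  match goal with
  | H : smooth ?f |- smooth ?f => exact H
  | |- @smooth _ _ sin => exact smooth_sin
  | |- @smooth _ _ cos => exact smooth_cos
  | |- @smooth ?U _ (fun x => x) => refine (@smooth_id_V U)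
  | |- @smooth ?U _ (fun x => ?c) => refine (@smooth_const U c)
  | |- @smooth ?U _ (fun x => @?f x + @?g x) => refine (@smooth_plus U f g _ _)
  | |- @smooth ?U _ (fun x => @?f x - @?g x) => refine (@smooth_minus U f g _ _)
  | |- @smooth ?U _ (fun x => @?f x * @?g x) => refine (@smooth_mult U f g _ _)
  | |- @smooth ?U _ (fun x => @?f x ^ ?n) => refine (@smooth_pow U f n _)
  | |- @smooth ?U _ (fun x => - @?f x) => refine (@smooth_opp U f _)
  | |- @smooth ?U _ (fun x => (@?f x, @?g x)) =>
      first [ refine (@smooth_pair U R_NormedModule R_NormedModule f g _ _)
            | refine (@smooth_pair U R_NormedModule NR2 f g _ _) ]
  | |- @smooth ?U _ (fun x => fst (@?f x)) =>
      first [ refine (@smooth_fst_comp U R_NormedModule R_NormedModule f _)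
            | refine (@smooth_fst_comp U R_NormedModule NR2 f _)
            | refine (@smooth_fst_comp U R_NormedModule NR3 f _) ]
  | |- @smooth ?U _ (fun x => snd (@?f x)) =>
      first [ refine (@smooth_snd_comp U R_NormedModule R_NormedModule f _)
            | refine (@smooth_snd_comp U R_NormedModule NR2 f _)
            | refine (@smooth_snd_comp U R_NormedModule NR3 f _) ]
  | |- @smooth _ _ (dx ?f) => refine (smooth_dx f _)
  | |- @smooth _ _ (dy ?f) => refine (smooth_dy f _)
  | |- @smooth ?U _ (pd ?h ?f) => refine (@smooth_pd U f h _)
  | |- @smooth _ _ (Derive ?f) => refine (smooth_Derive f _)
  | |- @smooth ?U _ (fun x => ?h (@?g x)) =>
      first [ refine (@smooth_comp_R U h g _ _)
            | refine (@smooth_comp2 U h g _ _)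
            | refine (@smooth_comp3 U h g _ _) ]
  end.
Ltac smooth_auto := repeat smooth_step.

Lemma ex_RInt_smooth (f : R -> R) (a b : R) : smooth f -> ex_RInt f a b.
Proof.
  intros Hf. apply ex_RInt_of_continuous. intros x.
  exact (smooth_continuous_R (U := R_NormedModule) f x Hf).
Qed.

(** With x = cos th and y = u sin th the domain becomes a fixed rectangle and the
    integrand is smooth on it, whereas the bounds sqrt(1 - x^2) are not
    differentiable at the ends. *)
Lemma int_disk_polar (F : R2 -> R) : (forall p, continuous F p) ->
  int_disk F =
    RInt (fun th => RInt (fun u => F (cos th, u * sin th) * sin th ^ 2) (-1) 1) 0 PI.
Proof.
  intros HF.
  (* The inner integral over u; sqrt is 0 on negative arguments, so it is
     continuous on the whole line, as the substitution requires. *)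
  set (I := fun x => RInt (fun u => F (x, u * sqrt (1 - x ^ 2)) * sqrt (1 - x ^ 2)) (-1) 1).
  assert (CF : forall x y, continuous (fun y => F (x, y)) y).
  { intros x y. apply (continuous_comp (fun y : R => (x, y)) F); [|apply HF].
    apply continuous_pair. apply continuous_const. apply continuous_id. }
  assert (HI : forall x, RInt (fun y => F (x, y)) (- sqrt (1 - x ^ 2)) (sqrt (1 - x ^ 2)) = I x).
  { intros x. unfold I. set (s := sqrt (1 - x ^ 2)).
    assert (H := RInt_comp_lin (V := R_CompleteNormedModule) (fun y => F (x, y)) s 0 (-1) 1).
    replace (s * -1 + 0) with (- s) in H by ring. replace (s * 1 + 0) with s in H by ring.
    rewrite <- H.
    - apply RInt_ext. intros u _. change (s * F (x, s * u + 0) = F (x, u * s) * s).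
      rewrite Rmult_comm. do 3 f_equal. ring.
    - apply ex_RInt_of_continuous. intros; apply CF. }
  assert (CS : forall x, continuous (fun x => sqrt (1 - x ^ 2)) x).
  { intros x. apply (continuous_comp (fun x => 1 - x ^ 2) sqrt).
    apply (ex_derive_continuous (fun x => 1 - x ^ 2)). auto_derive. trivial.
    apply continuous_sqrt. }
  assert (CI : forall x, continuous I x).
  { intros x. apply (continuous_RInt_section (U := R_NormedModule) (-1) 1 ltac:(lra)
      (fun q => F (snd q, fst q * sqrt (1 - snd q ^ 2)) * sqrt (1 - snd q ^ 2))).
    intros q.
    assert (C2 : continuous (fun q : R * R => sqrt (1 - snd q ^ 2)) q).
    { apply (continuous_comp (fun q : R * R => snd q) (fun x => sqrt (1 - x ^ 2))).
      apply continuous_snd. apply CS. }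
    apply (continuous_mult (fun q : R * R => F (snd q, fst q * sqrt (1 - snd q ^ 2)))
      (fun q : R * R => sqrt (1 - snd q ^ 2))); [|exact C2].
    apply (continuous_comp (fun q : R * R => (snd q, fst q * sqrt (1 - snd q ^ 2))) F); [|apply HF].
    apply continuous_pair. apply continuous_snd.
    apply (continuous_mult (fun q : R * R => fst q) (fun q : R * R => sqrt (1 - snd q ^ 2))).
    apply continuous_fst. exact C2. }
  transitivity (RInt I (-1) 1).
  { unfold int_disk. apply RInt_ext. intros x _. apply HI. }
  assert (H := RInt_comp (V := R_CompleteNormedModule) I cos (fun x => - sin x) 0 PI).
  rewrite cos_0, cos_PI in H.
  replace (RInt I (-1) 1) with (- RInt I 1 (-1)).
  2: { apply (opp_RInt_swap (V := R_CompleteNormedModule) I 1 (-1)).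
       apply ex_RInt_of_continuous. intros; apply CI. }
  rewrite <- H; clear H.
  - assert (CIs : ex_RInt (fun y => scal (- sin y) (I (cos y))) 0 PI).
    { apply ex_RInt_of_continuous. intros z.
      apply (continuous_mult (fun y => - sin y) (fun y => I (cos y))).
      apply (ex_derive_continuous (fun y => - sin y)). auto_derive. trivial.
      apply (continuous_comp cos I). apply continuous_cos. apply CI. }
    etransitivity. symmetry. exact (RInt_opp _ _ _ CIs).
    apply RInt_ext. rewrite Rmin_left, Rmax_right by (left; apply PI_RGT_0). intros t Ht.
    assert (Hs := sin_gt_0 t (proj1 Ht) (proj2 Ht)).
    assert (Es : sqrt (1 - cos t ^ 2) = sin t).
    { rewrite <- (sqrt_Rsqr (sin t)) by lra. f_equal.
      assert (H := sin2_cos2 t). unfold Rsqr in *. simpl. lra. }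
    change (- (- sin t * I (cos t)) = RInt (fun u => F (cos t, u * sin t) * sin t ^ 2) (-1) 1).
    unfold I. rewrite Es.
    transitivity (sin t * RInt (fun u => F (cos t, u * sin t) * sin t) (-1) 1). ring.
    etransitivity. symmetry. apply (RInt_scal (V := R_CompleteNormedModule)).
    + apply ex_RInt_of_continuous. intros u.
      apply (continuous_mult (fun u => F (cos t, u * sin t)) (fun _ => sin t)); [|apply continuous_const].
      apply (continuous_comp (fun u => u * sin t) (fun y => F (cos t, y))); [|apply CF].
      apply (ex_derive_continuous (fun u => u * sin t)). auto_derive. trivial.
    + apply RInt_ext. intros u _. change (sin t * (F (cos t, u * sin t) * sin t) = F (cos t, u * sin t) * sin t ^ 2). ring.
  - intros; apply CI.
  - intros x _. split. auto_derive. trivial. ring.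
    apply (ex_derive_continuous (fun x => - sin x)). auto_derive. trivial.
Qed.

Lemma RInt_symmetric (q : R -> R) (a : R) : (forall x, continuous q x) ->
  RInt q (- a) a = RInt (fun x => q x + q (- x)) 0 a.
Proof.
  intros Hq.
  assert (Ex : forall a b, ex_RInt q a b).
  { intros. apply ex_RInt_of_continuous. intros; apply Hq. }
  assert (Hq' : forall x, continuous (fun x => q (- x)) x).
  { intros x. apply (continuous_comp Ropp q); [|apply Hq].
    apply (ex_derive_continuous Ropp). auto_derive. trivial. }
  assert (Ex' : forall a b, ex_RInt (fun x => q (- x)) a b).
  { intros. apply ex_RInt_of_continuous. intros; apply Hq'. }
  rewrite <- (RInt_Chasles (V := R_CompleteNormedModule) q (- a) 0 a) by apply Ex.
  etransitivity; [|symmetry; apply (RInt_plus (V := R_CompleteNormedModule) q (fun x => q (- x))); auto].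
  etransitivity; [apply plus_comm|]. apply f_equal.
  assert (H := RInt_comp_lin (V := R_CompleteNormedModule) q (-1) 0 0 a (Ex _ _)).
  replace (-1 * 0 + 0) with 0 in H by ring. replace (-1 * a + 0) with (- a) in H by ring.
  rewrite <- (opp_RInt_swap (V := R_CompleteNormedModule) q 0 (- a)) by apply Ex. rewrite <- H.
  etransitivity. symmetry. apply (RInt_opp (V := R_CompleteNormedModule)).
  - apply (ex_RInt_ext (V := R_NormedModule) (fun x => - q (- x))).
    + intros x _. change (- q (- x) = -1 * q (-1 * x + 0)). replace (-1 * x + 0) with (- x) by ring. ring.
    + apply (ex_RInt_opp (V := R_NormedModule)). auto.
  - apply RInt_ext. intros x _. change (- (-1 * q (-1 * x + 0)) = q (- x)).
    replace (-1 * x + 0) with (- x) by ring. ring.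
Qed.

Lemma RInt_of_derive (f df : R -> R) (a b : R) :
  (forall x, is_derive f x (df x)) -> (forall x, continuous df x) -> RInt df a b = f b - f a.
Proof.
  intros H1 H2. apply is_RInt_unique. apply (is_RInt_derive (V := R_CompleteNormedModule)); auto.
Qed.

Lemma line_R_sub (x t : R) : t = line x 1 (t - x).
Proof. change (t = x + (t - x) * 1). ring. Qed.

(** The [dy] part is the fundamental theorem of calculus in u.  For the [dx] part
    consider K(th), the integral of [P] over the vertical chord at cos th: its
    derivative consists of the boundary terms minus the integral of [dx P] times
    sin th, and K vanishes at 0 and PI. *)
Lemma divergence_disk (P Q : R2 -> R) : smooth P -> smooth Q ->
  int_disk (fun p => dx P p + dy Q p) =
  RInt (fun th => P (cos th, sin th) * cos th + Q (cos th, sin th) * sin th) (- PI) PI.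
Proof.
  intros HP HQ.
  rewrite int_disk_polar.
  2: { intros p. apply (smooth_continuous_R (fun p => dx P p + dy Q p)). smooth_auto. }
  rewrite RInt_symmetric.
  2: { intros x. apply (smooth_continuous_R (fun th => P (cos th, sin th) * cos th + Q (cos th, sin th) * sin th)).
       smooth_auto. }
  set (A := fun th => RInt (fun u => dx P (cos th, u * sin th) * sin th ^ 2) (-1) 1).
  set (K := fun th => RInt (fun u => P (cos th, u * sin th) * sin th) (-1) 1).
  set (b := fun th => cos th * (P (cos th, sin th) + P (cos th, - sin th))).
  set (d := fun th => sin th * (Q (cos th, sin th) - Q (cos th, - sin th))).
  assert (SA : smooth A).
  { apply (smooth_RInt_section (U := R_NormedModule) (-1) 1 ltac:(lra)
      (fun q => dx P (cos (snd q), fst q * sin (snd q)) * sin (snd q) ^ 2)).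
    smooth_auto. }
  assert (Sb : smooth b) by (unfold b; smooth_auto).
  assert (Sd : smooth d) by (unfold d; smooth_auto).
  assert (HB : forall th, RInt (fun u => dy Q (cos th, u * sin th) * sin th ^ 2) (-1) 1 = d th).
  { intros th. rewrite (RInt_of_derive (fun u => sin th * Q (cos th, u * sin th))).
    - unfold d. replace (1 * sin th) with (sin th) by ring. replace (-1 * sin th) with (- sin th) by ring.
      change (sin th * Q (cos th, sin th) - sin th * Q (cos th, - sin th) =
        sin th * (Q (cos th, sin th) - Q (cos th, - sin th))). ring.
    - intros u. evar_last. apply is_derive_scal.
      apply (is_derive_comp (fun y => Q (cos th, y)) (fun u => u * sin th)).
      apply is_derive_dy. exact HQ. auto_derive. trivial. reflexivity.
      change (sin th * (1 * sin th * dy Q (cos th, u * sin th)) = dy Q (cos th, u * sin th) * sin th ^ 2). ring.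
    - intros u. apply (smooth_continuous_R (fun u => dy Q (cos th, u * sin th) * sin th ^ 2)). smooth_auto. }
  assert (HK : forall th, is_derive K th (b th - A th)).
  { intros th.
    set (KK := fun q : R * R => P (cos (snd q), fst q * sin (snd q)) * sin (snd q)).
    assert (SKK : smooth KK) by (unfold KK; smooth_auto).
    assert (DKK : forall u, pd (zero, 1) KK (u, th) =
       cos th * (P (cos th, u * sin th) + u * (sin th * dy P (cos th, u * sin th)))
         - dx P (cos th, u * sin th) * sin th ^ 2).
    { intros u. change (zero, 1) with ((0, 1) : R2). rewrite <- dy_pd. unfold dy. cbn [fst snd].
      apply is_derive_unique. unfold KK. cbn [fst snd].
      evar_last. apply (is_derive_mult (fun t => P (cos t, u * sin t)) sin th
        (- sin th * dx P (cos th, u * sin th) + u * cos th * dy P (cos th, u * sin th)) (cos th)).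
      apply (is_derive_comp_R2 P cos (fun t => u * sin t) th (- sin th) (u * cos th)). exact HP.
      apply is_derive_cos. auto_derive. trivial. ring.
      apply is_derive_sin. intros; apply Rmult_comm.
      change ((- sin th * dx P (cos th, u * sin th) + u * cos th * dy P (cos th, u * sin th)) * sin th +
        P (cos th, u * sin th) * cos th =
        cos th * (P (cos th, u * sin th) + u * (sin th * dy P (cos th, u * sin th))) -
          dx P (cos th, u * sin th) * sin th ^ 2). ring. }
    assert (H := is_derive_RInt_section (U := R_NormedModule) (-1) 1 KK th 1 (SKK 1%nat)).
    evar_last.
    - apply (is_derive_ext (fun t => RInt (fun s => KK (s, line th 1 (t - th))) (-1) 1)).
      { intros t. unfold K, KK. apply RInt_ext. intros u _. cbn [fst snd].
        replace (line th 1 (t - th)) with t. reflexivity. apply (line_R_sub th t). }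
      apply (is_derive_comp (fun r => RInt (fun s => KK (s, line th 1 r)) (-1) 1) (fun t => t - th)).
      rewrite Rminus_diag. exact H. auto_derive. trivial. reflexivity.
    - etransitivity. apply Rmult_1_l.
      transitivity (RInt (fun u => cos th * (P (cos th, u * sin th) + u * (sin th * dy P (cos th, u * sin th)))
         - dx P (cos th, u * sin th) * sin th ^ 2) (-1) 1).
      { apply RInt_ext. intros; apply DKK. }
      etransitivity. apply (RInt_minus (V := R_CompleteNormedModule)
        (fun u => cos th * (P (cos th, u * sin th) + u * (sin th * dy P (cos th, u * sin th))))
        (fun u => dx P (cos th, u * sin th) * sin th ^ 2)).
      apply ex_RInt_smooth; smooth_auto. apply ex_RInt_smooth; smooth_auto.
      change (RInt (fun u => cos th * (P (cos th, u * sin th) + u * (sin th * dy P (cos th, u * sin th)))) (-1) 1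
        - A th = b th - A th). apply (f_equal (fun r => r - A th)).
      rewrite (RInt_of_derive (fun u => cos th * (u * P (cos th, u * sin th)))).
      + unfold b. replace (1 * sin th) with (sin th) by ring. replace (-1 * sin th) with (- sin th) by ring.
        change (cos th * (1 * P (cos th, sin th)) - cos th * (-1 * P (cos th, - sin th)) =
          cos th * (P (cos th, sin th) + P (cos th, - sin th))). ring.
      + intros u. apply is_derive_scal. evar_last.
        apply (is_derive_mult (fun u => u) (fun u => P (cos th, u * sin th)) u 1).
        apply (is_derive_id (K := R_AbsRing)).
        apply (is_derive_comp (fun y => P (cos th, y)) (fun u => u * sin th)).
        apply is_derive_dy. exact HP. auto_derive. trivial. reflexivity. intros; apply Rmult_comm.
        change (1 * P (cos th, u * sin th) + u * (1 * sin th * dy P (cos th, u * sin th)) =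
          P (cos th, u * sin th) + u * (sin th * dy P (cos th, u * sin th))). ring.
      + intros u. apply (smooth_continuous_R (fun u => cos th *
         (P (cos th, u * sin th) + u * (sin th * dy P (cos th, u * sin th))))). smooth_auto. }
  assert (IA : RInt A 0 PI = RInt b 0 PI).
  { assert (H : RInt (fun th => b th - A th) 0 PI = K PI - K 0).
    { apply RInt_of_derive. exact HK. intros x. apply (smooth_continuous_R (fun th => b th - A th)). smooth_auto. }
    rewrite (RInt_minus (V := R_CompleteNormedModule) b A) in H by (apply ex_RInt_smooth; assumption).
    assert (K0 : forall t, sin t = 0 -> K t = 0).
    { intros t Ht. unfold K. rewrite Ht.
      rewrite (RInt_ext _ (fun _ => 0)) by (intros; apply Rmult_0_r).
      rewrite RInt_const. apply Rmult_0_r. }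
    rewrite (K0 PI sin_PI), (K0 0 sin_0) in H.
    change (RInt b 0 PI - RInt A 0 PI = 0 - 0) in H. lra. }
  transitivity (RInt (fun th => plus (A th) (d th)) 0 PI).
  { apply RInt_ext. intros th _. rewrite <- HB.
    etransitivity; [|apply (RInt_plus (V := R_CompleteNormedModule)
      (fun u => dx P (cos th, u * sin th) * sin th ^ 2) (fun u => dy Q (cos th, u * sin th) * sin th ^ 2))].
    - apply RInt_ext. intros u _. apply Rmult_plus_distr_r.
    - apply ex_RInt_smooth; smooth_auto.
    - apply ex_RInt_smooth; smooth_auto. }
  rewrite (RInt_plus (V := R_CompleteNormedModule) A d) by (apply ex_RInt_smooth; assumption).
  rewrite IA.
  rewrite <- (RInt_plus (V := R_CompleteNormedModule) b d) by (apply ex_RInt_smooth; assumption).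
  apply RInt_ext. intros th _. rewrite cos_neg, sin_neg.
  change (b th + d th = P (cos th, sin th) * cos th + Q (cos th, sin th) * sin th +
    (P (cos th, - sin th) * cos th + Q (cos th, - sin th) * - sin th)). unfold b, d. ring.
Qed.

(** * The first variation of the energy *)

Lemma is_derive_int_disk (G : R * R2 -> R) : smooth G ->
  is_derive (fun t => int_disk (fun p => G (t, p))) 0 (int_disk (fun p => pd e0 G (0, p))).
Proof.
  intros HG.
  set (G' := fun z : R * R2 => G (snd (snd z), (cos (fst (snd z)), fst z * sin (fst (snd z))))
                   * sin (fst (snd z)) ^ 2).
  assert (SG' : smooth G').
  { unfold G'.
    refine (@smooth_mult NR3 (fun z => G (snd (snd z), (cos (fst (snd z)), fst z * sin (fst (snd z)))))
       (fun z => sin (fst (snd z)) ^ 2) _ _); [|smooth_auto].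
    refine (@smooth_comp3 NR3 G (fun z => (snd (snd z), (cos (fst (snd z)), fst z * sin (fst (snd z))))) _ _);
    [exact HG|smooth_auto]. }
  set (K := fun q : R2 => RInt (fun u => G' (u, q)) (-1) 1).
  assert (SK : smooth K).
  { exact (smooth_RInt_section (U := NR2) (-1) 1 ltac:(lra) G' SG'). }
  apply (is_derive_ext (fun t => RInt (fun th => K (th, line 0 1 t)) 0 PI)).
  { intros t. rewrite int_disk_polar.
    - apply RInt_ext. intros th _. unfold K. apply RInt_ext. intros u _. unfold G'. cbn [fst snd].
      replace (line 0 1 t) with t. reflexivity. rewrite (line_R_sub 0 t) at 1. now rewrite Rminus_0_r.
    - intros p. apply (continuous_comp (fun p : R2 => (t, p)) G).
      apply continuous_pair. apply continuous_const. apply continuous_id.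
      exact (smooth_continuous_R (U := NR3) G _ HG). }
  evar_last. apply (is_derive_RInt_section (U := R_NormedModule) 0 PI K 0 1 (SK 1%nat)).
  rewrite int_disk_polar.
  - apply RInt_ext. intros th _.
    etransitivity. apply (pd_RInt_section (U := NR2) (-1) 1 G' (th, 0) (zero, 1) SG').
    apply RInt_ext. intros u _. apply pd_eq.
    apply (is_derive_ext (fun s : R => G (0 + s * 1, (cos th, u * sin th)) * sin th ^ 2)).
    { intros s.
      change (G (0 + s * 1, (cos th, u * sin th)) * sin th ^ 2 =
        G (0 + s * 1, (cos (th + s * 0), (u + s * 0) * sin (th + s * 0))) * sin (th + s * 0) ^ 2).
      now rewrite Rmult_0_r, !Rplus_0_r. }
    evar_last. apply (is_derive_mult (fun s : R => G (0 + s * 1, (cos th, u * sin th))) (fun _ => sin th ^ 2) 0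
      (pd e0 G (0, (cos th, u * sin th))) 0).
    + evar_last. apply (is_derive_comp (fun s => G (s, (cos th, u * sin th))) (fun s => 0 + s * 1)).
      apply is_derive_e0. exact HG. auto_derive. trivial. reflexivity.
      replace (0 + 0 * 1) with 0 by ring. change (1 * 1 * pd e0 G (0, (cos th, u * sin th)) =
        pd e0 G (0, (cos th, u * sin th))). ring.
    + apply (is_derive_const (sin th ^ 2) 0).
    + intros; apply Rmult_comm.
    + change (pd e0 G (0, (cos th, u * sin th)) * sin th ^ 2 + G (0 + 0 * 1, (cos th, u * sin th)) * 0
       = pd e0 G (0, (cos th, u * sin th)) * sin th ^ 2). ring.
  - intros p. apply (continuous_comp (fun p : R2 => (0, p)) (pd e0 G)).
    apply continuous_pair. apply continuous_const. apply continuous_id.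
    refine (smooth_continuous_R (U := NR3) (pd e0 G) _ _). smooth_auto.
Qed.

Section Rules.
Context (f g : R2 -> R) (p : R2) (Hf : smooth f) (Hg : smooth g).
Lemma dx_plus : dx (fun q => f q + g q) p = dx f p + dx g p.
Proof. rewrite !dx_pd. exact (pd_plus (U := NR2) f g _ p Hf Hg). Qed.
Lemma dy_plus : dy (fun q => f q + g q) p = dy f p + dy g p.
Proof. rewrite !dy_pd. exact (pd_plus (U := NR2) f g _ p Hf Hg). Qed.
Lemma dx_minus : dx (fun q => f q - g q) p = dx f p - dx g p.
Proof. rewrite !dx_pd. exact (pd_minus (U := NR2) f g _ p Hf Hg). Qed.
Lemma dy_minus : dy (fun q => f q - g q) p = dy f p - dy g p.
Proof. rewrite !dy_pd. exact (pd_minus (U := NR2) f g _ p Hf Hg). Qed.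
Lemma dx_mult : dx (fun q => f q * g q) p = dx f p * g p + f p * dx g p.
Proof. rewrite !dx_pd. exact (pd_mult (U := NR2) f g _ p Hf Hg). Qed.
Lemma dy_mult : dy (fun q => f q * g q) p = dy f p * g p + f p * dy g p.
Proof. rewrite !dy_pd. exact (pd_mult (U := NR2) f g _ p Hf Hg). Qed.
Lemma dx_opp : dx (fun q => - f q) p = - dx f p.
Proof. rewrite !dx_pd. exact (pd_opp (U := NR2) f _ p Hf). Qed.
Lemma dy_opp : dy (fun q => - f q) p = - dy f p.
Proof. rewrite !dy_pd. exact (pd_opp (U := NR2) f _ p Hf). Qed.
Lemma dx_const (c : R) : dx (fun _ => c) p = 0.
Proof. exact (Derive_const c _). Qed.
Lemma dy_const (c : R) : dy (fun _ => c) p = 0.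
Proof. exact (Derive_const c _). Qed.
Lemma dx_comp (h : R2 -> R) : smooth h ->
  dx (fun q => h (f q, g q)) p = dx f p * dx h (f p, g p) + dx g p * dy h (f p, g p).
Proof. intros Hh. rewrite (dx_pd (fun q => h (f q, g q))), (dx_pd f), (dx_pd g).
  exact (pd_comp_R2 (U := NR2) h f g _ p Hh Hf Hg). Qed.
Lemma dy_comp (h : R2 -> R) : smooth h ->
  dy (fun q => h (f q, g q)) p = dy f p * dx h (f p, g p) + dy g p * dy h (f p, g p).
Proof. intros Hh. rewrite (dy_pd (fun q => h (f q, g q))), (dy_pd f), (dy_pd g).
  exact (pd_comp_R2 (U := NR2) h f g _ p Hh Hf Hg). Qed.
Lemma dx_dy_comm : dx (dy f) p = dy (dx f) p.
Proof. rewrite dx_pd, dy_pd, dxE, dyE. exact (pd_comm (U := NR2) f _ _ p Hf). Qed.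
End Rules.

Lemma dx_ext_loc (f g : R2 -> R) (p : R2) : locally p (fun q => f q = g q) -> dx f p = dx g p.
Proof. rewrite !dx_pd. exact (pd_ext_loc (U := NR2) f g _ p). Qed.
Lemma dy_ext_loc (f g : R2 -> R) (p : R2) : locally p (fun q => f q = g q) -> dy f p = dy g p.
Proof. rewrite !dy_pd. exact (pd_ext_loc (U := NR2) f g _ p). Qed.

(** Expands all first partial derivatives and writes mixed second derivatives as
    [dy (dx f)], so that [ring] can compare the results. *)
Ltac partials :=
  repeat match goal with
  | |- context [dx (fun q => @?f q + @?g q) ?p] => rewrite (dx_plus f g p) by smooth_auto
  | |- context [dx (fun q => @?f q - @?g q) ?p] => rewrite (dx_minus f g p) by smooth_auto
  | |- context [dx (fun q => @?f q * @?g q) ?p] => rewrite (dx_mult f g p) by smooth_auto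
  | |- context [dx (fun q => - @?f q) ?p] => rewrite (dx_opp f p) by smooth_auto
  | |- context [dx (fun q => ?c) ?p] => rewrite (dx_const p c)
  | |- context [dx (fun q => ?h (@?f q, @?g q)) ?p] => rewrite (dx_comp f g p) by smooth_auto
  | |- context [dy (fun q => @?f q + @?g q) ?p] => rewrite (dy_plus f g p) by smooth_auto
  | |- context [dy (fun q => @?f q - @?g q) ?p] => rewrite (dy_minus f g p) by smooth_auto
  | |- context [dy (fun q => @?f q * @?g q) ?p] => rewrite (dy_mult f g p) by smooth_auto
  | |- context [dy (fun q => - @?f q) ?p] => rewrite (dy_opp f p) by smooth_auto
  | |- context [dy (fun q => ?c) ?p] => rewrite (dy_const p c)
  | |- context [dy (fun q => ?h (@?f q, @?g q)) ?p] => rewrite (dy_comp f g p) by smooth_auto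
  | |- context [dx (fun q => ?f q) ?p] => progress change (dx (fun q => f q) p) with (dx f p)
  | |- context [dy (fun q => ?f q) ?p] => progress change (dy (fun q => f q) p) with (dy f p)
  | |- context [dx (dy ?f) ?p] => rewrite (dx_dy_comm f p) by smooth_auto
  end; cbv beta.

Definition interior_disk (p : R2) : Prop := fst p ^ 2 + snd p ^ 2 < 1.

Lemma interior_disk_open (p : R2) : interior_disk p -> locally p interior_disk.
Proof.
  intros Hp.
  assert (C : continuous (fun q : R2 => fst q * fst q + snd q * snd q) p).
  { refine (smooth_continuous_R (U := NR2) (fun q => fst q * fst q + snd q * snd q) p _). smooth_auto. }
  unfold interior_disk in *.
  assert (H : 0 < 1 - (fst p ^ 2 + snd p ^ 2)) by lra.
  eapply filter_imp; [|exact (C _ (locally_ball (fst p * fst p + snd p * snd p) (mkposreal _ H)))].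
  intros q Hq. change (Rabs ((fst q * fst q + snd q * snd q) - (fst p * fst p + snd p * snd p))
    < 1 - (fst p ^ 2 + snd p ^ 2)) in Hq. apply Rabs_def2 in Hq. simpl in *. lra.
Qed.

Section Energy.
Context (mu f g : R2 -> R) (Hmu : smooth mu) (Hf : smooth f) (Hg : smooth g).

Definition weight (q : R2) : R := mu (f q, g q) * mu (f q, g q).
(** With [f], [g] the components of Phi and [weight] = mu^2(Phi), this is the
    integrand of [Hhat]; [hopf_re] and [hopf_im] are the real and imaginary parts
    of mu^2(Phi) times the Hopf function. *)
Definition energy (q : R2) : R :=
  weight q * ((dx f q * dx f q + dx g q * dx g q) + (dy f q * dy f q + dy g q * dy g q)).
Definition hopf_re (q : R2) : R :=
  weight q * ((dy f q * dy f q + dy g q * dy g q) - (dx f q * dx f q + dx g q * dx g q)).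
Definition hopf_im (q : R2) : R := weight q * (2 * (dx f q * dy f q + dx g q * dy g q)).

Lemma smooth_weight : smooth weight.
Proof. unfold weight. smooth_auto. Qed.
Lemma smooth_energy : smooth energy.
Proof. assert (H := smooth_weight). unfold energy. smooth_auto. Qed.
Lemma smooth_hopf_re : smooth hopf_re.
Proof. assert (H := smooth_weight). unfold hopf_re. smooth_auto. Qed.
Lemma smooth_hopf_im : smooth hopf_im.
Proof. assert (H := smooth_weight). unfold hopf_im. smooth_auto. Qed.

Definition energy_t (w1 w2 : R * R2 -> R) (q : R * R2) : R :=
  mu (w1 q, w2 q) * mu (w1 q, w2 q) *
   ((pd e1 w1 q * pd e1 w1 q + pd e1 w2 q * pd e1 w2 q) +
    (pd e2 w1 q * pd e2 w1 q + pd e2 w2 q * pd e2 w2 q)).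

Lemma pd_e1_slice (F : R * R2 -> R) (t : R) (p : R2) : pd e1 F (t, p) = dx (fun q => F (t, q)) p.
Proof.
  rewrite dx_pd. unfold pd. apply Derive_ext. intros s. f_equal.
  apply injective_projections; [|reflexivity]. change (t + s * 0 = t). ring.
Qed.
Lemma pd_e2_slice (F : R * R2 -> R) (t : R) (p : R2) : pd e2 F (t, p) = dy (fun q => F (t, q)) p.
Proof.
  rewrite dy_pd. unfold pd. apply Derive_ext. intros s. f_equal.
  apply injective_projections; [|reflexivity]. change (t + s * 0 = t). ring.
Qed.

(** Time and space derivatives commute, so d_t of the first derivatives of the map
    are first derivatives of v . grad.  The part in which v is not differentiated
    is v . grad(energy), that is div(energy v) - energy div v; the rest combines
    with - energy div v into the two Hopf terms.  The hypotheses hold only on the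
    open disk, so the point has to be interior. *)
Lemma energy_variation (w1 w2 : R * R2 -> R) (v1 v2 : R2 -> R) (p : R2) :
  smooth w1 -> smooth w2 -> smooth v1 -> smooth v2 ->
  (forall q, interior_disk q -> w1 (0, q) = f q /\ w2 (0, q) = g q) ->
  (forall q, interior_disk q ->
     pd e0 w1 (0, q) = v1 q * dx f q + v2 q * dy f q /\
     pd e0 w2 (0, q) = v1 q * dx g q + v2 q * dy g q) ->
  interior_disk p ->
  pd e0 (energy_t w1 w2) (0, p) =
    dx (fun q => energy q * v1 q) p + dy (fun q => energy q * v2 q) p
    - hopf_re p * (dx v1 p - dy v2 p) + hopf_im p * (dx v2 p + dy v1 p).
Proof.
  intros Hw1 Hw2 Hv1 Hv2 H0 H1 Hp.
  assert (Hloc := interior_disk_open p Hp).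
  destruct (H0 p Hp) as [E1 E2]. destruct (H1 p Hp) as [T1 T2].
  assert (X1 : pd e1 w1 (0, p) = dx f p).
  { rewrite pd_e1_slice. apply dx_ext_loc. revert Hloc. apply filter_imp. intros q Hq. now apply H0. }
  assert (X2 : pd e1 w2 (0, p) = dx g p).
  { rewrite pd_e1_slice. apply dx_ext_loc. revert Hloc. apply filter_imp. intros q Hq. now apply H0. }
  assert (Y1 : pd e2 w1 (0, p) = dy f p).
  { rewrite pd_e2_slice. apply dy_ext_loc. revert Hloc. apply filter_imp. intros q Hq. now apply H0. }
  assert (Y2 : pd e2 w2 (0, p) = dy g p).
  { rewrite pd_e2_slice. apply dy_ext_loc. revert Hloc. apply filter_imp. intros q Hq. now apply H0. }
  assert (TX1 : pd e0 (pd e1 w1) (0, p) = dx (fun q => v1 q * dx f q + v2 q * dy f q) p).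
  { rewrite (pd_comm (U := NR3) w1 e0 e1 (0, p) Hw1), pd_e1_slice. apply dx_ext_loc.
    revert Hloc. apply filter_imp. intros q Hq. now apply H1. }
  assert (TX2 : pd e0 (pd e1 w2) (0, p) = dx (fun q => v1 q * dx g q + v2 q * dy g q) p).
  { rewrite (pd_comm (U := NR3) w2 e0 e1 (0, p) Hw2), pd_e1_slice. apply dx_ext_loc.
    revert Hloc. apply filter_imp. intros q Hq. now apply H1. }
  assert (TY1 : pd e0 (pd e2 w1) (0, p) = dy (fun q => v1 q * dx f q + v2 q * dy f q) p).
  { rewrite (pd_comm (U := NR3) w1 e0 e2 (0, p) Hw1), pd_e2_slice. apply dy_ext_loc.
    revert Hloc. apply filter_imp. intros q Hq. now apply H1. }
  assert (TY2 : pd e0 (pd e2 w2) (0, p) = dy (fun q => v1 q * dx g q + v2 q * dy g q) p).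
  { rewrite (pd_comm (U := NR3) w2 e0 e2 (0, p) Hw2), pd_e2_slice. apply dy_ext_loc.
    revert Hloc. apply filter_imp. intros q Hq. now apply H1. }
  set (m := fun q : NR3 => mu (w1 q, w2 q)).
  assert (Em : pd e0 m (0, p) = pd e0 w1 (0, p) * dx mu (w1 (0, p), w2 (0, p)) +
      pd e0 w2 (0, p) * dy mu (w1 (0, p), w2 (0, p)))
    by exact (pd_comp_R2 (U := NR3) mu w1 w2 e0 (0, p) Hmu Hw1 Hw2).
  assert (Sm : smooth m).
  { exact (smooth_comp_R2 (U := NR3) mu w1 w2 Hmu Hw1 Hw2). }
  assert (Hsq : forall h : R * R2 -> R, smooth h -> pd e0 (fun q : NR3 => h q * h q) (0, p) =
     2 * h (0, p) * pd e0 h (0, p)).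
  { intros h Hh. rewrite (pd_mult (U := NR3) h h e0 (0, p) Hh Hh). ring. }
  assert (LHS : pd e0 (energy_t w1 w2) (0, p) =
    2 * mu (f p, g p) * (pd e0 w1 (0, p) * dx mu (f p, g p) + pd e0 w2 (0, p) * dy mu (f p, g p)) *
     ((dx f p * dx f p + dx g p * dx g p) + (dy f p * dy f p + dy g p * dy g p)) +
    mu (f p, g p) * mu (f p, g p) *
      ((2 * dx f p * pd e0 (pd e1 w1) (0, p) + 2 * dx g p * pd e0 (pd e1 w2) (0, p)) +
       (2 * dy f p * pd e0 (pd e2 w1) (0, p) + 2 * dy g p * pd e0 (pd e2 w2) (0, p)))).
  { change (energy_t w1 w2) with (fun q : NR3 => (m q * m q) *
      ((pd e1 w1 q * pd e1 w1 q + pd e1 w2 q * pd e1 w2 q) +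
       (pd e2 w1 q * pd e2 w1 q + pd e2 w2 q * pd e2 w2 q))).
    rewrite (pd_mult (U := NR3) (fun q => m q * m q)
      (fun q => (pd e1 w1 q * pd e1 w1 q + pd e1 w2 q * pd e1 w2 q) +
        (pd e2 w1 q * pd e2 w1 q + pd e2 w2 q * pd e2 w2 q))) by smooth_auto.
    rewrite (Hsq m Sm).
    rewrite (pd_plus (U := NR3) (fun q => (pd e1 w1 q * pd e1 w1 q + pd e1 w2 q * pd e1 w2 q))
        (fun q => (pd e2 w1 q * pd e2 w1 q + pd e2 w2 q * pd e2 w2 q))) by smooth_auto.
    rewrite (pd_plus (U := NR3) (fun q => pd e1 w1 q * pd e1 w1 q) (fun q => pd e1 w2 q * pd e1 w2 q)) by smooth_auto.
    rewrite (pd_plus (U := NR3) (fun q => pd e2 w1 q * pd e2 w1 q) (fun q => pd e2 w2 q * pd e2 w2 q)) by smooth_auto.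
    rewrite !Hsq by smooth_auto.
    rewrite Em. unfold m. rewrite E1, E2, X1, X2, Y1, Y2. ring. }
  rewrite LHS, T1, T2, TX1, TX2, TY1, TY2.
  assert (S1 := smooth_energy). assert (S2 := smooth_weight).
  rewrite (dx_mult energy v1 p S1 Hv1), (dy_mult energy v2 p S1 Hv2).
  unfold hopf_re, hopf_im, energy, weight.
  partials. ring.
Qed.

Context (psi r : R2 -> R) (Hpsi : smooth psi) (Hr : smooth r).

(** With [r] = 1 / (2 eta), [field1] + i [field2] = i eta^-1 dbar psi. *)
Definition field1 (q : R2) : R := - (r q * dy psi q).
Definition field2 (q : R2) : R := r q * dx psi q.
(** [hopf_dbar_re] + i [hopf_dbar_im] is 2 dbar(mu^2(Phi) f_Phi), and
    [interior_density] is 2 Im dbar(eta^-1 dbar(mu^2(Phi) f_Phi)). *)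
Definition hopf_dbar_re (q : R2) : R := dx hopf_re q - dy hopf_im q.
Definition hopf_dbar_im (q : R2) : R := dy hopf_re q + dx hopf_im q.
Definition interior_density (q : R2) : R :=
  dx (fun q => r q * hopf_dbar_im q) q + dy (fun q => r q * hopf_dbar_re q) q.
Definition flux1 (q : R2) : R :=
  energy q * field1 q - hopf_re q * field1 q + hopf_im q * field2 q
    - psi q * (r q * hopf_dbar_im q).
Definition flux2 (q : R2) : R :=
  energy q * field2 q + hopf_re q * field2 q + hopf_im q * field1 q
    - psi q * (r q * hopf_dbar_re q).

Lemma smooth_field1 : smooth field1.
Proof. unfold field1. smooth_auto. Qed.
Lemma smooth_field2 : smooth field2.
Proof. unfold field2. smooth_auto. Qed.
Lemma smooth_hopf_dbar_re : smooth hopf_dbar_re.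
Proof. assert (H1 := smooth_hopf_re). assert (H2 := smooth_hopf_im). unfold hopf_dbar_re. smooth_auto. Qed.
Lemma smooth_hopf_dbar_im : smooth hopf_dbar_im.
Proof. assert (H1 := smooth_hopf_re). assert (H2 := smooth_hopf_im). unfold hopf_dbar_im. smooth_auto. Qed.
Lemma smooth_interior_density : smooth interior_density.
Proof.
  assert (H1 := smooth_hopf_dbar_re). assert (H2 := smooth_hopf_dbar_im).
  unfold interior_density.
  refine (@smooth_plus NR2 (dx (fun q => r q * hopf_dbar_im q)) (dy (fun q => r q * hopf_dbar_re q)) _ _);
  smooth_auto.
Qed.
Lemma smooth_flux1 : smooth flux1.
Proof.
  assert (H1 := smooth_hopf_dbar_im). assert (H2 := smooth_hopf_re). assert (H3 := smooth_hopf_im).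
  assert (H4 := smooth_energy). assert (H5 := smooth_field1). assert (H6 := smooth_field2).
  unfold flux1. smooth_auto.
Qed.
Lemma smooth_flux2 : smooth flux2.
Proof.
  assert (H1 := smooth_hopf_dbar_re). assert (H2 := smooth_hopf_re). assert (H3 := smooth_hopf_im).
  assert (H4 := smooth_energy). assert (H5 := smooth_field1). assert (H6 := smooth_field2).
  unfold flux2. smooth_auto.
Qed.

(** Two integrations by parts in divergence form: the derivatives go from the
    field to the Hopf terms, which leaves
    - r (psi_y hopf_dbar_re + psi_x hopf_dbar_im), and then from psi to the other
    factors. *)
Lemma variation_density (p : R2) :
  dx (fun q => energy q * field1 q) p + dy (fun q => energy q * field2 q) p
    - hopf_re p * (dx field1 p - dy field2 p) + hopf_im p * (dx field2 p + dy field1 p)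
  = dx flux1 p + dy flux2 p + psi p * interior_density p.
Proof.
  assert (Hre := smooth_hopf_re). assert (Him := smooth_hopf_im).
  assert (Hdr := smooth_hopf_dbar_re). assert (Hdi := smooth_hopf_dbar_im).
  assert (He := smooth_energy). assert (H1 := smooth_field1). assert (H2 := smooth_field2).
  unfold flux1, flux2, interior_density. partials.
  unfold hopf_dbar_im at 2 4. unfold hopf_dbar_re at 2 4.
  unfold field1, field2, hopf_dbar_re, hopf_dbar_im. partials. ring.
Qed.

(** On the circle psi = 0 and its gradient is normal, so the field is a multiple of
    (-y, x): the energy term drops out and only the Hopf terms contribute. *)
Lemma flux_boundary (p : R2) : psi p = 0 -> boundary_disk p ->
  fst p * dy psi p = snd p * dx psi p ->
  flux1 p * fst p + flux2 p * snd p =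
  (fst p * dx psi p + snd p * dy psi p) * r p *
    (2 * hopf_re p * fst p * snd p + hopf_im p * (fst p ^ 2 - snd p ^ 2)).
Proof.
  unfold boundary_disk. intros H0 Hp Ht. unfold flux1, flux2, field1, field2. rewrite H0.
  set (x := fst p) in *. set (y := snd p) in *. set (N := x * dx psi p + y * dy psi p).
  assert (Ex : dx psi p = x * N).
  { unfold N. transitivity ((x ^ 2 + y ^ 2) * dx psi p). rewrite Hp; ring.
    transitivity (x ^ 2 * dx psi p + y * (y * dx psi p)). ring. rewrite <- Ht. ring. }
  assert (Ey : dy psi p = y * N).
  { unfold N. transitivity ((x ^ 2 + y ^ 2) * dy psi p). rewrite Hp; ring.
    transitivity (x * (x * dy psi p) + y ^ 2 * dy psi p). ring. rewrite Ht. ring. }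
  rewrite Ex, Ey.
  ring.
Qed.
End Energy.

(** Differentiate psi along the rotation of p. *)
Lemma tangential_derivative_zero (psi : R2 -> R) (p : R2) : smooth psi ->
  (forall q, boundary_disk q -> psi q = 0) -> boundary_disk p ->
  fst p * dy psi p = snd p * dx psi p.
Proof.
  intros Hpsi H0 Hp. destruct p as [x y]. unfold boundary_disk in Hp. cbn [fst snd] in *.
  assert (H := is_derive_comp_R2 psi (fun t => x * cos t - y * sin t) (fun t => x * sin t + y * cos t)
    0 (- y) x Hpsi).
  cbv beta in H. rewrite cos_0, sin_0 in H.
  replace (x * 1 - y * 0) with x in H by ring. replace (x * 0 + y * 1) with y in H by ring.
  assert (D := H ltac:(auto_derive; [trivial|rewrite cos_0, sin_0; ring])
                 ltac:(auto_derive; [trivial|rewrite cos_0, sin_0; ring])).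
  assert (E : - y * dx psi (x, y) + x * dy psi (x, y) = 0).
  { rewrite <- (is_derive_unique _ _ _ D). apply is_derive_unique.
    apply (is_derive_ext (fun _ => 0)).
    - intros t. symmetry. apply H0. unfold boundary_disk. cbn [fst snd].
      rewrite <- Hp. assert (Hsc := sin2_cos2 t). unfold Rsqr in Hsc.
      transitivity ((x ^ 2 + y ^ 2) * (sin t * sin t + cos t * cos t)). ring. rewrite Hsc. ring.
    - apply (is_derive_const 0). }
  lra.
Qed.

(** The integrals see only interior points, where identities between functions
    given on the disk may be differentiated. *)
Lemma disk_polar (th u : R) : - 1 < u < 1 -> 0 < th < PI -> interior_disk (cos th, u * sin th).
Proof.
  intros Hu Ht. unfold interior_disk. cbn [fst snd].
  assert (Hs := sin_gt_0 th (proj1 Ht) (proj2 Ht)).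
  assert (Hsc := sin2_cos2 th). unfold Rsqr in Hsc.
  assert (u * u < 1) by nra. assert (0 < sin th * sin th) by nra. nra.
Qed.

Lemma int_disk_ext (F G : R2 -> R) : (forall p, continuous F p) -> (forall p, continuous G p) ->
  (forall p, interior_disk p -> F p = G p) -> int_disk F = int_disk G.
Proof.
  intros HF HG H. rewrite !int_disk_polar by assumption.
  apply RInt_ext. rewrite Rmin_left, Rmax_right by (left; apply PI_RGT_0). intros th Hth.
  apply RInt_ext. rewrite Rmin_left, Rmax_right by lra. intros u Hu.
  rewrite H; [reflexivity|]. now apply disk_polar.
Qed.

Lemma int_disk_plus (F G : R2 -> R) : smooth F -> smooth G ->
  int_disk (fun p => F p + G p) = int_disk F + int_disk G.
Proof.
  intros HF HG.
  assert (C : forall H : R2 -> R, smooth H -> forall p, continuous H p).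
  { intros H HH p. exact (smooth_continuous_R (U := NR2) H p HH). }
  assert (HFG : smooth (fun p : NR2 => F p + G p)) by smooth_auto.
  rewrite (int_disk_polar F (C F HF)), (int_disk_polar G (C G HG)).
  etransitivity. apply int_disk_polar. apply (C _ HFG).
  assert (S1 : forall H : R2 -> R, smooth H ->
    smooth (fun th => RInt (fun u => H (cos th, u * sin th) * sin th ^ 2) (-1) 1)).
  { intros H HH. apply (smooth_RInt_section (U := R_NormedModule) (-1) 1 ltac:(lra)
      (fun q => H (cos (snd q), fst q * sin (snd q)) * sin (snd q) ^ 2)). smooth_auto. }
  etransitivity; [|apply (RInt_plus (V := R_CompleteNormedModule)); apply ex_RInt_smooth; auto].
  apply RInt_ext. intros th _.
  etransitivity; [|apply (RInt_plus (V := R_CompleteNormedModule)); apply ex_RInt_smooth; smooth_auto].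
  apply RInt_ext. intros u _. apply Rmult_plus_distr_r.
Qed.

(** Differentiate under the integral, insert [energy_variation] and
    [variation_density], and apply the divergence theorem to the flux. *)
Lemma first_variation (mu f g psi r : R2 -> R) (W : R -> R2 -> R2) :
  smooth mu -> smooth f -> smooth g -> smooth psi -> smooth r ->
  (forall p, boundary_disk p -> psi p = 0) ->
  smooth (fun q : R * R2 => W (fst q) (snd q)) ->
  (forall p, interior_disk p -> W 0 p = (f p, g p)) ->
  (forall p, interior_disk p -> is_derive (fun s => W s p) 0
    (field1 psi r p * dx f p + field2 psi r p * dy f p,
     field1 psi r p * dx g p + field2 psi r p * dy g p)) ->
  is_derive (fun t => Hhat mu (W t)) 0
    (int_disk (fun p => psi p * interior_density mu f g r p) +
     RInt (fun th => let p := (cos th, sin th) in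
       (cos th * dx psi p + sin th * dy psi p) * r p *
       (2 * hopf_re mu f g p * cos th * sin th + hopf_im mu f g p * (cos th ^ 2 - sin th ^ 2)))
       (- PI) PI).
Proof.
  intros Hmu Hf Hg Hpsi Hr H0 HW HW0 HW1.
  set (w1 := fun q : R * R2 => fst (W (fst q) (snd q))).
  set (w2 := fun q : R * R2 => snd (W (fst q) (snd q))).
  assert (S1 : smooth w1) by exact (smooth_fst_comp (U := NR3) (V := R_NormedModule) (W := R_NormedModule) _ HW).
  assert (S2 : smooth w2) by exact (smooth_snd_comp (U := NR3) (V := R_NormedModule) (W := R_NormedModule) _ HW).
  assert (SE : smooth (energy_t mu w1 w2)).
  { assert (Sm := smooth_comp_R2 (U := NR3) mu w1 w2 Hmu S1 S2).
    change (@smooth NR3 R_NormedModule (fun q : NR3 => mu (w1 q, w2 q) * mu (w1 q, w2 q) *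
      ((pd e1 w1 q * pd e1 w1 q + pd e1 w2 q * pd e1 w2 q) +
       (pd e2 w1 q * pd e2 w1 q + pd e2 w2 q * pd e2 w2 q)))).
    smooth_auto. }
  apply (is_derive_ext (fun t => int_disk (fun p => energy_t mu w1 w2 (t, p)))).
  { intros t. unfold Hhat. f_equal. apply functional_extensionality. intros p.
    unfold energy_t. rewrite !pd_e1_slice, !pd_e2_slice.
    unfold w1, w2. cbn [fst snd]. rewrite <- (surjective_pairing (W t p)).
    unfold m2tr, m2mul, m2T, Jac, dot2, dx2, dy2. cbn [fst snd]. ring. }
  evar_last. apply (is_derive_int_disk (energy_t mu w1 w2) SE).
  assert (F1 := smooth_flux1 mu f g Hmu Hf Hg psi r Hpsi Hr).
  assert (F2 := smooth_flux2 mu f g Hmu Hf Hg psi r Hpsi Hr).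
  assert (ID := smooth_interior_density mu f g Hmu Hf Hg r Hr).
  transitivity (int_disk (fun p => psi p * interior_density mu f g r p +
    (dx (flux1 mu f g psi r) p + dy (flux2 mu f g psi r) p))).
  - apply int_disk_ext.
    + intros p. apply (continuous_comp (fun p : R2 => (0, p)) (pd e0 (energy_t mu w1 w2))).
      apply continuous_pair. apply continuous_const. apply continuous_id.
      refine (smooth_continuous_R (U := NR3) (pd e0 _) _ _). smooth_auto.
    + intros p. refine (smooth_continuous_R (U := NR2) (fun p => psi p * interior_density mu f g r p +
        (dx (flux1 mu f g psi r) p + dy (flux2 mu f g psi r) p)) p _). smooth_auto.
    + intros p Hp.
      rewrite (energy_variation mu f g Hmu Hf Hg w1 w2 (field1 psi r) (field2 psi r) p S1 S2
        (smooth_field1 psi r Hpsi Hr) (smooth_field2 psi r Hpsi Hr)).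
      * rewrite (variation_density mu f g Hmu Hf Hg psi r Hpsi Hr). ring.
      * intros q Hq. unfold w1, w2. cbn [fst snd]. now rewrite (HW0 q Hq).
      * intros q Hq. specialize (HW1 q Hq). split; apply pd_e0_eq.
        -- exact (is_derive_linear_comp (fun z : R2 => fst z) _ 0 _ is_linear_fst HW1).
        -- exact (is_derive_linear_comp (fun z : R2 => snd z) _ 0 _ is_linear_snd HW1).
      * exact Hp.
  - rewrite int_disk_plus by smooth_auto. f_equal.
    rewrite divergence_disk by assumption.
    apply RInt_ext. intros th _. cbv zeta.
    assert (B : boundary_disk (cos th, sin th)).
    { unfold boundary_disk. cbn [fst snd]. assert (Hsc := sin2_cos2 th). unfold Rsqr in Hsc. simpl. lra. }
    exact (flux_boundary mu f g psi r (cos th, sin th) (H0 _ B) B (tangential_derivative_zero psi _ Hpsi H0 B)).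
Qed.

(** * Time changes of flows *)

Lemma pd_zero {U : NormedModule R_AbsRing} (F : U -> R) (q : U) : pd zero F q = 0.
Proof.
  apply pd_eq. apply (is_derive_ext (fun _ => F q)).
  - intros r. f_equal. unfold line. symmetry. transitivity (plus q (@zero U)).
    f_equal. exact (scal_zero_r r). apply plus_zero_r.
  - apply (is_derive_const (F q)).
Qed.

(** [Fx], [Fy] are the components of a family of maps F_s, starting at the
    identity, which is the flow of V: [Hinv] says that the derivative of F_s along
    V is its derivative in s.  As [m] is constant along V, changing the speed by
    the factor m / k gives the flow of (m / k) V. *)
Section TimeChange.
Context (Fx Fy : R * R2 -> R) (HFx : smooth Fx) (HFy : smooth Fy)
  (V1 V2 : R2 -> R) (k m : R2 -> R) (c : R) (Hc : 0 < c)
  (Hk : smooth k) (Hkc : forall p, c <= k p) (Hm : smooth m).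
Context (Hinit : forall p, disk p -> Fx (0, p) = fst p /\ Fy (0, p) = snd p)
  (Hinv : forall s p, disk p ->
     pd (0, (V1 p, V2 p)) Fx (s, p) = pd e0 Fx (s, p) /\
     pd (0, (V1 p, V2 p)) Fy (s, p) = pd e0 Fy (s, p))
  (Hmv : forall p, disk p -> V1 p * dx m p + V2 p * dy m p = 0).

(** Let E(s, p) be the integral of k(F_r p) over r in [0, s] and define sigma by
    E(sigma(t, p), p) = m(p) t.  Differentiating this equation in t and along V
    gives d_t sigma = (m / k) (V sigma + 1), because V E = k(F_s p) - k(p).  By
    the chain rule this is the transport equation for F_sigma. *)
Lemma time_changed_flow : exists sigma : R * R2 -> R, smooth sigma /\
  (forall p, disk p -> sigma (0, p) = 0) /\
  forall t p, disk p ->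
    pd e0 (fun q : NR3 => Fx (sigma q, snd q)) (t, p) =
      m p / k p * pd (0, (V1 p, V2 p)) (fun q : NR3 => Fx (sigma q, snd q)) (t, p) /\
    pd e0 (fun q : NR3 => Fy (sigma q, snd q)) (t, p) =
      m p / k p * pd (0, (V1 p, V2 p)) (fun q : NR3 => Fy (sigma q, snd q)) (t, p).
Proof.
  set (kt := fun q : NR3 => k (Fx q, Fy q)).
  assert (Skt : smooth kt) by exact (smooth_comp_R2 (U := NR3) k Fx Fy Hk HFx HFy).
  assert (Hktc : forall q, c <= kt q) by (intros; apply Hkc).
  destruct (smooth_primitive kt Skt) as [E [SE [E0 Ek]]].
  destruct (implicit_function E kt c Hc SE Ek Hktc) as [S [SS HS]].
  set (arg := fun q : NR3 => (m (snd q) * fst q, snd q) : NR3).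
  assert (Sm : @smooth NR3 R_NormedModule (fun q => m (snd q))).
  { refine (@smooth_comp2 NR3 m (fun q => snd q) Hm _).
    exact (smooth_linear _ (is_linear_snd (U := R_NormedModule) (V := NR2))). }
  assert (Sarg : smooth arg).
  { unfold arg.
    refine (@smooth_pair NR3 R_NormedModule NR2 (fun q => m (snd q) * fst q) (fun q => snd q) _ _).
    refine (@smooth_mult NR3 (fun q => m (snd q)) (fun q => fst q) Sm smooth_fst3).
    exact (smooth_linear _ (is_linear_snd (U := R_NormedModule) (V := NR2))). }
  set (sigma := fun q : NR3 => S (arg q)).
  assert (Ssig : smooth sigma) by exact (smooth_comp3 (U := NR3) S arg SS Sarg).
  assert (Hsig : forall q : NR3, E (sigma q, snd q) = m (snd q) * fst q).
  { intros q. exact (HS (arg q)). }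
  assert (chain : forall (F : R * R2 -> R) (h q : NR3), smooth F ->
    pd h (fun q : NR3 => F (sigma q, snd q)) q =
      pd h sigma q * pd e0 F (sigma q, snd q) + pd (0, snd h) F (sigma q, snd q)).
  { intros F h q HF.
    transitivity (pd h (fun q : NR3 => F (sigma q, (fst (snd q), snd (snd q)))) q).
    { f_equal. apply functional_extensionality. intros [t [x y]]. reflexivity. }
    etransitivity. apply (pd_comp_R3 (U := NR3) F sigma (fun q => fst (snd q)) (fun q => snd (snd q))).
    exact HF. exact Ssig. exact smooth_fst_snd3. exact smooth_snd_snd3.
    destruct q as [t [x y]], h as [h0 [h1 h2]]. cbn [fst snd].
    rewrite (pd_coordinates F (0, (h1, h2)) _ HF). cbn [fst snd].
    assert (X1 : pd (h0, (h1, h2)) (fun q : NR3 => fst (snd q)) (t, (x, y)) = h1).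
    { apply pd_eq. apply (is_derive_ext (fun s : R => x + s * h1)). reflexivity.
      auto_derive; trivial. ring. }
    assert (X2 : pd (h0, (h1, h2)) (fun q : NR3 => snd (snd q)) (t, (x, y)) = h2).
    { apply pd_eq. apply (is_derive_ext (fun s : R => y + s * h2)). reflexivity.
      auto_derive; trivial. ring. }
    etransitivity.
    { apply f_equal. apply (f_equal2 Rplus); apply (f_equal2 Rmult);
      [exact X1 | reflexivity | exact X2 | reflexivity]. }
    apply (f_equal (Rplus _)). symmetry.
    etransitivity. exact (f_equal2 Rplus (Rmult_0_l _) (eq_refl _)). apply Rplus_0_l. }
  exists sigma. split; [exact Ssig|]. split.
  - intros p Hp. apply (implicit_unique E kt c Hc SE Ek Hktc _ 0 p).
    rewrite E0. etransitivity. apply (Hsig (0, p)). apply Rmult_0_r.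
  - intros t p Hp.
    set (s := sigma (t, p)). set (V := (0, (V1 p, V2 p)) : NR3).
    assert (Hkt0 : kt (0, p) = k p).
    { unfold kt. destruct (Hinit p Hp) as [-> ->]. now rewrite <- surjective_pairing. }
    assert (kp : k p <> 0). { specialize (Hkc p). lra. }
    assert (ks : kt (s, p) <> 0). { specialize (Hktc (s, p)). lra. }
    assert (HVk : forall r, pd V kt (r, p) = pd e0 kt (r, p)).
    { intros r. unfold kt.
      transitivity (pd V Fx (r, p) * dx k (Fx (r, p), Fy (r, p)) + pd V Fy (r, p) * dy k (Fx (r, p), Fy (r, p))).
      exact (pd_comp_R2 (U := NR3) k Fx Fy V (r, p) Hk HFx HFy).
      destruct (Hinv r p Hp) as [I1 I2]. unfold V. rewrite I1, I2. symmetry.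
      exact (pd_comp_R2 (U := NR3) k Fx Fy e0 (r, p) Hk HFx HFy). }
    assert (EkF : pd e0 E = kt) by (apply functional_extensionality; exact Ek).
    (* V E - kt has zero time derivative by symmetry of second derivatives, and
       V E vanishes at time 0. *)
    assert (HVE : pd V E (s, p) = kt (s, p) - k p).
    { assert (D : forall r, is_derive (fun r => pd V E (r, p) - kt (r, p)) r 0).
      { intros r. evar_last. apply (is_derive_minus (fun r => pd V E (r, p)) (fun r => kt (r, p))).
        - apply (is_derive_e0 (pd V E)). exact (smooth_pd (U := NR3) E V SE).
        - apply (is_derive_e0 kt). exact Skt.
        - apply Rminus_diag_eq.
          exact (eq_trans (pd_comm (U := NR3) E e0 V (r, p) SE)
            (eq_trans (f_equal (fun F => pd V F (r, p)) EkF) (HVk r))). }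
      assert (C : pd V E (s, p) - kt (s, p) = pd V E (0, p) - kt (0, p)).
      { destruct (MVT_gen (fun r => pd V E (r, p) - kt (r, p)) 0 s (fun _ => 0)) as [xi [_ HM]].
        intros; apply D. intros r _. apply continuity_pt_filterlim.
        apply (ex_derive_continuous (fun r => pd V E (r, p) - kt (r, p))). eexists; apply D. lra. }
      assert (Z : pd V E (0, p) = 0).
      { apply pd_eq. apply (is_derive_ext (fun _ => 0)).
        - intros r. symmetry. etransitivity; [|exact (E0 (line p (V1 p, V2 p) r))].
          f_equal. apply injective_projections; [|reflexivity]. change (0 + r * 0 = 0). ring.
        - apply (is_derive_const 0). }
      rewrite Z, Hkt0 in C. lra. }
    assert (G : forall h : NR3, pd h sigma (t, p) * kt (s, p) + pd (0, snd h) E (s, p) =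
      pd h (fun q : NR3 => m (snd q)) (t, p) * t + m p * fst h).
    { intros h. transitivity (pd h (fun q : NR3 => E (sigma q, snd q)) (t, p)).
      { symmetry. etransitivity. exact (chain E h (t, p) SE).
        apply (f_equal2 Rplus); [apply (f_equal (Rmult _)); apply Ek | reflexivity]. }
      replace (fun q : NR3 => E (sigma q, snd q)) with (fun q : NR3 => m (snd q) * fst q).
      2: { apply functional_extensionality. intros q. symmetry. apply Hsig. }
      etransitivity. exact (pd_mult (U := NR3) (fun q => m (snd q)) (fun q => fst q) h (t, p) Sm smooth_fst3).
      cbn [fst snd]. apply (f_equal (fun z => _ + m p * z)). destruct h as [h0 [h1 h2]].
      apply pd_eq. apply (is_derive_ext (fun s : R => t + s * h0)). reflexivity.
      auto_derive; trivial. cbn [fst]. ring. }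
    assert (Gm : forall h : NR3, pd h (fun q : NR3 => m (snd q)) (t, p) =
      fst (snd h) * dx m p + snd (snd h) * dy m p).
    { intros h. etransitivity.
      apply (pd_comp_linear (fun q : NR3 => snd q) m h (t, p)). apply is_linear_snd.
      cbn [snd]. apply (pd_R2 m (snd h) p Hm). }
    assert (T0 : pd e0 sigma (t, p) * kt (s, p) = m p).
    { assert (H : pd e0 sigma (t, p) * kt (s, p) + 0 = 0 * t + m p * 1).
      { etransitivity; [apply f_equal; symmetry; exact (pd_zero E (s, p))|].
        etransitivity; [exact (G e0)|].
        apply (f_equal2 Rplus); [|reflexivity]. apply (f_equal (fun z => z * t)).
        etransitivity; [exact (Gm e0)|]. cbn [fst snd e0]. ring. }
      lra. }
    assert (TV : pd V sigma (t, p) * kt (s, p) = k p - kt (s, p)).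
    { assert (H : pd V sigma (t, p) * kt (s, p) + (kt (s, p) - k p) = 0 * t + m p * 0).
      { etransitivity; [apply f_equal; symmetry; exact HVE|].
        etransitivity; [exact (G V)|].
        apply (f_equal2 Rplus); [|reflexivity]. apply (f_equal (fun z => z * t)).
        etransitivity; [exact (Gm V)|]. exact (Hmv p Hp). }
      lra. }
    assert (T : pd e0 sigma (t, p) = m p / k p * (pd V sigma (t, p) + 1)).
    { apply (Rmult_eq_reg_r (kt (s, p))); [|exact ks]. rewrite T0.
      transitivity (m p / k p * (pd V sigma (t, p) * kt (s, p) + kt (s, p))). rewrite TV. field. exact kp.
      ring. }
    destruct (Hinv s p Hp) as [I1 I2].
    assert (fin : forall F : R * R2 -> R, smooth F -> pd V F (s, p) = pd e0 F (s, p) ->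
      pd e0 (fun q : NR3 => F (sigma q, snd q)) (t, p) =
        m p / k p * pd V (fun q : NR3 => F (sigma q, snd q)) (t, p)).
    { intros F HF HV.
      transitivity (pd e0 sigma (t, p) * pd e0 F (s, p) + 0).
      { etransitivity; [exact (chain F e0 (t, p) HF)|]. apply f_equal. exact (pd_zero F (s, p)). }
      transitivity (m p / k p * (pd V sigma (t, p) * pd e0 F (s, p) + pd V F (s, p))).
      { rewrite HV, T. ring. }
      apply f_equal. symmetry. exact (chain F V (t, p) HF). }
    split; apply fin; assumption.
Qed.
End TimeChange.

(** * Functions that are positive on the disk *)

(** The disk is the continuous image of a square.  Around each point choose a radius
    at most f/2 on which [f] stays above f/2; the uniform radius that compactness
    provides is then a lower bound for [f]. *)
Lemma positive_on_disk (f : R2 -> R) : (forall p, continuous f p) ->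
  (forall p, disk p -> 0 < f p) -> exists c, 0 < c /\ forall p, disk p -> c <= f p.
Proof.
  intros Hf Hpos.
  set (T := fun q : R2 => (fst q, snd q * sqrt (1 - fst q ^ 2))).
  assert (CT : forall q, continuous T q).
  { intros q. apply continuous_pair. apply continuous_fst.
    apply (continuous_mult (fun q : R2 => snd q) (fun q : R2 => sqrt (1 - fst q ^ 2))).
    apply continuous_snd. apply (continuous_comp (fun q : R2 => 1 - fst q ^ 2) sqrt).
    apply (continuous_comp (fun q : R2 => fst q) (fun x => 1 - x ^ 2)). apply continuous_fst.
    apply (ex_derive_continuous (fun x => 1 - x ^ 2)). auto_derive. trivial. apply continuous_sqrt. }
  assert (TD : forall x y, -1 <= x <= 1 -> -1 <= y <= 1 -> disk (T (x, y))).
  { intros x y Hx Hy. unfold disk, T. cbn [fst snd]. rewrite Rpow_mult_distr, pow2_sqrt by nra. assert (0 <= (1 - y ^ 2) * (1 - x ^ 2)) by (apply Rmult_le_pos; nra). lra. }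
  assert (DT : forall p, disk p -> exists x y, -1 <= x <= 1 /\ -1 <= y <= 1 /\ p = T (x, y)).
  { intros [x y] Hp. unfold disk in Hp. cbn [fst snd] in Hp.
    assert (Hs0 := sqrt_pos (1 - x ^ 2)). assert (Hs := pow2_sqrt (1 - x ^ 2) ltac:(nra)).
    set (s := sqrt (1 - x ^ 2)) in *.
    destruct (Req_dec s 0) as [Z|Z].
    - exists x, 0. split. nra. split. lra. unfold T. cbn [fst snd].
      f_equal. rewrite Z in Hs. nra.
    - assert (Hs' : 0 < s) by lra. exists x, (y / s). split. nra. split.
      + assert (E : y = (y / s) * s) by (field; lra).
        assert ((y / s) ^ 2 * s ^ 2 <= s ^ 2) by (rewrite <- Rpow_mult_distr, <- E; lra).
        assert (0 < s ^ 2) by nra. assert ((y / s) ^ 2 <= 1) by nra. nra.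
      + unfold T. cbn [fst snd]. f_equal. change (y = y / s * s). field. lra. }
  destruct (functional_choice (fun (q : R2) (d : posreal) => (-1 <= fst q <= 1 /\ -1 <= snd q <= 1) ->
     d <= f (T q) / 2 /\ forall z, ball q d z -> Rabs (f (T z) - f (T q)) < f (T q) / 2)) as [delta Hdelta].
  { intros q. destruct (Rlt_dec 0 (f (T q))) as [H|H].
    - assert (H2 : 0 < f (T q) / 2) by lra.
      assert (C : continuous (fun z => f (T z)) q) by (apply continuous_comp; auto).
      destruct (C _ (locally_ball (f (T q)) (mkposreal _ H2))) as [d Hd].
      assert (Hm : 0 < Rmin d (f (T q) / 2)) by (apply Rmin_glb_lt; [apply d|exact H2]).
      exists (mkposreal _ Hm). intros _. split. apply Rmin_r.
      intros z Hz. apply (Hd z). eapply ball_le; [|exact Hz]. apply Rmin_l.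
    - exists (mkposreal _ Rlt_0_1). intros [H1 H2]. exfalso. apply H. apply Hpos.
      destruct q. now apply TD. }
  destruct (compactness_value_2d (-1) 1 (-1) 1 (fun x y => delta (x, y))) as [d Hd].
  exists d. split. apply d. intros p Hp. destruct (DT p Hp) as [x [y [Hx [Hy ->]]]].
  apply Rnot_lt_le. intros Hn. apply (Hd x y Hx Hy). intros [u [v [Hu [Hv [Hxu [Hyv Hduv]]]]]].
  destruct (Hdelta (u, v) (conj Hu Hv)) as [H1 H2].
  assert (H3 := H2 (x, y) (conj Hxu Hyv)). apply Rabs_def2 in H3. lra.
Qed.

Lemma positive_smooth_extension (eta : R2 -> R) : smooth eta ->
  (forall p, disk p -> 0 < eta p) ->
  exists (n : R2 -> R) (c : R), smooth n /\ 0 < c /\ (forall p, c <= n p) /\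
    forall p, disk p -> locally p (fun q => n q = eta q).
Proof.
  intros He Hp.
  assert (Ce : forall p, continuous eta p).
  { intros p. exact (smooth_continuous_R (U := NR2) eta p He). }
  destruct (positive_on_disk eta Ce Hp) as [c [Hc Hce]].
  destruct (positive_extension (c / 2) ltac:(lra)) as [F [SF [HF1 HF2]]].
  exists (fun p => F (eta p)), (c / 2 / 2). split; [|split; [|split]].
  - exact (smooth_comp_R (U := NR2) F eta SF He).
  - lra.
  - intros p. apply HF1.
  - intros p Hd. specialize (Hce p Hd). assert (H2 : 0 < c / 2) by lra.
    eapply filter_imp; [|exact (Ce p _ (locally_ball (eta p) (mkposreal _ H2)))].
    intros q Hq. apply HF2. change (Rabs (eta q - eta p) < c / 2) in Hq. apply Rabs_def2 in Hq. lra.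
Qed.

(** * Rotations of the disk about an arbitrary centre *)

Section Quotient.
Context {U : NormedModule R_AbsRing}.
Context (n1 n2 d1 d2 : U -> R) (q : U) (Hn1 : smooth n1) (Hn2 : smooth n2)
  (Hd1 : smooth d1) (Hd2 : smooth d2) (Hq : d1 q * d1 q + d2 q * d2 q <> 0).

Let T1 (h : U) := (pd h n1 q * d1 q - pd h n2 q * d2 q) - (n1 q * pd h d1 q - n2 q * pd h d2 q).
Let T2 (h : U) := (pd h n1 q * d2 q + pd h n2 q * d1 q) - (n1 q * pd h d2 q + n2 q * pd h d1 q).

(** Real part of (n/d)' = (n' d - n d') / d^2 for n = n1 + i n2, d = d1 + i d2;
    [T1] + i [T2] is the numerator. *)
Lemma pd_quotient_re (h : U) :
  pd h (fun x => (n1 x * d1 x + n2 x * d2 x) / (d1 x * d1 x + d2 x * d2 x)) q =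
  (T1 h * (d1 q * d1 q - d2 q * d2 q) + 2 * T2 h * d1 q * d2 q) / (d1 q * d1 q + d2 q * d2 q) ^ 2.
Proof.
  apply pd_eq. evar_last.
  apply (is_derive_div (fun s => n1 (line q h s) * d1 (line q h s) + n2 (line q h s) * d2 (line q h s))
    (fun s => d1 (line q h s) * d1 (line q h s) + d2 (line q h s) * d2 (line q h s)) 0
    (pd h (fun x => n1 x * d1 x + n2 x * d2 x) q) (pd h (fun x => d1 x * d1 x + d2 x * d2 x) q)).
  - apply (smooth_is_derive (fun x => n1 x * d1 x + n2 x * d2 x)). smooth_auto.
  - apply (smooth_is_derive (fun x => d1 x * d1 x + d2 x * d2 x)). smooth_auto.
  - rewrite line_0. exact Hq.
  - rewrite line_0.
    rewrite (pd_plus (fun x => n1 x * d1 x) (fun x => n2 x * d2 x)) by smooth_auto.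
    rewrite (pd_plus (fun x => d1 x * d1 x) (fun x => d2 x * d2 x)) by smooth_auto.
    rewrite !pd_mult by assumption. unfold T1, T2.
    match goal with |- ?l = ?r => change (@eq R l r) end. field. exact Hq.
Qed.

Lemma pd_quotient_im (h : U) :
  pd h (fun x => (n2 x * d1 x - n1 x * d2 x) / (d1 x * d1 x + d2 x * d2 x)) q =
  (T2 h * (d1 q * d1 q - d2 q * d2 q) - 2 * T1 h * d1 q * d2 q) / (d1 q * d1 q + d2 q * d2 q) ^ 2.
Proof.
  apply pd_eq. evar_last.
  apply (is_derive_div (fun s => n2 (line q h s) * d1 (line q h s) - n1 (line q h s) * d2 (line q h s))
    (fun s => d1 (line q h s) * d1 (line q h s) + d2 (line q h s) * d2 (line q h s)) 0
    (pd h (fun x => n2 x * d1 x - n1 x * d2 x) q) (pd h (fun x => d1 x * d1 x + d2 x * d2 x) q)).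
  - apply (smooth_is_derive (fun x => n2 x * d1 x - n1 x * d2 x)). smooth_auto.
  - apply (smooth_is_derive (fun x => d1 x * d1 x + d2 x * d2 x)). smooth_auto.
  - rewrite line_0. exact Hq.
  - rewrite line_0.
    rewrite (pd_minus (fun x => n2 x * d1 x) (fun x => n1 x * d2 x)) by smooth_auto.
    rewrite (pd_plus (fun x => d1 x * d1 x) (fun x => d2 x * d2 x)) by smooth_auto.
    rewrite !pd_mult by assumption. unfold T1, T2.
    match goal with |- ?l = ?r => change (@eq R l r) end. field. exact Hq.
Qed.
End Quotient.

Lemma vfield_re (eta psi : R2 -> R) (p : R2) :
  Re (vfield eta psi p) = - (/ (2 * eta p) * dy psi p).
Proof.
  unfold vfield, dbar. cbn.
  change (dx (fun q => 0) p) with (Derive (fun _ : R => 0) (fst p)).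
  change (dy (fun q => 0) p) with (Derive (fun _ : R => 0) (snd p)). rewrite !Derive_const.
  change (dx (fun q => psi q) p) with (dx psi p). change (dy (fun q => psi q) p) with (dy psi p).
  rewrite Rinv_mult. ring.
Qed.

Lemma vfield_im (eta psi : R2 -> R) (p : R2) :
  Im (vfield eta psi p) = / (2 * eta p) * dx psi p.
Proof.
  unfold vfield, dbar. cbn.
  change (dx (fun q => 0) p) with (Derive (fun _ : R => 0) (fst p)).
  change (dy (fun q => 0) p) with (Derive (fun _ : R => 0) (snd p)). rewrite !Derive_const.
  change (dx (fun q => psi q) p) with (dx psi p). change (dy (fun q => psi q) p) with (dy psi p).
  rewrite Rinv_mult. ring.
Qed.

Lemma pd_horizontal (F : R * R2 -> R) (v1 v2 : R) (q : NR3) : smooth F ->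
  pd ((0, (v1, v2)) : NR3) F q = v1 * pd e1 F q + v2 * pd e2 F q.
Proof.
  intros HF. etransitivity; [exact (pd_coordinates F (0, (v1, v2)) q HF)|]. cbn [fst snd].
  ring.
Qed.

Lemma is_derive_line3 (f : R -> R -> R -> R -> R) (t x y h0 h1 h2 l : R) :
  is_derive (fun r => f (cos (t + r * h0)) (sin (t + r * h0)) (x + r * h1) (y + r * h2)) 0 l ->
  pd ((h0, (h1, h2)) : NR3)
    (fun q : NR3 => f (cos (fst q)) (sin (fst q)) (fst (snd q)) (snd (snd q))) (t, (x, y)) = l.
Proof. intros H. apply pd_eq. exact H. Qed.

(** A function of cos t, sin t, x, y, seen as a function of time and position. *)
Definition with_angle (f : R -> R -> R -> R -> R) : NR3 -> R :=
  fun q => f (cos (fst q)) (sin (fst q)) (fst (snd q)) (snd (snd q)).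

Lemma pow_four_lt (g : R) : 0 < g <= 1 -> g ^ 4 / 32 < g ^ 2 / 4.
Proof. intros H. assert (0 < g ^ 2) by nra. assert (g ^ 2 <= 1) by nra. nra. Qed.

Section Mobius.
Context (a b : R) (Hab : a ^ 2 + b ^ 2 < 1).

(** In complex notation, for the centre alpha = a + i b, a point z = x + i y and a
    unit number E = c + i s: [mob_w1] + i [mob_w2] is w = 1 - conj(alpha) z,
    [mob_z1] + i [mob_z2] is E (z - alpha), and [mob_n1] + i [mob_n2],
    [mob_d1] + i [mob_d2] are numerator and denominator of the Moebius map fixing
    alpha that is conjugate to the rotation by E; [mob_gap] is 1 - |alpha|^2. *)
Definition mob_w1 (x y : R) : R := 1 - a * x - b * y.
Definition mob_w2 (x y : R) : R := b * x - a * y.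
Definition mob_gap : R := 1 - a ^ 2 - b ^ 2.
Definition mob_z1 (c s x y : R) : R := c * (x - a) - s * (y - b).
Definition mob_z2 (c s x y : R) : R := s * (x - a) + c * (y - b).
Definition mob_n1 (c s x y : R) : R := mob_z1 c s x y + (a * mob_w1 x y - b * mob_w2 x y).
Definition mob_n2 (c s x y : R) : R := mob_z2 c s x y + (a * mob_w2 x y + b * mob_w1 x y).
Definition mob_d1 (c s x y : R) : R := mob_w1 x y + (a * mob_z1 c s x y + b * mob_z2 c s x y).
Definition mob_d2 (c s x y : R) : R := mob_w2 x y + (a * mob_z2 c s x y - b * mob_z1 c s x y).
Definition mob_den (c s x y : R) : R := mob_d1 c s x y * mob_d1 c s x y + mob_d2 c s x y * mob_d2 c s x y.

Lemma mob_gap_bounds : 0 < mob_gap <= 1.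
Proof. unfold mob_gap. nra. Qed.

Lemma mob_w_lower (x y : R) : x ^ 2 + y ^ 2 <= 1 ->
  mob_gap ^ 2 / 4 <= mob_w1 x y ^ 2 + mob_w2 x y ^ 2.
Proof.
  intros H. assert (G := mob_gap_bounds).
  assert (mob_gap / 2 <= mob_w1 x y).
  { unfold mob_gap, mob_w1 in *. assert (H1 := pow2_ge_0 (a - x)). assert (H2 := pow2_ge_0 (b - y)). lra. }
  assert (mob_gap ^ 2 / 4 <= mob_w1 x y ^ 2) by nra.
  assert (H2 := pow2_ge_0 (mob_w2 x y)). lra.
Qed.

Lemma mob_contract (c s x y : R) : c ^ 2 + s ^ 2 = 1 ->
  mob_w1 x y ^ 2 + mob_w2 x y ^ 2 - (mob_z1 c s x y ^ 2 + mob_z2 c s x y ^ 2)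
    = mob_gap * (1 - (x ^ 2 + y ^ 2)).
Proof.
  intros H. transitivity (mob_w1 x y ^ 2 + mob_w2 x y ^ 2 - (c ^ 2 + s ^ 2) * ((x - a) ^ 2 + (y - b) ^ 2)).
  unfold mob_z1, mob_z2; ring. rewrite H. unfold mob_w1, mob_w2, mob_gap. ring.
Qed.

(** With n and d the numerator and the denominator, n = E (z - alpha) + alpha w and
    d = w + conj(alpha) E (z - alpha), hence
      2 Re(d conj(w)) = 2 |w|^2 + |n|^2 - |z - alpha|^2 - |alpha|^2 |w|^2,
    which is at least (1 - |alpha|^2) |w|^2 because |z - alpha| <= |w| on the disk.
    The Cauchy-Schwarz inequality turns this into a lower bound for |d|. *)
Lemma mob_den_lower (c s x y : R) : c ^ 2 + s ^ 2 = 1 -> x ^ 2 + y ^ 2 <= 1 ->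
  mob_gap ^ 4 / 16 <= mob_den c s x y.
Proof.
  intros Hcs Hxy. assert (G := mob_gap_bounds). assert (HW := mob_w_lower x y Hxy).
  assert (HC := mob_contract c s x y Hcs).
  set (W := mob_w1 x y ^ 2 + mob_w2 x y ^ 2) in *.
  set (Z := mob_z1 c s x y ^ 2 + mob_z2 c s x y ^ 2) in *.
  assert (HZ : Z <= W) by nra.
  assert (HG2 : 0 < mob_gap ^ 2) by nra.
  (* The real part of the denominator times the conjugate of w. *)
  set (K := mob_d1 c s x y * mob_w1 x y + mob_d2 c s x y * mob_w2 x y).
  assert (EK : 2 * K = 2 * W + (mob_n1 c s x y ^ 2 + mob_n2 c s x y ^ 2 - Z - (a ^ 2 + b ^ 2) * W)).
  { unfold K, W, Z, mob_d1, mob_d2, mob_n1, mob_n2. ring. }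
  assert (HK : W * mob_gap / 2 <= K).
  { assert (H1 := pow2_ge_0 (mob_n1 c s x y)). assert (H2 := pow2_ge_0 (mob_n2 c s x y)).
    unfold mob_gap in *. lra. }
  assert (CS : K ^ 2 + (mob_d1 c s x y * mob_w2 x y - mob_d2 c s x y * mob_w1 x y) ^ 2 = mob_den c s x y * W).
  { unfold K, W, mob_den. ring. }
  assert (H3 := pow2_ge_0 (mob_d1 c s x y * mob_w2 x y - mob_d2 c s x y * mob_w1 x y)).
  assert (H4 : (W * mob_gap / 2) ^ 2 <= mob_den c s x y * W).
  { assert (0 <= W * mob_gap / 2) by nra. assert ((W * mob_gap / 2) ^ 2 <= K ^ 2) by (apply pow_incr; lra). lra. }
  assert (HW0 : 0 < W) by lra.
  assert (H5 : W * mob_gap ^ 2 / 4 <= mob_den c s x y).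
  { apply Rmult_le_reg_r with W. exact HW0. replace (W * mob_gap ^ 2 / 4 * W) with ((W * mob_gap / 2) ^ 2) by field. exact H4. }
  apply Rle_trans with (mob_gap ^ 2 / 4 * (mob_gap ^ 2 / 4)). right; field. nra.
Qed.

(** |d|^2 - |n|^2 = (1 - |alpha|^2)^2 (1 - |z|^2). *)
Lemma mob_in_disk (c s x y : R) : c ^ 2 + s ^ 2 = 1 -> x ^ 2 + y ^ 2 <= 1 ->
  let n1 := mob_n1 c s x y in let n2 := mob_n2 c s x y in
  let d1 := mob_d1 c s x y in let d2 := mob_d2 c s x y in
  ((n1 * d1 + n2 * d2) / mob_den c s x y) ^ 2 + ((n2 * d1 - n1 * d2) / mob_den c s x y) ^ 2 <= 1.
Proof.
  intros Hcs Hxy n1 n2 d1 d2. assert (G := mob_gap_bounds).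
  assert (HD := mob_den_lower c s x y Hcs Hxy). assert (HC := mob_contract c s x y Hcs).
  assert (HD0 : 0 < mob_den c s x y). { assert (0 < mob_gap ^ 4) by (apply pow_lt; lra). lra. }
  assert (HN : n1 ^ 2 + n2 ^ 2 <= mob_den c s x y).
  { assert (E : mob_den c s x y - (n1 ^ 2 + n2 ^ 2) = mob_gap * (mob_w1 x y ^ 2 + mob_w2 x y ^ 2
      - (mob_z1 c s x y ^ 2 + mob_z2 c s x y ^ 2))).
    { unfold mob_den, n1, n2, mob_d1, mob_d2, mob_n1, mob_n2, mob_gap. ring. }
    rewrite HC in E. assert (0 <= mob_gap * (mob_gap * (1 - (x ^ 2 + y ^ 2)))).
    { apply Rmult_le_pos. lra. apply Rmult_le_pos; lra. } lra. }
  transitivity ((n1 ^ 2 + n2 ^ 2) / mob_den c s x y).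
  - right. unfold mob_den in *. fold d1 d2 in HD0 |- *. field. lra.
  - apply Rmult_le_reg_r with (mob_den c s x y). exact HD0.
    unfold Rdiv. rewrite Rmult_assoc, Rinv_l by lra. lra.
Qed.

End Mobius.

Section Mobius.
Context (a b : R) (Hab : a ^ 2 + b ^ 2 < 1).
Notation gap := (mob_gap a b).

(** [mob_v1] + i [mob_v2] is i (z - alpha)(1 - conj(alpha) z), which is
    1 - |alpha|^2 times the velocity of the rotations about alpha. *)
Definition mob_v1 (x y : R) : R := - ((x - a) * mob_w2 a b x y + (y - b) * mob_w1 a b x y).
Definition mob_v2 (x y : R) : R := (x - a) * mob_w1 a b x y - (y - b) * mob_w2 a b x y.

Lemma smooth_mob_fractions : smooth (with_angle (mob_n1 a b)) /\ smooth (with_angle (mob_n2 a b)) /\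
  smooth (with_angle (mob_d1 a b)) /\ smooth (with_angle (mob_d2 a b)).
Proof.
  assert (S0 := smooth_fst3). assert (S1 := smooth_fst_snd3). assert (S2 := smooth_snd_snd3).
  unfold with_angle, mob_n1, mob_n2, mob_d1, mob_d2, mob_z1, mob_z2, mob_w1, mob_w2.
  repeat split; smooth_auto.
Qed.

Ltac mob_derive :=
  unfold mob_n1, mob_n2, mob_d1, mob_d2, mob_z1, mob_z2, mob_w1, mob_w2;
  auto_derive; [trivial | rewrite ?Rmult_0_l, ?Rmult_0_r, ?Rplus_0_r; ring].

(** This is the flow property of the rotations about alpha, up to the factor in
    [mob_v1].  By the quotient rule it suffices to compare the numerators
    n' d - n d' of the two derivatives, and these are polynomials. *)
Lemma mob_flow_relation (t x y : R) (HD : mob_den a b (cos t) (sin t) x y <> 0) :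
  let q := (t, (x, y)) : NR3 in
  let V := (0, (mob_v1 x y, mob_v2 x y)) : NR3 in
  let n1 := with_angle (mob_n1 a b) in let n2 := with_angle (mob_n2 a b) in
  let d1 := with_angle (mob_d1 a b) in let d2 := with_angle (mob_d2 a b) in
  pd V (fun z => (n1 z * d1 z + n2 z * d2 z) / (d1 z * d1 z + d2 z * d2 z)) q =
    gap * pd e0 (fun z : NR3 => (n1 z * d1 z + n2 z * d2 z) / (d1 z * d1 z + d2 z * d2 z)) q /\
  pd V (fun z => (n2 z * d1 z - n1 z * d2 z) / (d1 z * d1 z + d2 z * d2 z)) q =
    gap * pd e0 (fun z : NR3 => (n2 z * d1 z - n1 z * d2 z) / (d1 z * d1 z + d2 z * d2 z)) q.
Proof.
  intros q V n1 n2 d1 d2. destruct smooth_mob_fractions as [S1 [S2 [S3 S4]]].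
  assert (HD' : d1 q * d1 q + d2 q * d2 q <> 0) by exact HD.
  assert (E0 : (pd e0 n1 q = - sin t * (x - a) - cos t * (y - b)) /\
               (pd e0 n2 q = cos t * (x - a) - sin t * (y - b)) /\
               (pd e0 d1 q = a * (- sin t * (x - a) - cos t * (y - b)) + b * (cos t * (x - a) - sin t * (y - b))) /\
               (pd e0 d2 q = a * (cos t * (x - a) - sin t * (y - b)) - b * (- sin t * (x - a) - cos t * (y - b)))).
  { repeat split; apply (is_derive_line3 _ t x y 1 0 0); mob_derive. }
  set (X := mob_v1 x y). set (Y := mob_v2 x y).
  assert (EV : (pd V n1 q = (cos t * X - sin t * Y) - (a * (a * X + b * Y) + b * (b * X - a * Y))) /\
               (pd V n2 q = (sin t * X + cos t * Y) + (a * (b * X - a * Y) - b * (a * X + b * Y))) /\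
               (pd V d1 q = - (a * X + b * Y) + (a * (cos t * X - sin t * Y) + b * (sin t * X + cos t * Y))) /\
               (pd V d2 q = (b * X - a * Y) + (a * (sin t * X + cos t * Y) - b * (cos t * X - sin t * Y)))).
  { repeat split; apply (is_derive_line3 _ t x y 0 X Y); mob_derive. }
  destruct E0 as [e1 [e2 [e3 e4]]], EV as [v1 [v2 [v3 v4]]].
  assert (V1 : n1 q = mob_n1 a b (cos t) (sin t) x y) by reflexivity.
  assert (V2 : n2 q = mob_n2 a b (cos t) (sin t) x y) by reflexivity.
  assert (V3 : d1 q = mob_d1 a b (cos t) (sin t) x y) by reflexivity.
  assert (V4 : d2 q = mob_d2 a b (cos t) (sin t) x y) by reflexivity.
  assert (T1 : (pd V n1 q * d1 q - pd V n2 q * d2 q) - (n1 q * pd V d1 q - n2 q * pd V d2 q) =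
    gap * ((pd e0 n1 q * d1 q - pd e0 n2 q * d2 q) - (n1 q * pd e0 d1 q - n2 q * pd e0 d2 q))).
  { rewrite e1, e2, e3, e4, v1, v2, v3, v4, V1, V2, V3, V4. unfold X, Y, mob_v1, mob_v2, mob_n1, mob_n2, mob_d1, mob_d2, mob_z1, mob_z2, mob_w1, mob_w2, mob_gap. ring. }
  assert (T2 : (pd V n1 q * d2 q + pd V n2 q * d1 q) - (n1 q * pd V d2 q + n2 q * pd V d1 q) =
    gap * ((pd e0 n1 q * d2 q + pd e0 n2 q * d1 q) - (n1 q * pd e0 d2 q + n2 q * pd e0 d1 q))).
  { rewrite e1, e2, e3, e4, v1, v2, v3, v4, V1, V2, V3, V4. unfold X, Y, mob_v1, mob_v2, mob_n1, mob_n2, mob_d1, mob_d2, mob_z1, mob_z2, mob_w1, mob_w2, mob_gap. ring. }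
  split.
  - rewrite !(pd_quotient_re (U := NR3) n1 n2 d1 d2 q S1 S2 S3 S4 HD'). rewrite T1, T2. field. exact HD'.
  - rewrite !(pd_quotient_im (U := NR3) n1 n2 d1 d2 q S1 S2 S3 S4 HD'). rewrite T1, T2. field. exact HD'.
Qed.

(** |z - alpha|^2 / |1 - conj(alpha) z|^2, with [F] extending the denominator
    positively beyond the disk. *)
Definition mob_level (F : R -> R) (p : R2) : R :=
  ((fst p - a) ^ 2 + (snd p - b) ^ 2) * / F (mob_w1 a b (fst p) (snd p) ^ 2 + mob_w2 a b (fst p) (snd p) ^ 2).

Lemma mob_level_partials (F : R -> R) (eps x y : R) :
  (forall r, eps <= r -> F r = r) -> 0 < eps ->
  let w1 := mob_w1 a b x y in let w2 := mob_w2 a b x y in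
  eps < w1 ^ 2 + w2 ^ 2 ->
  mob_level F (x, y) = ((x - a) ^ 2 + (y - b) ^ 2) / (w1 ^ 2 + w2 ^ 2) /\
  dx (mob_level F) (x, y) = 2 * gap * mob_v2 x y / (w1 ^ 2 + w2 ^ 2) ^ 2 /\
  dy (mob_level F) (x, y) = - (2 * gap * mob_v1 x y) / (w1 ^ 2 + w2 ^ 2) ^ 2.
Proof.
  intros HF He w1 w2 Hw.
  set (lev := fun q : R2 => ((fst q - a) ^ 2 + (snd q - b) ^ 2) /
    (mob_w1 a b (fst q) (snd q) ^ 2 + mob_w2 a b (fst q) (snd q) ^ 2)).
  assert (Hloc : locally ((x, y) : R2) (fun q => mob_level F q = lev q)).
  { assert (C : continuous (fun q : R2 => mob_w1 a b (fst q) (snd q) ^ 2 + mob_w2 a b (fst q) (snd q) ^ 2) (x, y)).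
    { refine (smooth_continuous_R (U := NR2) (fun q => mob_w1 a b (fst q) (snd q) ^ 2 + mob_w2 a b (fst q) (snd q) ^ 2) (x, y) _).
      unfold mob_w1, mob_w2. smooth_auto. }
    assert (H : 0 < w1 ^ 2 + w2 ^ 2 - eps) by lra.
    eapply filter_imp; [|exact (C _ (locally_ball (w1 ^ 2 + w2 ^ 2) (mkposreal _ H)))].
    intros [x' y'] Hq. unfold mob_level, lev. cbn [fst snd].
    change (Rabs ((mob_w1 a b x' y' ^ 2 + mob_w2 a b x' y' ^ 2) - (w1 ^ 2 + w2 ^ 2))
      < w1 ^ 2 + w2 ^ 2 - eps) in Hq. apply Rabs_def2 in Hq.
    set (W := mob_w1 a b x' y' ^ 2 + mob_w2 a b x' y' ^ 2) in *.
    rewrite HF by lra. reflexivity. }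
  assert (Hw0 : w1 ^ 2 + w2 ^ 2 <> 0) by lra. unfold w1, w2, mob_w1, mob_w2 in Hw0.
  split; [|split].
  - exact (locally_singleton _ _ Hloc).
  - rewrite (dx_ext_loc _ lev _ Hloc). apply is_derive_unique.
    unfold lev, w1, w2, mob_v2, mob_w1, mob_w2, mob_gap. cbn [fst snd].
    auto_derive. contradict Hw0. rewrite <- Hw0. ring. field. contradict Hw0. rewrite <- Hw0. ring.
  - rewrite (dy_ext_loc _ lev _ Hloc). apply is_derive_unique.
    unfold lev, w1, w2, mob_v1, mob_w1, mob_w2, mob_gap. cbn [fst snd].
    auto_derive. contradict Hw0. rewrite <- Hw0. ring. field. contradict Hw0. rewrite <- Hw0. ring.
Qed.

(** With w = 1 - conj(alpha) z and V the velocity of the rotations about alpha,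
    (-u_y, u_x) = 2 (1 - |alpha|^2)^2 |w|^-4 V.  Hence the field of psi = h(u) is
    (m / k) V with m = h'(u) and k = eta |w|^4 / (1 - |alpha|^2)^2, and m is constant
    along V: the time change of the rotations followed by [Phi] solves the
    transport equation. *)
Lemma mobius_transport (eta n : R2 -> R) (c : R) :
  smooth n -> 0 < c -> (forall p, c <= n p) -> (forall p, disk p -> n p = eta p) ->
  exists u : R2 -> R, smooth u /\
  (forall x y, disk (x, y) ->
     let W := mob_w1 a b x y ^ 2 + mob_w2 a b x y ^ 2 in
     u (x, y) = ((x - a) ^ 2 + (y - b) ^ 2) / W /\
     dx u (x, y) = 2 * gap * mob_v2 x y / W ^ 2 /\
     dy u (x, y) = - (2 * gap * mob_v1 x y) / W ^ 2) /\
  forall (Phi : R2 -> R2) (h : R -> R), smooth Phi -> (forall p, disk p -> disk (Phi p)) -> smooth h ->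
  exists W, transport_solution eta (fun p => h (u p)) Phi 1 W.
Proof.
  intros Sn Hc Hnc Hn. assert (G := mob_gap_bounds a b Hab).
  (* Half of the bound of [mob_den_lower], to leave room for a neighbourhood. *)
  set (eps := gap ^ 4 / 32). assert (He : 0 < eps) by (unfold eps; assert (0 < gap ^ 4) by (apply pow_lt; lra); lra).
  destruct (positive_extension eps He) as [F [SF [HF1 HF2]]].
  assert (Hw_eps : forall x y, disk (x, y) -> eps < mob_w1 a b x y ^ 2 + mob_w2 a b x y ^ 2).
  { intros x y Hd. assert (H := mob_w_lower a b Hab x y Hd).
    assert (H2 := pow_four_lt gap G). unfold eps. lra. }
  assert (Hcs : forall t, cos t ^ 2 + sin t ^ 2 = 1).
  { intros t. assert (H := sin2_cos2 t). unfold Rsqr in H. simpl. lra. }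
  assert (Hd_eps : forall t x y, disk (x, y) -> eps < mob_den a b (cos t) (sin t) x y).
  { intros t x y Hd. assert (H := mob_den_lower a b Hab _ _ x y (Hcs t) Hd). unfold eps in *.
    assert (0 < gap ^ 4) by (apply pow_lt; lra). lra. }
  assert (HFn : forall r, F r <> 0). { intros r. specialize (HF1 r). lra. }
  set (Wf := fun p : R2 => mob_w1 a b (fst p) (snd p) ^ 2 + mob_w2 a b (fst p) (snd p) ^ 2).
  assert (SW : smooth Wf) by (unfold Wf, mob_w1, mob_w2; smooth_auto).
  assert (SFW : @smooth NR2 R_NormedModule (fun p => F (Wf p))) by exact (smooth_comp_R (U := NR2) F Wf SF SW).
  set (u := mob_level F).
  assert (Su : smooth u).
  { refine (@smooth_mult NR2 (fun p => (fst p - a) ^ 2 + (snd p - b) ^ 2) (fun p => / F (Wf p)) _ _).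
    smooth_auto. apply (smooth_inv (U := NR2) (fun p => F (Wf p))); auto. }
  exists u. split; [exact Su|].
  assert (Hu : forall x y, disk (x, y) ->
     let W := mob_w1 a b x y ^ 2 + mob_w2 a b x y ^ 2 in
     u (x, y) = ((x - a) ^ 2 + (y - b) ^ 2) / W /\
     dx u (x, y) = 2 * gap * mob_v2 x y / W ^ 2 /\
     dy u (x, y) = - (2 * gap * mob_v1 x y) / W ^ 2).
  { intros x y Hd. apply (mob_level_partials F eps x y HF2 He). now apply Hw_eps. }
  split; [exact Hu|].
  intros Phi h SPhi HPhi Sh.
  destruct smooth_mob_fractions as [S1 [S2 [S3 S4]]].
  set (n1 := with_angle (mob_n1 a b)) in *. set (n2 := with_angle (mob_n2 a b)) in *.
  set (d1 := with_angle (mob_d1 a b)) in *. set (d2 := with_angle (mob_d2 a b)) in *.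
  set (den := fun q : NR3 => d1 q * d1 q + d2 q * d2 q).
  assert (Sden : smooth den) by (unfold den; smooth_auto).
  assert (SFden : smooth (fun q : NR3 => / F (den q))).
  { apply (smooth_inv (U := NR3) (fun q => F (den q))). intros; apply HFn.
    exact (smooth_comp_R (U := NR3) F den SF Sden). }
  set (Fx := fun q : NR3 => (n1 q * d1 q + n2 q * d2 q) * / F (den q)).
  set (Fy := fun q : NR3 => (n2 q * d1 q - n1 q * d2 q) * / F (den q)).
  assert (SFx : smooth Fx).
  { refine (@smooth_mult NR3 (fun q => n1 q * d1 q + n2 q * d2 q) (fun q => / F (den q)) _ SFden). smooth_auto. }
  assert (SFy : smooth Fy).
  { refine (@smooth_mult NR3 (fun q => n2 q * d1 q - n1 q * d2 q) (fun q => / F (den q)) _ SFden). smooth_auto. }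
  assert (RE : forall q : NR3, F (den q) = den q ->
    Fx q = (n1 q * d1 q + n2 q * d2 q) / (d1 q * d1 q + d2 q * d2 q) /\
    Fy q = (n2 q * d1 q - n1 q * d2 q) / (d1 q * d1 q + d2 q * d2 q)).
  { intros q Hq. unfold Fx, Fy. rewrite Hq. split; reflexivity. }
  assert (Hden : forall t x y, disk (x, y) -> locally ((t, (x, y)) : NR3) (fun q => F (den q) = den q)).
  { intros t x y Hd. specialize (Hd_eps t x y Hd).
    assert (H : 0 < den (t, (x, y)) - eps) by (change (0 < mob_den a b (cos t) (sin t) x y - eps); lra).
    eapply filter_imp; [|exact (smooth_continuous_R (U := NR3) den (t, (x, y)) Sden _
       (locally_ball (den (t, (x, y))) (mkposreal _ H)))].
    intros q Hq. change (Rabs (den q - den (t, (x, y))) < den (t, (x, y)) - eps) in Hq.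
    apply Rabs_def2 in Hq. apply HF2. lra. }
  set (V1 := fun p : R2 => mob_v1 (fst p) (snd p) / gap).
  set (V2 := fun p : R2 => mob_v2 (fst p) (snd p) / gap).
  set (k := fun p : R2 => n p * (F (Wf p) * F (Wf p)) * / gap ^ 2).
  assert (Sk : smooth k).
  { unfold k. refine (@smooth_mult NR2 (fun p => n p * (F (Wf p) * F (Wf p))) (fun _ => / gap ^ 2) _ (smooth_const _)).
    refine (@smooth_mult NR2 n (fun p => F (Wf p) * F (Wf p)) Sn _).
    exact (@smooth_mult NR2 (fun p => F (Wf p)) (fun p => F (Wf p)) SFW SFW). }
  assert (Hig : 0 < / gap ^ 2) by (apply Rinv_0_lt_compat, pow_lt; lra).
  assert (Hkc : forall p, c * (eps / 2 * (eps / 2)) * / gap ^ 2 <= k p).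
  { intros p. unfold k. apply Rmult_le_compat_r. lra. specialize (HF1 (Wf p)). specialize (Hnc p).
    apply Rmult_le_compat; try lra. nra. nra. }
  assert (Hc' : 0 < c * (eps / 2 * (eps / 2)) * / gap ^ 2).
  { apply Rmult_lt_0_compat; [|exact Hig]. apply Rmult_lt_0_compat. exact Hc. nra. }
  set (m := fun p : R2 => Derive h (u p)).
  assert (Sm : smooth m) by exact (smooth_comp_R (U := NR2) (Derive h) u (smooth_Derive h Sh) Su).
  assert (Hinit : forall p, disk p -> Fx (0, p) = fst p /\ Fy (0, p) = snd p).
  { intros [x y] Hd.
    assert (E : F (den (0, (x, y))) = den (0, (x, y))) by exact (locally_singleton _ _ (Hden 0 x y Hd)).
    assert (X1 : n1 (0, (x, y)) = gap * x).
    { unfold n1, with_angle. cbn [fst snd]. rewrite cos_0, sin_0. unfold mob_n1, mob_z1, mob_w1, mob_w2, mob_gap. ring. }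
    assert (X2 : n2 (0, (x, y)) = gap * y).
    { unfold n2, with_angle. cbn [fst snd]. rewrite cos_0, sin_0. unfold mob_n2, mob_z2, mob_w1, mob_w2, mob_gap. ring. }
    assert (X3 : d1 (0, (x, y)) = gap).
    { unfold d1, with_angle. cbn [fst snd]. rewrite cos_0, sin_0. unfold mob_d1, mob_z1, mob_z2, mob_w1, mob_w2, mob_gap. ring. }
    assert (X4 : d2 (0, (x, y)) = 0).
    { unfold d2, with_angle. cbn [fst snd]. rewrite cos_0, sin_0. unfold mob_d2, mob_z1, mob_z2, mob_w1, mob_w2, mob_gap. ring. }
    split; cbn [fst snd].
    - etransitivity; [exact (proj1 (RE _ E))|]. rewrite X1, X2, X3, X4. field. lra.
    - etransitivity; [exact (proj2 (RE _ E))|]. rewrite X1, X2, X3, X4. field. lra. }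
  assert (Hinv : forall s p, disk p ->
     pd (0, (V1 p, V2 p)) Fx (s, p) = pd e0 Fx (s, p) /\
     pd (0, (V1 p, V2 p)) Fy (s, p) = pd e0 Fy (s, p)).
  { intros s [x y] Hd.
    assert (HD : mob_den a b (cos s) (sin s) x y <> 0) by (specialize (Hd_eps s x y Hd); lra).
    destruct (mob_flow_relation s x y HD) as [Q1 Q2].
    assert (L1 : forall e, pd e Fx (s, (x, y)) =
      pd e (fun z : NR3 => (n1 z * d1 z + n2 z * d2 z) / (d1 z * d1 z + d2 z * d2 z)) (s, (x, y))).
    { intros e. apply (pd_ext_loc (U := NR3)). generalize (Hden s x y Hd). apply filter_imp.
      intros q Hq. exact (proj1 (RE q Hq)). }
    assert (L2 : forall e, pd e Fy (s, (x, y)) =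
      pd e (fun z : NR3 => (n2 z * d1 z - n1 z * d2 z) / (d1 z * d1 z + d2 z * d2 z)) (s, (x, y))).
    { intros e. apply (pd_ext_loc (U := NR3)). generalize (Hden s x y Hd). apply filter_imp.
      intros q Hq. exact (proj2 (RE q Hq)). }
    assert (sc : forall Fn : R * R2 -> R, smooth Fn ->
      pd ((0, (mob_v1 x y, mob_v2 x y)) : NR3) Fn (s, (x, y)) = gap * pd e0 Fn (s, (x, y)) ->
      pd ((0, (V1 (x, y), V2 (x, y))) : NR3) Fn (s, (x, y)) = pd e0 Fn (s, (x, y))).
    { intros Fn SFn HH. etransitivity; [exact (pd_horizontal Fn _ _ _ SFn)|].
      apply (Rmult_eq_reg_l gap); [|lra].
      etransitivity; [|exact HH]. etransitivity; [|symmetry; exact (pd_horizontal Fn _ _ _ SFn)].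
      unfold V1, V2. cbn [fst snd]. field. lra. }
    split; apply sc; auto. rewrite !L1. exact Q1. rewrite !L2. exact Q2. }
  assert (Hmv : forall p, disk p -> V1 p * dx m p + V2 p * dy m p = 0).
  { intros [x y] Hd. destruct (Hu x y Hd) as [_ [U1 U2]].
    assert (Hw := Hw_eps x y Hd).
    assert (M1 : dx m (x, y) = dx u (x, y) * Derive (Derive h) (u (x, y))).
    { rewrite !dx_pd. exact (pd_comp_R (U := NR2) (Derive h) u (1, 0) (x, y) (smooth_Derive h Sh) Su). }
    assert (M2 : dy m (x, y) = dy u (x, y) * Derive (Derive h) (u (x, y))).
    { rewrite !dy_pd. exact (pd_comp_R (U := NR2) (Derive h) u (0, 1) (x, y) (smooth_Derive h Sh) Su). }
    rewrite M1, M2, U1, U2. unfold V1, V2. cbn [fst snd]. field. split; lra. }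
  destruct (time_changed_flow Fx Fy SFx SFy V1 V2 k m _ Hc' Sk Hkc Sm Hinit Hinv Hmv)
    as [sigma [Ssig [Hs0 Hsig]]].
  set (p1 := fun q : NR3 => Fx (sigma q, snd q)). set (p2 := fun q : NR3 => Fy (sigma q, snd q)).
  assert (Sarg : smooth (fun q : NR3 => (sigma q, snd q) : NR3)).
  { refine (@smooth_pair NR3 R_NormedModule NR2 sigma (fun q => snd q) Ssig _).
    exact (smooth_linear _ (is_linear_snd (U := R_NormedModule) (V := NR2))). }
  assert (Sp1 : smooth p1) by exact (smooth_comp3 (U := NR3) Fx _ SFx Sarg).
  assert (Sp2 : smooth p2) by exact (smooth_comp3 (U := NR3) Fy _ SFy Sarg).
  assert (Sf : smooth (fun p => fst (Phi p))) by exact (smooth_fst_comp (U := NR2) (V := R_NormedModule) (W := R_NormedModule) Phi SPhi).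
  assert (Sg : smooth (fun p => snd (Phi p))) by exact (smooth_snd_comp (U := NR2) (V := R_NormedModule) (W := R_NormedModule) Phi SPhi).
  assert (SW1 : smooth (fun q : NR3 => fst (Phi (p1 q, p2 q)))) by exact (smooth_comp_R2 (U := NR3) (fun p => fst (Phi p)) p1 p2 Sf Sp1 Sp2).
  assert (SW2 : smooth (fun q : NR3 => snd (Phi (p1 q, p2 q)))) by exact (smooth_comp_R2 (U := NR3) (fun p => snd (Phi p)) p1 p2 Sg Sp1 Sp2).
  exists (fun t p => Phi (p1 (t, p), p2 (t, p))). split; [|split].
  - assert (EW : (fun q : NR3 => Phi (p1 (fst q, snd q), p2 (fst q, snd q))) =
                 (fun q : NR3 => Phi (p1 q, p2 q))).
    { apply functional_extensionality. intros q. now destruct q. }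
    exact (eq_ind_r (fun F : NR3 -> NR2 => smooth F)
      (smooth_R2_of_components (U := NR3) (fun q => Phi (p1 q, p2 q)) SW1 SW2) EW).
  - intros p Hd. transitivity (Phi (fst p, snd p)); [|now rewrite <- surjective_pairing].
    destruct (Hinit p Hd) as [I1 I2]. apply f_equal. apply (f_equal2 pair).
    + exact (eq_trans (f_equal (fun s => Fx (s, p)) (Hs0 p Hd)) I1).
    + exact (eq_trans (f_equal (fun s => Fy (s, p)) (Hs0 p Hd)) I2).
  - intros t p _ Hd. split.
    + apply HPhi. destruct p as [x y]. unfold p1, p2. cbn [snd]. set (s := sigma (t, (x, y))).
      assert (E : F (den (s, (x, y))) = den (s, (x, y))) by exact (locally_singleton _ _ (Hden s x y Hd)).
      unfold disk. cbn [fst snd].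
      refine (eq_ind_r (fun r => r ^ 2 + _ <= 1) _ (proj1 (RE _ E))).
      refine (eq_ind_r (fun r => _ + r ^ 2 <= 1) _ (proj2 (RE _ E))).
      exact (mob_in_disk a b Hab (cos s) (sin s) x y (Hcs s) Hd).
    + destruct (Hsig t p Hd) as [I1 I2]. fold p1 in I1. fold p2 in I2.
      assert (Hfield : Re (vfield eta (fun p => h (u p)) p) = m p / k p * V1 p /\
                       Im (vfield eta (fun p => h (u p)) p) = m p / k p * V2 p).
      { rewrite vfield_re, vfield_im, <- (Hn p Hd). destruct p as [x y].
        destruct (Hu x y Hd) as [_ [U1 U2]].
        assert (Hw := Hw_eps x y Hd). assert (Hnp := Hnc (x, y)).
        assert (M1 : dx (fun p => h (u p)) (x, y) = dx u (x, y) * m (x, y)).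
        { rewrite !dx_pd. exact (pd_comp_R (U := NR2) h u (1, 0) (x, y) Sh Su). }
        assert (M2 : dy (fun p => h (u p)) (x, y) = dy u (x, y) * m (x, y)).
        { rewrite !dy_pd. exact (pd_comp_R (U := NR2) h u (0, 1) (x, y) Sh Su). }
        rewrite M1, M2, U1, U2. unfold V1, V2, k. unfold Wf. cbn [fst snd]. rewrite HF2 by lra.
        split; field; repeat split; lra. }
      destruct Hfield as [-> ->].
      assert (Tr : forall f : R2 -> R, smooth f ->
        is_derive (fun s => f (p1 (s, p), p2 (s, p))) t
         (m p / k p * V1 p * dx (fun q => f (p1 (t, q), p2 (t, q))) p +
          m p / k p * V2 p * dy (fun q => f (p1 (t, q), p2 (t, q))) p)).
      { intros f Hf. set (w := fun q : NR3 => f (p1 q, p2 q)).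
        assert (Sw : smooth w) by exact (smooth_comp_R2 (U := NR3) f p1 p2 Hf Sp1 Sp2).
        evar_last. apply (is_derive_e0 w t p Sw).
        etransitivity; [|exact (f_equal2 (fun X Y => m p / k p * V1 p * X + m p / k p * V2 p * Y)
          (pd_e1_slice w t p) (pd_e2_slice w t p))]. cbv beta.
        assert (C : forall e, pd e w (t, p) = pd e p1 (t, p) * dx f (p1 (t, p), p2 (t, p)) +
           pd e p2 (t, p) * dy f (p1 (t, p), p2 (t, p))).
        { intros e. exact (pd_comp_R2 (U := NR3) f p1 p2 e (t, p) Hf Sp1 Sp2). }
        transitivity (m p / k p * pd ((0, (V1 p, V2 p)) : NR3) w (t, p)).
        - etransitivity; [exact (C e0)|].
          etransitivity; [exact (f_equal2 (fun X Y => X * _ + Y * _) I1 I2)|].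
          etransitivity; [|apply f_equal; symmetry; exact (C _)].
          assert (D : forall l A B X Y, l * A * X + l * B * Y = l * (A * X + B * Y)) by (intros; ring).
          apply D.
        - etransitivity; [apply f_equal; exact (pd_horizontal w _ _ _ Sw)|].
          assert (D : forall l A B X Y, l * (A * X + B * Y) = l * A * X + l * B * Y) by (intros; ring).
          apply D. }
      exact (is_derive_ext _ _ t _ (fun s => eq_sym (surjective_pairing (Phi (p1 (s, p), p2 (s, p)))))
        (is_derive_pair _ _ t _ _ (Tr _ Sf) (Tr _ Sg))).
Qed.
End Mobius.

(** * Localisation: positive integrals and the Poisson kernel *)

Lemma RInt_pos_of_point (k : R -> R) (A B c : R) :
  (forall x, continuous k x) -> (forall x, A < x < B -> 0 <= k x) -> A < c < B -> 0 < k c ->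
  0 < RInt k A B.
Proof.
  intros Ck Hk Hc Hkc.
  assert (Ex : forall a b, ex_RInt k a b).
  { intros. apply ex_RInt_of_continuous. intros; apply Ck. }
  assert (H2 : 0 < k c / 2) by lra.
  destruct (Ck c _ (locally_ball (k c) (mkposreal _ H2))) as [d Hd].
  set (e := Rmin (d / 2) (Rmin ((c - A) / 2) ((B - c) / 2))).
  assert (He : 0 < e).
  { unfold e. destruct d as [d Hd0]. simpl. repeat apply Rmin_glb_lt; lra. }
  assert (He1 : e <= d / 2) by apply Rmin_l.
  assert (He2 : e <= (c - A) / 2) by (eapply Rle_trans; [apply Rmin_r|apply Rmin_l]).
  assert (He3 : e <= (B - c) / 2) by (eapply Rle_trans; [apply Rmin_r|apply Rmin_r]).
  assert (Hd0 := cond_pos d).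
  rewrite <- (RInt_Chasles (V := R_CompleteNormedModule) k A (c - e) B) by apply Ex.
  rewrite <- (RInt_Chasles (V := R_CompleteNormedModule) k (c - e) (c + e) B) by apply Ex.
  assert (I1 : 0 <= RInt k A (c - e)) by (apply RInt_ge_0; [lra|apply Ex|intros; apply Hk; lra]).
  assert (I3 : 0 <= RInt k (c + e) B) by (apply RInt_ge_0; [lra|apply Ex|intros; apply Hk; lra]).
  assert (I2 : 0 < RInt k (c - e) (c + e)).
  { apply RInt_gt_0. lra. 2: intros; apply Ck. intros x Hx.
    assert (H : Rabs (k x - k c) < k c / 2).
    { apply (Hd x). change (Rabs (x - c) < d). apply Rabs_def1; lra. }
    apply Rabs_def2 in H. lra. }
  change (0 < RInt k A (c - e) + (RInt k (c - e) (c + e) + RInt k (c + e) B)). lra.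
Qed.

Lemma int_disk_pos (F : R2 -> R) (a : R2) : smooth F ->
  (forall p, interior_disk p -> 0 <= F p) -> interior_disk a -> 0 < F a -> 0 < int_disk F.
Proof.
  intros SF HF Ha HFa.
  rewrite int_disk_polar by (intros p; exact (smooth_continuous_R (U := NR2) F p SF)).
  destruct a as [x y]. unfold interior_disk in Ha. cbn [fst snd] in Ha.
  assert (Hx : -1 < x < 1) by nra.
  set (t := acos x).
  assert (Ct : cos t = x) by (apply cos_acos; lra).
  assert (Bt : 0 <= t <= PI) by apply acos_bound.
  assert (Ht : 0 < t < PI).
  { split.
    - destruct (Req_dec t 0) as [E|E]; [|lra]. rewrite E, cos_0 in Ct. lra.
    - destruct (Req_dec t PI) as [E|E]; [|lra]. rewrite E, cos_PI in Ct. lra. }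
  assert (Hs := sin_gt_0 t (proj1 Ht) (proj2 Ht)).
  assert (Hsc := sin2_cos2 t). unfold Rsqr in Hsc. rewrite Ct in Hsc.
  assert (Hu : -1 < y / sin t < 1).
  { assert (E : y = y / sin t * sin t) by (field; lra).
    assert ((y / sin t) ^ 2 * (sin t * sin t) < 1 * (sin t * sin t)).
    { replace ((y / sin t) ^ 2 * (sin t * sin t)) with (y ^ 2) by (field; lra). nra. }
    assert (0 < sin t * sin t) by nra.
    assert ((y / sin t) ^ 2 < 1) by nra. nra. }
  apply (RInt_pos_of_point _ 0 PI t).
  - intros th. refine (smooth_continuous_R (U := R_NormedModule) _ th _).
    apply (smooth_RInt_section (U := R_NormedModule) (-1) 1 ltac:(lra)
      (fun q => F (cos (snd q), fst q * sin (snd q)) * sin (snd q) ^ 2)). smooth_auto.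
  - intros th Hth. apply RInt_ge_0. lra. apply ex_RInt_smooth; smooth_auto.
    intros u Hu'. apply Rmult_le_pos. apply HF. now apply disk_polar. apply pow2_ge_0.
  - exact Ht.
  - apply (RInt_pos_of_point _ (-1) 1 (y / sin t)).
    + intros u. refine (smooth_continuous_R (U := R_NormedModule) (fun u => F (cos t, u * sin t) * sin t ^ 2) u _). smooth_auto.
    + intros u Hu'. apply Rmult_le_pos. apply HF. now apply disk_polar. apply pow2_ge_0.
    + exact Hu.
    + apply Rmult_lt_0_compat; [|nra]. rewrite Ct. replace (y / sin t * sin t) with y by (field; lra). exact HFa.
Qed.

Lemma int_disk_zero (F : R2 -> R) : smooth F -> (forall p, interior_disk p -> F p = 0) -> int_disk F = 0.
Proof.
  intros SF HF. rewrite (int_disk_ext F (fun _ => 0)).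
  - unfold int_disk. rewrite (RInt_ext _ (fun _ => 0)). rewrite RInt_const. apply Rmult_0_r.
    intros x _. rewrite RInt_const. apply Rmult_0_r.
  - intros p; exact (smooth_continuous_R (U := NR2) F p SF).
  - intros p. apply continuous_const.
  - exact HF.
Qed.

(** Transfers identities from an open arc or radius to its end point. *)
Lemma zero_at_right_end (k : R -> R) (A B : R) : A < B -> continuous k B ->
  (forall x, A < x < B -> k x = 0) -> k B = 0.
Proof.
  intros HAB Ck H0. destruct (Req_dec (k B) 0) as [|n]; [assumption|exfalso].
  assert (Hp := Rabs_pos_lt _ n).
  destruct (Ck _ (locally_ball (k B) (mkposreal _ Hp))) as [d Hd].
  set (x := B - Rmin (d / 2) ((B - A) / 2)).
  assert (H1 : 0 < Rmin (d / 2) ((B - A) / 2)) by (destruct d; simpl; apply Rmin_glb_lt; lra).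
  assert (H2 := Rmin_l (d / 2) ((B - A) / 2)). assert (H3 := Rmin_r (d / 2) ((B - A) / 2)).
  assert (H := Hd x). change (Rabs (x - B) < d -> Rabs (k x - k B) < Rabs (k B)) in H.
  assert (Hd0 := cond_pos d).
  rewrite H0 in H by (unfold x; lra). rewrite Rminus_0_l, Rabs_Ropp in H.
  apply (Rlt_irrefl (Rabs (k B))), H. unfold x. apply Rabs_def1; lra.
Qed.

Lemma cos_quadratic (t : R) : 2 - 2 * cos t <= t ^ 2.
Proof.
  assert (S : forall y, 0 <= y -> sin y ^ 2 <= y ^ 2).
  { intros y Hy. destruct (Req_dec y 0) as [->|n]. rewrite sin_0. lra.
    assert (H := sin_lt_x y ltac:(lra)). assert (B := SIN_bound y).
    destruct (Rle_dec 1 y). nra.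
    assert (P := sin_ge_0 y Hy ltac:(assert (H3 := PI_RGT_0); assert (H4 := PI2_1); lra)). nra. }
  assert (S' : sin (t / 2) ^ 2 <= (t / 2) ^ 2).
  { destruct (Rle_dec 0 (t / 2)). now apply S.
    replace (sin (t / 2) ^ 2) with (sin (- (t / 2)) ^ 2) by (rewrite sin_neg; ring).
    replace ((t / 2) ^ 2) with ((- (t / 2)) ^ 2) by ring. apply S. lra. }
  replace (cos t) with (cos (2 * (t / 2))) by (f_equal; field). rewrite cos_2a_sin. lra.
Qed.

Lemma abs_lt_of_pow2_lt (y d : R) : 0 < d -> y ^ 2 < d ^ 2 -> Rabs y < d.
Proof. intros Hd H. apply Rabs_def1; nra. Qed.

(** Write P for the kernel of the centre rho z0, z0 = (cos t0, sin t0).  On the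
    circle [G] >= h0 - C |z - z0|^2 for a suitable [C]: near z0 by continuity, far
    from it because [G] is bounded.  As rho |z - z0|^2 is at most the denominator
    of P, the second term contributes at most a multiple of 1 - rho, whereas P has
    mass at least 1. *)
Lemma poisson_concentration (G : R2 -> R) (t0 : R) : (forall p, continuous G p) ->
  - PI < t0 < PI -> 0 < G (cos t0, sin t0) ->
  exists rho, 0 < rho < 1 /\
    0 < RInt (fun t => (1 - rho ^ 2) / (1 + rho ^ 2 - 2 * rho * cos (t - t0)) * G (cos t, sin t)) (- PI) PI.
Proof.
  intros CG Ht0 HG. set (h0 := G (cos t0, sin t0) / 2).
  assert (Hh0 : 0 < h0) by (unfold h0; lra).
  assert (CGt : forall t, continuous (fun t => G (cos t, sin t)) t).
  { intros t. apply (continuous_comp (fun t => (cos t, sin t)) G); [|apply CG].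
    apply continuous_pair. apply continuous_cos. apply continuous_sin. }
  assert (HPI := PI_RGT_0).
  destruct (continuity_ab_min (fun t => G (cos t, sin t)) (- PI) PI) as [tm [Hm _]]. lra.
  { intros t _. apply continuity_pt_filterlim. apply CGt. }
  set (K := Rabs (G (cos tm, sin tm))).
  assert (HK0 : 0 <= K) by apply Rabs_pos.
  assert (HK : forall t, - PI <= t <= PI -> - K <= G (cos t, sin t)).
  { intros t Ht. specialize (Hm t Ht). cbv beta in Hm. unfold K.
    assert (H := Rle_abs (- G (cos tm, sin tm))). rewrite Rabs_Ropp in H. lra. }
  destruct (CG (cos t0, sin t0) _ (locally_ball (G (cos t0, sin t0)) (mkposreal _ Hh0))) as [d Hd].
  set (C := (h0 + K) / d ^ 2).
  assert (Hd0 : 0 < d ^ 2) by (apply pow_lt, cond_pos).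
  assert (HC : 0 < C) by (apply Rdiv_lt_0_compat; lra).
  set (dist := fun t => 2 - 2 * cos (t - t0)).
  assert (Hdist : forall t, dist t = (cos t - cos t0) ^ 2 + (sin t - sin t0) ^ 2).
  { intros t. unfold dist. rewrite cos_minus. assert (H1 := sin2_cos2 t). assert (H2 := sin2_cos2 t0).
    unfold Rsqr in *. simpl. nra. }
  assert (Hdist0 : forall t, 0 <= dist t).
  { intros t. rewrite Hdist. apply Rplus_le_le_0_compat; apply pow2_ge_0. }
  assert (Hmin : forall t, - PI <= t <= PI -> h0 - C * dist t <= G (cos t, sin t)).
  { intros t Ht. assert (Hp := Hdist0 t).
    destruct (Rlt_dec (dist t) (d ^ 2)) as [Hn|Hf].
    - assert (B : Rabs (G (cos t, sin t) - G (cos t0, sin t0)) < h0).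
      { apply (Hd (cos t, sin t)). rewrite Hdist in Hn. assert (Hd1 := cond_pos d).
        split; [change (Rabs (cos t - cos t0) < d)|change (Rabs (sin t - sin t0) < d)];
        (apply abs_lt_of_pow2_lt; [exact Hd1|]);
        assert (Q1 := pow2_ge_0 (cos t - cos t0)); assert (Q2 := pow2_ge_0 (sin t - sin t0)); lra. }
      apply Rabs_def2 in B. assert (0 <= C * dist t) by (apply Rmult_le_pos; lra).
      unfold h0 in *. lra.
    - apply Rnot_lt_le in Hf.
      assert (C * d ^ 2 <= C * dist t) by (apply Rmult_le_compat_l; [left; exact HC|exact Hf]).
      assert (E : C * d ^ 2 = h0 + K).
      { unfold C. field. apply Rgt_not_eq, cond_pos. }
      specialize (HK t Ht). lra. }
  (* 1 - rho: small enough for [t0 - e, t0 + e] to lie in the interval, and for the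
     quadratic term, of size at most 2 PI * 4 C e, to be at most half of h0. *)
  set (e := Rmin (Rmin (1 / 2) (h0 / (16 * PI * C))) (Rmin (t0 + PI) (PI - t0))).
  assert (HPC : 0 < 16 * PI * C) by (apply Rmult_lt_0_compat; lra).
  assert (He : 0 < e).
  { unfold e. repeat apply Rmin_glb_lt; try lra. now apply Rdiv_lt_0_compat. }
  assert (He1 : e <= 1 / 2) by (unfold e; eapply Rle_trans; [apply Rmin_l|apply Rmin_l]).
  assert (He2 : e <= h0 / (16 * PI * C)) by (unfold e; eapply Rle_trans; [apply Rmin_l|apply Rmin_r]).
  assert (He3 : e <= t0 + PI) by (unfold e; eapply Rle_trans; [apply Rmin_r|apply Rmin_l]).
  assert (He4 : e <= PI - t0) by (unfold e; eapply Rle_trans; [apply Rmin_r|apply Rmin_r]).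
  assert (He5 : e * (16 * PI * C) <= h0).
  { replace h0 with (h0 / (16 * PI * C) * (16 * PI * C)) by (field; lra).
    apply Rmult_le_compat_r; lra. }
  clearbody e. set (rho := 1 - e).
  exists rho. split. unfold rho; lra.
  set (W := fun t => 1 + rho ^ 2 - 2 * rho * cos (t - t0)).
  assert (HW : forall t, W t = e ^ 2 + rho * dist t) by (intros t; unfold W, dist, rho; ring).
  assert (HW0 : forall t, 0 < W t).
  { intros t. rewrite HW. assert (0 <= rho * dist t). { apply Rmult_le_pos. unfold rho; lra. apply Hdist0. } nra. }
  set (P := fun t => (1 - rho ^ 2) / W t).
  assert (HQ : 0 < 1 - rho ^ 2) by (unfold rho; nra).
  assert (CP : forall t, continuous P t).
  { intros t. apply (ex_derive_continuous P). unfold P, W. auto_derive. specialize (HW0 t). unfold W in HW0.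
    unfold Rminus in HW0. simpl in HW0. lra. }
  assert (HP0 : forall t, 0 < P t) by (intros t; apply Rdiv_lt_0_compat; auto).
  assert (ExP : forall a b, ex_RInt P a b).
  { intros. apply ex_RInt_of_continuous. intros; apply CP. }
  (* For |t - t0| < e the denominator is at most 2 e^2. *)
  assert (near : 1 <= RInt P (t0 - e) (t0 + e)).
  { replace 1 with (RInt (fun _ => / (2 * e)) (t0 - e) (t0 + e)).
    2: { rewrite RInt_const. change ((t0 + e - (t0 - e)) * / (2 * e) = 1). field. lra. }
    apply RInt_le. lra. apply ex_RInt_const. apply ExP. intros t Ht.
    assert (D : dist t <= e ^ 2). { eapply Rle_trans; [apply cos_quadratic|]. nra. }
    assert (W2 : W t <= 2 * e ^ 2). { rewrite HW. assert (0 <= dist t) by (apply Hdist0). unfold rho. nra. }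
    unfold P. apply Rmult_le_reg_r with (W t). apply HW0. unfold Rdiv. rewrite Rmult_assoc, Rinv_l by (specialize (HW0 t); lra).
    apply Rle_trans with (/ (2 * e) * (2 * e ^ 2)). apply Rmult_le_compat_l. left; apply Rinv_0_lt_compat; lra. exact W2.
    replace (/ (2 * e) * (2 * e ^ 2)) with e by (field; lra). unfold rho. nra. }
  assert (total : 1 <= RInt P (- PI) PI).
  { rewrite <- (RInt_Chasles (V := R_CompleteNormedModule) P (- PI) (t0 - e) PI) by apply ExP.
    rewrite <- (RInt_Chasles (V := R_CompleteNormedModule) P (t0 - e) (t0 + e) PI) by apply ExP.
    assert (I1 : 0 <= RInt P (- PI) (t0 - e)) by (apply RInt_ge_0; [lra|apply ExP|intros; left; apply HP0]).
    assert (I3 : 0 <= RInt P (t0 + e) PI) by (apply RInt_ge_0; [lra|apply ExP|intros; left; apply HP0]).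
    change (1 <= RInt P (- PI) (t0 - e) + (RInt P (t0 - e) (t0 + e) + RInt P (t0 + e) PI)). lra. }
  set (c0 := C * (1 - rho ^ 2) / rho).
  assert (lower : RInt (fun t => h0 * P t - c0) (- PI) PI <= RInt (fun t => P t * G (cos t, sin t)) (- PI) PI).
  { apply RInt_le. lra.
    - apply ex_RInt_of_continuous. intros t.
      apply (continuous_minus (fun t => h0 * P t) (fun _ => c0)); [|apply continuous_const].
      apply (continuous_mult (fun _ => h0) P). apply continuous_const. apply CP.
    - apply ex_RInt_of_continuous. intros t.
      apply (continuous_mult P (fun t => G (cos t, sin t))). apply CP. apply CGt.
    - intros t Ht. apply Rle_trans with (P t * (h0 - C * dist t)).
      2: { apply Rmult_le_compat_l. left; apply HP0. apply Hmin; lra. }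
      assert (H : P t * dist t <= (1 - rho ^ 2) / rho).
      { unfold P. apply Rmult_le_reg_r with (W t * rho). apply Rmult_lt_0_compat. apply HW0. unfold rho; lra.
        specialize (HW0 t). replace ((1 - rho ^ 2) / W t * dist t * (W t * rho)) with ((1 - rho ^ 2) * (rho * dist t)) by (field; lra).
        replace ((1 - rho ^ 2) / rho * (W t * rho)) with ((1 - rho ^ 2) * W t) by (field; unfold rho; lra).
        apply Rmult_le_compat_l. lra. rewrite HW. nra. }
      unfold c0. assert (C * (P t * dist t) <= C * ((1 - rho ^ 2) / rho)) by (apply Rmult_le_compat_l; lra).
      unfold Rdiv in *. lra. }
  eapply Rlt_le_trans; [|exact lower].
  rewrite (RInt_minus (V := R_CompleteNormedModule) (fun t => h0 * P t) (fun _ => c0)).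
  2: { apply (ex_RInt_scal (V := R_NormedModule) P). apply ExP. }
  2: apply ex_RInt_const.
  rewrite (RInt_scal (V := R_CompleteNormedModule) P) by apply ExP. rewrite RInt_const.
  change (0 < h0 * RInt P (- PI) PI - (PI - - PI) * c0).
  assert (Hc0 : c0 <= C * (4 * e)).
  { unfold c0, Rdiv. rewrite Rmult_assoc. apply Rmult_le_compat_l. lra.
    apply Rmult_le_reg_r with rho. unfold rho; lra. rewrite Rmult_assoc, Rinv_l by (unfold rho; lra). unfold rho. nra. }
  assert (h0 * 1 <= h0 * RInt P (- PI) PI) by (apply Rmult_le_compat_l; lra).
  assert ((PI - - PI) * c0 <= (PI - - PI) * (C * (4 * e))) by (apply Rmult_le_compat_l; lra).
  assert ((PI - - PI) * (C * (4 * e)) = e * (16 * PI * C) / 2) by field. lra.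
Qed.

Lemma poisson_integrand_continuous (G : R2 -> R) (t0 rho : R) : 0 < rho < 1 ->
  (forall p, continuous G p) -> forall t,
  continuous (fun t => (1 - rho ^ 2) / (1 + rho ^ 2 - 2 * rho * cos (t - t0)) * G (cos t, sin t)) t.
Proof.
  intros Hr CG t.
  apply (continuous_mult (fun t => (1 - rho ^ 2) / (1 + rho ^ 2 - 2 * rho * cos (t - t0)))
     (fun t => G (cos t, sin t))).
  - apply (ex_derive_continuous (fun t => (1 - rho ^ 2) / (1 + rho ^ 2 - 2 * rho * cos (t - t0)))).
    auto_derive. assert (B := COS_bound (t + - t0)). nra.
  - apply (continuous_comp (fun t => (cos t, sin t)) G); [|apply CG].
    apply continuous_pair. apply continuous_cos. apply continuous_sin.
Qed.

(** * The two conditions *)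

Lemma Im_dbar (F : R2 -> C) (p : R2) :
  Im (dbar F p) = / 2 * (dx (fun q => Im (F q)) p + dy (fun q => Re (F q)) p).
Proof. unfold dbar. cbn. ring. Qed.
Lemma Re_dbar (F : R2 -> C) (p : R2) :
  Re (dbar F p) = / 2 * (dx (fun q => Re (F q)) p - dy (fun q => Im (F q)) p).
Proof. unfold dbar. cbn. ring. Qed.

(** A unit tangent is k (-y, x) with k^2 = 1, and tau / conj tau = tau^2. *)
Lemma tangent_square (p : R2) (tau z : C) : boundary_disk p -> unit_tangent p tau ->
  Im (Cmult z (Cdiv tau (Cconj tau))) =
    - (2 * Re z * fst p * snd p + Im z * (fst p ^ 2 - snd p ^ 2)).
Proof.
  intros Hp [Hm Ht]. unfold boundary_disk in Hp. destruct p as [x y], tau as [t1 t2], z as [A B].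
  unfold Cmod, Re, Im in *. cbn [fst snd] in *.
  assert (H1 : t1 ^ 2 + t2 ^ 2 = 1).
  { rewrite <- (sqrt_sqrt (t1 ^ 2 + t2 ^ 2)) by nra. rewrite Hm. ring. }
  set (k := t2 * x - t1 * y).
  assert (E1 : t1 = - y * k).
  { unfold k. transitivity (t1 * (x ^ 2 + y ^ 2) - x * (t1 * x + t2 * y)). rewrite Hp, Ht; ring. ring. }
  assert (E2 : t2 = x * k).
  { unfold k. transitivity (t2 * (x ^ 2 + y ^ 2) - y * (t1 * x + t2 * y)). rewrite Hp, Ht; ring. ring. }
  assert (Hk : k ^ 2 = 1).
  { rewrite <- H1. rewrite E1, E2. transitivity (k ^ 2 * (x ^ 2 + y ^ 2)). rewrite Hp; ring. ring. }
  assert (D : t1 * (t1 * 1) + - t2 * (- t2 * 1) = 1) by lra.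
  cbn. rewrite D.
  transitivity (A * (2 * t1 * t2) + B * (t1 ^ 2 - t2 ^ 2)). field.
  rewrite E1, E2. transitivity (- (2 * A * x * y + B * (x ^ 2 - y ^ 2)) * k ^ 2). ring. rewrite Hk. ring.
Qed.

Section Main.
Context (mu eta n : R2 -> R) (Phi : R2 -> R2) (c : R).
Context (Smu : smooth mu) (SPhi : smooth Phi) (Sn : smooth n) (Hc : 0 < c) (Hnc : forall p, c <= n p)
  (Hn : forall p, disk p -> locally p (fun q => n q = eta q)).

Notation f := (fun p => fst (Phi p)).
Notation g := (fun p => snd (Phi p)).
Notation r := (fun p => / (2 * n p)).

Lemma smooth_Phi1 : @smooth NR2 R_NormedModule f.
Proof. exact (smooth_fst_comp (U := NR2) (V := R_NormedModule) (W := R_NormedModule) Phi SPhi). Qed.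
Lemma smooth_Phi2 : @smooth NR2 R_NormedModule g.
Proof. exact (smooth_snd_comp (U := NR2) (V := R_NormedModule) (W := R_NormedModule) Phi SPhi). Qed.
Lemma smooth_r : @smooth NR2 R_NormedModule r.
Proof.
  apply (smooth_inv (U := NR2) (fun p => 2 * n p)). intros p. specialize (Hnc p). lra. smooth_auto.
Qed.

Lemma weighted_hopf (q : R2) :
  Cmult (RtoC (mu (Phi q) ^ 2)) (hopf Phi q) = (hopf_re mu f g q, hopf_im mu f g q).
Proof.
  unfold hopf_re, hopf_im, weight. rewrite <- (surjective_pairing (Phi q)).
  unfold Cmult, RtoC, hopf, dot2, dx2, dy2. cbn [fst snd]. f_equal; ring.
Qed.

Lemma interior_condition (p : R2) : disk p ->
  Im (dbar (fun q : R2 => Cmult (RtoC (/ eta q))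
       (dbar (fun s : R2 => Cmult (RtoC (mu (Phi s) ^ 2)) (hopf Phi s)) q)) p) =
  / 2 * interior_density mu f g r p.
Proof.
  intros Hp.
  assert (E : forall q, dbar (fun s : R2 => Cmult (RtoC (mu (Phi s) ^ 2)) (hopf Phi s)) q =
    (/ 2 * hopf_dbar_re mu f g q, / 2 * hopf_dbar_im mu f g q)).
  { intros q. replace (fun s : R2 => Cmult (RtoC (mu (Phi s) ^ 2)) (hopf Phi s)) with
      (fun s : R2 => (hopf_re mu f g s, hopf_im mu f g s) : C).
    2: { apply functional_extensionality. intros s. symmetry. apply weighted_hopf. }
    apply injective_projections.
    - etransitivity; [apply Re_dbar|reflexivity].
    - etransitivity; [apply Im_dbar|]. cbn [fst snd]. unfold hopf_dbar_im. apply f_equal, Rplus_comm. }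
  rewrite Im_dbar. apply f_equal. unfold interior_density. apply (f_equal2 Rplus).
  - apply dx_ext_loc. generalize (Hn p Hp). apply filter_imp. intros q Hq.
    rewrite E, <- Hq. cbn. specialize (Hnc q). field. lra.
  - apply dy_ext_loc. generalize (Hn p Hp). apply filter_imp. intros q Hq.
    rewrite E, <- Hq. cbn. specialize (Hnc q). field. lra.
Qed.

(** Up to the positive factor mu^2(Phi), this is - Im(f_Phi dz/dzbar). *)
Definition boundary_density (p : R2) : R :=
  2 * hopf_re mu f g p * fst p * snd p + hopf_im mu f g p * (fst p ^ 2 - snd p ^ 2).

Lemma boundary_condition (p : R2) (tau : C) : boundary_disk p -> unit_tangent p tau ->
  mu (Phi p) ^ 2 * Im (Cmult (hopf Phi p) (Cdiv tau (Cconj tau))) = - boundary_density p.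
Proof.
  intros Hp Ht. rewrite (tangent_square p tau _ Hp Ht). unfold boundary_density.
  assert (H := weighted_hopf p).
  replace (hopf_re mu f g p) with (mu (Phi p) ^ 2 * Re (hopf Phi p)).
  replace (hopf_im mu f g p) with (mu (Phi p) ^ 2 * Im (hopf Phi p)). ring.
  - transitivity (Im (Cmult (RtoC (mu (Phi p) ^ 2)) (hopf Phi p))). cbn; ring. now rewrite H.
  - transitivity (Re (Cmult (RtoC (mu (Phi p) ^ 2)) (hopf Phi p))). cbn; ring. now rewrite H.
Qed.

Lemma disk_of_interior (p : R2) : interior_disk p -> disk p.
Proof. unfold interior_disk, disk. lra. Qed.
Lemma disk_of_boundary (p : R2) : boundary_disk p -> disk p.
Proof. unfold boundary_disk, disk. lra. Qed.
Lemma boundary_circle (t : R) : boundary_disk (cos t, sin t).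
Proof. unfold boundary_disk. cbn [fst snd]. assert (H := sin2_cos2 t). unfold Rsqr in H. simpl. lra. Qed.

Definition first_variation_value (psi : R2 -> R) : R :=
  int_disk (fun p => psi p * interior_density mu f g r p) +
  RInt (fun t => (cos t * dx psi (cos t, sin t) + sin t * dy psi (cos t, sin t)) * r (cos t, sin t)
      * boundary_density (cos t, sin t)) (- PI) PI.

(** On the open disk a solution of the transport equation has the data that
    [first_variation] requires at time 0. *)
Lemma transport_variation (psi : R2 -> R) (eps : R) (W : R -> R2 -> R2) :
  smooth psi -> (forall p, boundary_disk p -> psi p = 0) -> 0 < eps ->
  transport_solution eta psi Phi eps W ->
  is_derive (fun t => Hhat mu (W t)) 0 (first_variation_value psi).
Proof.
  intros Spsi H0 Heps [SW [W0 WD]].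
  assert (Wf : forall p, interior_disk p -> W 0 p = (fst (Phi p), snd (Phi p))).
  { intros p Hp. rewrite W0 by now apply disk_of_interior. now rewrite <- surjective_pairing. }
  evar_last.
  apply (first_variation mu f g psi r W Smu smooth_Phi1 smooth_Phi2 Spsi smooth_r H0 SW Wf).
  - intros p Hp. assert (Hd := disk_of_interior p Hp).
    destruct (WD 0 p ltac:(rewrite Rabs_R0; exact Heps) Hd) as [_ D].
    evar_last. exact D. rewrite vfield_re, vfield_im.
    assert (Hloc := interior_disk_open p Hp).
    assert (X : dx2 (W 0) p = (dx f p, dx g p)).
    { apply (f_equal2 pair); apply dx_ext_loc; (eapply filter_imp; [|exact Hloc]);
      intros q Hq; rewrite (Wf q Hq); reflexivity. }
    assert (Y : dy2 (W 0) p = (dy f p, dy g p)).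
    { apply (f_equal2 pair); apply dy_ext_loc; (eapply filter_imp; [|exact Hloc]);
      intros q Hq; rewrite (Wf q Hq); reflexivity. }
    rewrite X, Y, <- (locally_singleton _ _ (Hn p Hd)). unfold field1, field2. reflexivity.
  - unfold first_variation_value. apply f_equal. apply RInt_ext. intros t _. reflexivity.
Qed.

Lemma first_variation_value_zero (psi : R2 -> R) : smooth psi ->
  (forall p, interior_disk p -> psi p * interior_density mu f g r p = 0) ->
  (forall p, boundary_disk p ->
     (fst p * dx psi p + snd p * dy psi p) * boundary_density p = 0) ->
  first_variation_value psi = 0.
Proof.
  intros Spsi H1 H2. unfold first_variation_value. rewrite int_disk_zero.
  - rewrite (RInt_ext _ (fun _ => 0)). rewrite RInt_const.
    change (0 + (PI - - PI) * 0 = 0). ring.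
    intros t _. specialize (H2 _ (boundary_circle t)). cbn [fst snd] in H2.
    change ((cos t * dx psi (cos t, sin t) + sin t * dy psi (cos t, sin t)) * / (2 * n (cos t, sin t))
      * boundary_density (cos t, sin t) = 0).
    rewrite Rmult_assoc, (Rmult_comm (/ _)), <- Rmult_assoc, H2. ring.
  - assert (S := smooth_interior_density mu f g Smu smooth_Phi1 smooth_Phi2 r smooth_r).
    refine (@smooth_mult NR2 psi (interior_density mu f g r) Spsi S).
  - exact H1.
Qed.

(** For psi = h(u_a) the normal derivative of psi on the circle is h'(1) times
    2 (1 - |a|^2) / |1 - conj(a) z|^2, twice the Poisson kernel. *)
Lemma mobius_first_variation (a b : R) : a ^ 2 + b ^ 2 < 1 ->
  (forall p, disk p -> disk (Phi p)) ->
  (forall psi, smooth psi -> (forall p, boundary_disk p -> psi p = 0) ->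
     forall eps W, 0 < eps -> transport_solution eta psi Phi eps W ->
     is_derive (fun t => Hhat mu (W t)) 0 0) ->
  exists u : R2 -> R, smooth u /\
  (forall x y, disk (x, y) ->
     u (x, y) = ((x - a) ^ 2 + (y - b) ^ 2) / (mob_w1 a b x y ^ 2 + mob_w2 a b x y ^ 2)) /\
  forall h : R -> R, smooth h -> h 1 = 0 ->
    int_disk (fun p => h (u p) * interior_density mu f g r p) +
    RInt (fun t => Derive h 1 * (2 * mob_gap a b /
        (mob_w1 a b (cos t) (sin t) ^ 2 + mob_w2 a b (cos t) (sin t) ^ 2)) * r (cos t, sin t)
      * boundary_density (cos t, sin t)) (- PI) PI = 0.
Proof.
  intros Hab HPhi HQR. assert (G := mob_gap_bounds a b Hab).
  destruct (mobius_transport a b Hab eta n c Sn Hc Hnc (fun p Hp => locally_singleton _ _ (Hn p Hp)))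
    as [u [Su [Hu HW]]].
  exists u. split; [exact Su|]. split. { intros x y Hd. apply (Hu x y Hd). }
  intros h Sh Hh1.
  assert (Wpos : forall x y, disk (x, y) -> 0 < mob_w1 a b x y ^ 2 + mob_w2 a b x y ^ 2).
  { intros x y Hd. assert (H := mob_w_lower a b Hab x y Hd).
    assert (0 < mob_gap a b ^ 2) by (apply pow_lt; lra). lra. }
  assert (Hu1 : forall p, boundary_disk p -> u p = 1).
  { intros [x y] Hp. assert (Hd := disk_of_boundary _ Hp). destruct (Hu x y Hd) as [-> _].
    specialize (Wpos x y Hd). unfold boundary_disk in Hp. cbn [fst snd] in Hp.
    replace ((x - a) ^ 2 + (y - b) ^ 2) with (mob_w1 a b x y ^ 2 + mob_w2 a b x y ^ 2). field; lra.
    assert (H := mob_contract a b 1 0 x y ltac:(ring)). rewrite Hp in H.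
    unfold mob_z1, mob_z2 in H.
    transitivity ((1 * (x - a) - 0 * (y - b)) ^ 2 + (0 * (x - a) + 1 * (y - b)) ^ 2). lra. ring. }
  set (psi := fun p => h (u p)).
  assert (Spsi : @smooth NR2 R_NormedModule psi) by exact (smooth_comp_R (U := NR2) h u Sh Su).
  assert (H0 : forall p, boundary_disk p -> psi p = 0).
  { intros p Hp. unfold psi. now rewrite Hu1. }
  destruct (HW Phi h SPhi HPhi Sh) as [W HTW].
  assert (D1 := transport_variation psi 1 W Spsi H0 Rlt_0_1 HTW).
  assert (D2 := HQR psi Spsi H0 1 W Rlt_0_1 HTW).
  assert (Z : first_variation_value psi = 0).
  { rewrite <- (is_derive_unique _ _ _ D1). now apply is_derive_unique. }
  rewrite <- Z. unfold first_variation_value. apply f_equal. apply RInt_ext. intros t _.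
  assert (Hb := boundary_circle t). assert (Hd := disk_of_boundary _ Hb).
  destruct (Hu _ _ Hd) as [_ [U1 U2]]. specialize (Wpos _ _ Hd).
  assert (P1 : dx psi (cos t, sin t) = dx u (cos t, sin t) * Derive h 1).
  { rewrite <- (Hu1 _ Hb). rewrite !dx_pd. exact (pd_comp_R (U := NR2) h u (1, 0) _ Sh Su). }
  assert (P2 : dy psi (cos t, sin t) = dy u (cos t, sin t) * Derive h 1).
  { rewrite <- (Hu1 _ Hb). rewrite !dy_pd. exact (pd_comp_R (U := NR2) h u (0, 1) _ Sh Su). }
  set (x := cos t) in *. set (y := sin t) in *.
  assert (Key : x * dx u (x, y) + y * dy u (x, y) =
    2 * mob_gap a b / (mob_w1 a b x y ^ 2 + mob_w2 a b x y ^ 2)).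
  { rewrite U1, U2. unfold boundary_disk in Hb. cbn [fst snd] in Hb.
    assert (E : x * mob_v2 a b x y - y * mob_v1 a b x y = mob_w1 a b x y ^ 2 + mob_w2 a b x y ^ 2).
    { unfold mob_v1, mob_v2.
      transitivity ((x ^ 2 + y ^ 2 - a * x - b * y) * mob_w1 a b x y + mob_w2 a b x y * (b * x - a * y)). ring.
      rewrite Hb. unfold mob_w1, mob_w2. ring. }
    transitivity (2 * mob_gap a b * (x * mob_v2 a b x y - y * mob_v1 a b x y) /
      (mob_w1 a b x y ^ 2 + mob_w2 a b x y ^ 2) ^ 2). field; lra. rewrite E. field; lra. }
  rewrite P1, P2.
  transitivity ((x * dx u (x, y) + y * dy u (x, y)) * Derive h 1 * / (2 * n (x, y)) * boundary_density (x, y)).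
  rewrite Key. match goal with |- @eq _ ?l ?r => change (@eq R l r) end. ring.
  change ((x * dx u (x, y) + y * dy u (x, y)) * Derive h 1 * / (2 * n (x, y)) * boundary_density (x, y)
   = (x * (dx u (x, y) * Derive h 1) + y * (dy u (x, y) * Derive h 1)) * / (2 * n (x, y)) * boundary_density (x, y)).
  ring.
Qed.

Context (HPhi : forall p, disk p -> disk (Phi p)).
Context (HQR : forall psi, smooth psi -> (forall p, boundary_disk p -> psi p = 0) ->
     forall eps W, 0 < eps -> transport_solution eta psi Phi eps W ->
     is_derive (fun t => Hhat mu (W t)) 0 0).

Let ID := interior_density mu f g r.
Let SID : smooth ID := smooth_interior_density mu f g Smu smooth_Phi1 smooth_Phi2 r smooth_r.

(** Test with a bump h(u) supported where u < kap: this set is a neighbourhood of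
    p on which the density keeps the sign that it has at p, and h'(1) = 0 removes
    the boundary term. *)
Lemma interior_density_zero_interior (p : R2) : interior_disk p -> ID p = 0.
Proof.
  intros Hp. destruct (Req_dec (ID p) 0) as [|n0]; [assumption|exfalso].
  assert (Hpos := Rabs_pos_lt _ n0).
  destruct (smooth_continuous_R (U := NR2) ID p SID _ (locally_ball (ID p) (mkposreal _ Hpos))) as [d Hd].
  destruct p as [a b]. assert (Hab : a ^ 2 + b ^ 2 < 1) by exact Hp.
  destruct (mobius_first_variation a b Hab HPhi HQR) as [u [Su [Hu HL]]].
  (* u < kap forces |z - p| < d, because |1 - conj(p) z|^2 <= 4; and kap < 1 makes
     h vanish near the circle. *)
  set (kap := Rmin (1 / 2) (d ^ 2 / 4)).
  assert (Hd0 := cond_pos d).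
  assert (Hk0 : 0 < kap). { apply Rmin_glb_lt. lra. assert (0 < d ^ 2) by (apply pow_lt; lra). lra. }
  assert (Hk1 : kap <= 1 / 2) by apply Rmin_l.
  assert (Hk2 : kap <= d ^ 2 / 4) by apply Rmin_r.
  set (h := fun s => flat 0 (kap - s)).
  assert (Sh : smooth h).
  { refine (@smooth_comp_R R_NormedModule (flat 0) (fun s => kap - s) (smooth_flat 0) _). smooth_auto. }
  assert (Hh1 : h 1 = 0) by (apply flat_neg; lra).
  assert (Dh1 : Derive h 1 = 0).
  { apply is_derive_unique. evar_last.
    apply (is_derive_comp (flat 0) (fun s => kap - s)). apply is_derive_flat.
    auto_derive. trivial. reflexivity. rewrite !flat_neg by lra.
    replace (0 - INR 0 * 0) with 0 by ring. exact (Rmult_0_r _). }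
  specialize (HL h Sh Hh1). rewrite Dh1 in HL.
  rewrite (RInt_ext _ (fun _ => 0)) in HL.
  2: { intros t _. change (0 * (2 * mob_gap a b /
        (mob_w1 a b (cos t) (sin t) ^ 2 + mob_w2 a b (cos t) (sin t) ^ 2)) * / (2 * n (cos t, sin t))
      * boundary_density (cos t, sin t) = 0). ring. }
  rewrite RInt_const in HL. change (int_disk (fun p => h (u p) * ID p) + (PI - - PI) * 0 = 0) in HL.
  rewrite Rmult_0_r, Rplus_0_r in HL.
  assert (close : forall x y, disk (x, y) -> u (x, y) < kap -> Rabs (ID (x, y) - ID (a, b)) < Rabs (ID (a, b))).
  { intros x y Hdk Huk. apply (Hd (x, y)).
    rewrite Hu in Huk by exact Hdk.
    assert (Hw := mob_w_lower a b Hab x y Hdk). assert (G := mob_gap_bounds a b Hab).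
    assert (HG2 : 0 < mob_gap a b ^ 2) by (apply pow_lt; lra).
    set (W := mob_w1 a b x y ^ 2 + mob_w2 a b x y ^ 2) in *.
    assert (HW4 : W <= 4).
    { assert (E : W + ((1 + (a * x + b * y)) ^ 2 + (b * x - a * y) ^ 2) = 2 + 2 * ((a ^ 2 + b ^ 2) * (x ^ 2 + y ^ 2)))
        by (unfold W, mob_w1, mob_w2; ring).
      assert (H1 := pow2_ge_0 (1 + (a * x + b * y))). assert (H2 := pow2_ge_0 (b * x - a * y)).
      assert (Hdk' : x ^ 2 + y ^ 2 <= 1) by exact Hdk.
      assert (Q1 := pow2_ge_0 x). assert (Q2 := pow2_ge_0 y). assert (Q3 := pow2_ge_0 a). assert (Q4 := pow2_ge_0 b).
      assert ((a ^ 2 + b ^ 2) * (x ^ 2 + y ^ 2) <= 1 * 1) by (apply Rmult_le_compat; lra). lra. }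
    assert (S : (x - a) ^ 2 + (y - b) ^ 2 < d ^ 2).
    { apply Rlt_le_trans with (kap * W).
      - apply (Rmult_lt_compat_r W) in Huk; [|lra]. unfold Rdiv in Huk. rewrite Rmult_assoc, Rinv_l in Huk by lra. lra.
      - apply Rle_trans with (d ^ 2 / 4 * 4); [|lra]. apply Rmult_le_compat; lra. }
    assert (Q1 := pow2_ge_0 (x - a)). assert (Q2 := pow2_ge_0 (y - b)).
    split; [change (Rabs (x - a) < d)|change (Rabs (y - b) < d)];
    (apply abs_lt_of_pow2_lt; [exact Hd0|lra]). }
  assert (Sint : @smooth NR2 R_NormedModule (fun p => h (u p) * ID p)).
  { refine (@smooth_mult NR2 (fun p => h (u p)) ID (smooth_comp_R (U := NR2) h u Sh Su) SID). }
  assert (hcase : forall p, disk p -> h (u p) = 0 \/ (0 < h (u p) /\ Rabs (ID p - ID (a, b)) < Rabs (ID (a, b)))).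
  { intros [x y] Hdk. destruct (Rlt_dec (u (x, y)) kap) as [Hl|Hl].
    - right. split. apply flat0_pos. lra. now apply close.
    - left. apply flat_neg. lra. }
  assert (hab : 0 < h (u (a, b))).
  { rewrite Hu by (apply disk_of_interior; exact Hp). apply flat0_pos.
    replace ((a - a) ^ 2 + (b - b) ^ 2) with 0 by ring. unfold Rdiv. rewrite Rmult_0_l. lra. }
  destruct (Rlt_dec 0 (ID (a, b))) as [Hs|Hs].
  - apply (Rlt_irrefl 0). rewrite <- HL at 2. apply (int_disk_pos _ (a, b) Sint); [|exact Hp|now apply Rmult_lt_0_compat].
    intros q Hq. destruct (hcase q (disk_of_interior q Hq)) as [->|[H1 H2]]. lra.
    rewrite (Rabs_right (ID (a, b))) in H2 by lra. apply Rabs_def2 in H2. apply Rmult_le_pos; lra.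
  - assert (Hs' : ID (a, b) < 0) by lra.
    assert (Sint' : @smooth NR2 R_NormedModule (fun p => - (h (u p) * ID p))) by smooth_auto.
    assert (HL' : int_disk (fun p => - (h (u p) * ID p)) = 0).
    { assert (E := int_disk_plus _ _ Sint Sint').
      refine (eq_trans _ (eq_trans (eq_sym E) (int_disk_zero _ _ _))).
      - etransitivity; [symmetry; apply Rplus_0_l|]. apply (f_equal (fun z => z + _)). symmetry. exact HL.
      - refine (@smooth_plus NR2 _ _ Sint Sint').
      - intros q _. cbv beta. ring. }
    apply (Rlt_irrefl 0). rewrite <- HL' at 2. apply (int_disk_pos _ (a, b) Sint'); [|exact Hp|].
    + intros q Hq. destruct (hcase q (disk_of_interior q Hq)) as [->|[H1 H2]]. lra.
      rewrite (Rabs_left (ID (a, b))) in H2 by lra. apply Rabs_def2 in H2.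
      assert (0 <= h (u q) * - ID q) by (apply Rmult_le_pos; lra). lra.
    + assert (0 < h (u (a, b)) * - ID (a, b)) by (apply Rmult_lt_0_compat; lra). lra.
Qed.

Lemma interior_density_zero (p : R2) : disk p -> ID p = 0.
Proof.
  intros Hp. destruct p as [x y].
  assert (Sk : smooth (fun t : R => ID (t * x, t * y))).
  { refine (@smooth_comp2 R_NormedModule ID (fun t => (t * x, t * y)) SID _). smooth_auto. }
  assert (H := zero_at_right_end (fun t => ID (t * x, t * y)) 0 1 Rlt_0_1
    (smooth_continuous_R (U := R_NormedModule) _ 1 Sk)).
  cbv beta in H. rewrite !Rmult_1_l in H. apply H. intros t Ht. apply interior_density_zero_interior.
  unfold interior_disk, disk in *. cbn [fst snd] in *.
  replace ((t * x) ^ 2 + (t * y) ^ 2) with (t ^ 2 * (x ^ 2 + y ^ 2)) by ring.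
  assert (0 <= t ^ 2 < 1) by nra. assert (0 <= x ^ 2 + y ^ 2) by nra. nra.
Qed.

Lemma smooth_boundary_density : smooth boundary_density.
Proof.
  assert (S1 := smooth_hopf_re mu f g Smu smooth_Phi1 smooth_Phi2).
  assert (S2 := smooth_hopf_im mu f g Smu smooth_Phi1 smooth_Phi2).
  unfold boundary_density.
  refine (@smooth_plus NR2 (fun p => 2 * hopf_re mu f g p * fst p * snd p)
     (fun p => hopf_im mu f g p * (fst p ^ 2 - snd p ^ 2)) _ _).
  - refine (@smooth_mult NR2 (fun p => 2 * hopf_re mu f g p * fst p) (fun p => snd p) _ _); [|smooth_auto].
    refine (@smooth_mult NR2 (fun p => 2 * hopf_re mu f g p) (fun p => fst p) _ _); [|smooth_auto].
    exact (@smooth_mult NR2 (fun p => 2) (hopf_re mu f g) (smooth_const 2) S1).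
  - refine (@smooth_mult NR2 (hopf_im mu f g) (fun p => fst p ^ 2 - snd p ^ 2) S2 _). smooth_auto.
Qed.

(** Test with h(s) = s - 1; the interior term is zero by now. *)
Lemma poisson_integral_zero (t0 rho : R) : 0 < rho < 1 ->
  RInt (fun t => (1 - rho ^ 2) / (1 + rho ^ 2 - 2 * rho * cos (t - t0)) *
    (r (cos t, sin t) * boundary_density (cos t, sin t))) (- PI) PI = 0.
Proof.
  intros Hr.
  set (a := rho * cos t0). set (b := rho * sin t0).
  assert (Hsc := sin2_cos2 t0). unfold Rsqr in Hsc.
  assert (Eab : a ^ 2 + b ^ 2 = rho ^ 2).
  { unfold a, b. transitivity (rho ^ 2 * (sin t0 * sin t0 + cos t0 * cos t0)). ring. rewrite Hsc. ring. }
  assert (Hab : a ^ 2 + b ^ 2 < 1) by (rewrite Eab; nra).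
  destruct (mobius_first_variation a b Hab HPhi HQR) as [u [Su [Hu HL]]].
  assert (Sh : smooth (fun s : R => s - 1)) by smooth_auto.
  specialize (HL (fun s => s - 1) Sh (Rminus_diag_eq 1 1 eq_refl)). cbv beta in HL.
  rewrite int_disk_zero in HL.
  - rewrite Rplus_0_l in HL.
    assert (D1 : Derive (fun s => s - 1) 1 = 1).
    { apply is_derive_unique. auto_derive. trivial. ring. }
    rewrite D1 in HL.
    assert (HL2 : RInt (fun t => 2 * ((1 - rho ^ 2) / (1 + rho ^ 2 - 2 * rho * cos (t - t0)) *
       (r (cos t, sin t) * boundary_density (cos t, sin t)))) (- PI) PI = 0).
    { rewrite <- HL. apply RInt_ext. intros t _.
      assert (Hsct := sin2_cos2 t). unfold Rsqr in Hsct.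
      replace (1 + rho ^ 2 - 2 * rho * cos (t - t0)) with
        (mob_w1 a b (cos t) (sin t) ^ 2 + mob_w2 a b (cos t) (sin t) ^ 2).
      replace (mob_gap a b) with (1 - rho ^ 2) by (unfold mob_gap; lra).
      match goal with |- ?l = ?r => change (@eq R l r) end. unfold Rdiv. ring.
      transitivity (1 - 2 * (a * cos t + b * sin t) + (a ^ 2 + b ^ 2) * (sin t * sin t + cos t * cos t)).
      unfold mob_w1, mob_w2. ring. rewrite Eab, Hsct, cos_minus. unfold a, b. ring. }
    rewrite (RInt_scal (V := R_CompleteNormedModule)) in HL2.
    + match type of HL2 with scal 2 ?X = 0 => change (2 * X = 0) in HL2; lra end.
    + apply ex_RInt_of_continuous. intros t.
      apply (poisson_integrand_continuous (fun p => r p * boundary_density p) t0 rho Hr).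
      intros p. refine (smooth_continuous_R (U := NR2) (fun p => r p * boundary_density p) _ _).
      exact (@smooth_mult NR2 r boundary_density smooth_r smooth_boundary_density).
  - refine (@smooth_mult NR2 (fun p => u p - 1) ID _ SID). smooth_auto.
  - intros p Hp. change ((u p - 1) * ID p = 0). rewrite interior_density_zero_interior by exact Hp. ring.
Qed.

Lemma boundary_density_zero (p : R2) : boundary_disk p -> boundary_density p = 0.
Proof.
  set (G := fun p : R2 => r p * boundary_density p).
  assert (SG : @smooth NR2 R_NormedModule G).
  { exact (@smooth_mult NR2 r boundary_density smooth_r smooth_boundary_density). }
  assert (CG : forall p, continuous G p) by (intros q; exact (smooth_continuous_R (U := NR2) G q SG)).
  assert (open_arc : forall t, - PI < t < PI -> G (cos t, sin t) = 0).
  { intros t0 Ht0. destruct (Rtotal_order (G (cos t0, sin t0)) 0) as [H|[H|H]]; [|exact H|]; exfalso.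
    - destruct (poisson_concentration (fun p => - G p) t0) as [rho [Hrho HP]].
      intros q. apply (continuous_opp G). apply CG. exact Ht0. lra.
      assert (Z := poisson_integral_zero t0 rho Hrho).
      assert (E : RInt (fun t => (1 - rho ^ 2) / (1 + rho ^ 2 - 2 * rho * cos (t - t0)) * - G (cos t, sin t))
        (- PI) PI = - 0).
      { etransitivity; [|exact (f_equal Ropp Z)].
        etransitivity; [|apply (RInt_opp (V := R_CompleteNormedModule))].
        - apply RInt_ext. intros t _. apply Ropp_mult_distr_r_reverse.
        - apply ex_RInt_of_continuous. intros t.
          apply (poisson_integrand_continuous G t0 rho Hrho CG). }
      lra.
    - destruct (poisson_concentration G t0 CG Ht0 H) as [rho [Hrho HP]].
      assert (Z := poisson_integral_zero t0 rho Hrho).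
      apply (Rlt_irrefl 0). rewrite <- Z at 2. exact HP. }
  assert (SGt : smooth (fun t : R => G (cos t, sin t))).
  { refine (@smooth_comp2 R_NormedModule G (fun t => (cos t, sin t)) SG _). smooth_auto. }
  assert (HPI := PI_RGT_0).
  assert (at_pi : G (cos PI, sin PI) = 0).
  { apply (zero_at_right_end (fun t => G (cos t, sin t)) (- PI) PI). lra.
    exact (smooth_continuous_R (U := R_NormedModule) _ PI SGt). exact open_arc. }
  assert (all : forall t, - PI <= t <= PI -> G (cos t, sin t) = 0).
  { intros t Ht. destruct (Req_dec t PI) as [->|n1]. exact at_pi.
    destruct (Req_dec t (- PI)) as [->|n2].
    - rewrite cos_neg, sin_neg.
      replace (- sin PI) with (sin PI) by (rewrite sin_PI; ring). exact at_pi.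
    - apply open_arc. lra. }
  intros Hp. destruct p as [x y]. unfold boundary_disk in Hp. cbn [fst snd] in Hp.
  assert (Hx : -1 <= x <= 1) by nra.
  assert (Bt := acos_bound x). assert (Ct := cos_acos x Hx). assert (St := sin_acos x Hx).
  assert (Z : G (x, y) = 0).
  { destruct (Rle_dec 0 y) as [Hy|Hy].
    - rewrite <- (all (acos x)) by lra. rewrite Ct, St. do 2 f_equal.
      rewrite <- (sqrt_Rsqr y Hy). f_equal. unfold Rsqr. lra.
    - rewrite <- (all (- acos x)) by lra. rewrite cos_neg, sin_neg, Ct, St. do 2 f_equal.
      rewrite <- (Ropp_involutive y) at 1. f_equal.
      rewrite <- (sqrt_Rsqr (- y)) by lra. f_equal. unfold Rsqr. lra. }
  unfold G in Z. apply Rmult_integral in Z. destruct Z as [Z|Z]; [|exact Z].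
  exfalso. revert Z. apply Rinv_neq_0_compat. assert (Hq := Hnc (x, y)). lra.
Qed.
End Main.

Theorem proposition4p1
  (Sigma Sigma1 : R3 -> Prop)
  (HSigma : embedded_disk Sigma) (HSigma1 : embedded_disk Sigma1)
  (X Y : R2 -> R3) (mu eta : R2 -> R)
  (HX : conformal_diffeo Sigma X mu) (HY : conformal_diffeo Sigma1 Y eta)
  (Phi : R2 -> R2) (HPhi : OSigma mu eta Phi)
  (Q : R3 -> R3) (HQ : decomposition Sigma X Y Phi Q) :
  quasi_rigid Sigma X Y mu eta Phi Q <->
  ((forall p : R2, disk p ->
      Im (dbar (fun q : R2 =>
            Cmult (RtoC (/ eta q))
              (dbar (fun r : R2 => Cmult (RtoC (mu (Phi r) ^ 2)) (hopf Phi r)) q)) p)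
      = 0%R) /\
   (forall p : R2, boundary_disk p -> forall tau : C, unit_tangent p tau ->
      Im (Cmult (hopf Phi p) (Cdiv tau (Cconj tau))) = 0%R)).
Proof.
  destruct HX as [_ [Smu Hmu]]. destruct HY as [_ [Seta Heta]].
  destruct HPhi as [[SPhi [Psi [_ [HPD _]]]] _].
  assert (HPhi : forall p, disk p -> disk (Phi p)) by (intros p Hp; apply HPD, Hp).
  destruct (positive_smooth_extension eta Seta (fun p Hp => proj1 (Heta p Hp)))
    as [n [c [Sn [Hc [Hnc Hn]]]]].
  assert (mu_pos : forall p, disk p -> mu (Phi p) ^ 2 <> 0).
  { intros p Hp. apply pow_nonzero. apply Rgt_not_eq. apply Hmu. now apply HPhi. }
  split.
  - intros [_ HQR]. split.
    + intros p Hp. rewrite (interior_condition mu eta n Phi c Hc Hnc Hn p Hp).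
      rewrite (interior_density_zero mu eta n Phi c Smu SPhi Sn Hc Hnc Hn HPhi HQR p Hp). apply Rmult_0_r.
    + intros p Hp tau Ht. assert (E := boundary_condition mu Phi p tau Hp Ht).
      rewrite (boundary_density_zero mu eta n Phi c Smu SPhi Sn Hc Hnc Hn HPhi HQR p Hp), Ropp_0 in E.
      apply Rmult_integral in E. destruct E as [E|E]; [|exact E].
      exfalso. exact (mu_pos p (disk_of_boundary p Hp) E).
  - intros [H1 H2]. split; [exact HQ|]. intros psi Spsi H0 eps W Heps HW.
    evar_last.
    apply (transport_variation mu eta n Phi c Smu SPhi Sn Hc Hnc Hn psi eps W Spsi H0 Heps HW).
    apply (first_variation_value_zero mu n Phi c Smu SPhi Sn Hc Hnc psi Spsi).
    + intros p Hp. assert (Hd := disk_of_interior p Hp). specialize (H1 p Hd).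
      rewrite (interior_condition mu eta n Phi c Hc Hnc Hn p Hd) in H1.
      apply Rmult_integral in H1. destruct H1 as [H1|H1]. lra. rewrite H1. apply Rmult_0_r.
    + intros p Hp.
      assert (Ht : unit_tangent p (- snd p, fst p)).
      { unfold boundary_disk in Hp. destruct p as [x y]. cbn [fst snd] in *. split.
        - unfold Cmod. cbn [fst snd]. replace ((- y) ^ 2 + x ^ 2) with 1 by (rewrite <- Hp; ring). apply sqrt_1.
        - cbn. ring. }
      assert (E := boundary_condition mu Phi p _ Hp Ht). rewrite (H2 p Hp _ Ht), Rmult_0_r in E.
      assert (Z : boundary_density mu Phi p = 0) by lra. rewrite Z. apply Rmult_0_r.
Qed.
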